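(* Fix integers $r\ge1$, $s\ge0$, $m,n\ge1$. Let $V=\{(x_1,\dots,x_m,y_1,\dots,y_n)\in\mathbb R^{m+n}:\sum_ix_i=\sum_jy_j\}$ and, for nonempty proper subsets $I\subsetneq[m]$, $J\subsetneq[n]$, let $W_{I,J}=\{(x,y)\in V:\sum_{i\in I}x_i-\sum_{j\in J}y_j=0\}$. Let $\mathfrak c$ be any connected component (chamber) of $V\setminus\bigcup_{I,J}W_{I,J}$. Then there is a polynomial $P_{\mathfrak c}$ in $x_1,\dots,x_m,y_1,\dots,y_n$ with rational coefficients such that $h^{(r),s}_{\mu,\nu}=P_{\mathfrak c}(\mu,\nu)$ for every $(\mu,\nu)=(\mu_1,\dots,\mu_m,\nu_1,\dots,\nu_n)\in\mathfrak c$ with all $\mu_i,\nu_j$ positive integers. That is, $(\mu,\nu)\mapsto h^{(r),s}_{\mu,\nu}$ is piecewise polynomial with walls $W_{I,J}$.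
   Context: $[m]=\{1,\dots,m\}$. For tuples of positive integers $\mu=(\mu_1,\dots,\mu_m)$, $\nu=(\nu_1,\dots,\nu_n)$ (regarded as partitions) with $\sum\mu_i=\sum\nu_j=d$, the disconnected double Hurwitz number with $s$ completed $(r+1)$-cycles is $h^{(r),s}_{\mu,\nu}=\frac{1}{\prod_i\mu_i\prod_j\nu_j}\sum_{|\lambda|=d}\chi^\lambda_\mu\big(\tfrac{p_{r+1}(\lambda)}{(r+1)!}\big)^s\chi^\lambda_\nu$, where $\chi^\lambda_\mu$ is the irreducible character of $S_d$ indexed by $\lambda$ evaluated on cycle type $\mu$, and $p_k(\lambda)=\sum_{i\ge1}((\lambda_i-i+\tfrac12)^k-(-i+\tfrac12)^k)$ with $\lambda_i=0$ for $i>l(\lambda)$.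
   Formalization: The case s=0, m=n=1 is excluded: there are no walls, the only chamber is V, and h at ((d),(d)) equals 1/d for every d≥1, which is not given by a polynomial, so the claim fails there. *)

(* Defs.v *)
From HB Require Import structures.
From mathcomp Require Import all_boot all_order all_algebra all_fingroup.
From mathcomp Require Import all_solvable all_field all_character.
From mathcomp Require Import all_classical all_reals all_analysis.
(* Not imported: the notations of mpoly clash with those of mathcomp-analysis. *)
From mathcomp Require mpoly.

Set Implicit Arguments.
Unset Strict Implicit.
Unset Printing Implicit Defensive.

Import Order.TTheory GRing.Theory Num.Theory.
Import numFieldNormedType.Exports.

Local Open Scope ring_scope.

(* la_i is stored at position i - 1.  Trailing zeros are allowed; no definition
   below depends on them. *)
Definition is_partition d (la : seq nat) : bool :=
  sorted geq la && (sumn la == d).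

Definition conj_partition (la : seq nat) : seq nat :=
  mkseq (fun j => count (fun part => (j < part)%N) la) (sumn la).

(* The terms with i > l(la) in the defining series vanish.  Positions start at
   0, whence - i - 1/2 where the usual formula, with i >= 1, has - i + 1/2. *)
Definition shifted_power_sum (k : nat) (la : seq nat) : rat :=
  \sum_(0 <= i < size la)
     ((((nth 0%N la i)%:R - i%:R - 1 / 2) ^+ k) - ((- i%:R - 1 / 2) ^+ k)).

(* reshape_index la i is the index of the block containing i when
   {0, ..., d - 1} is cut into consecutive blocks of sizes la_1, la_2, ... *)
Definition young_subgroup d (la : seq nat) : {set 'S_d} :=
  [set g : 'S_d |
     [forall i : 'I_d, reshape_index la (g i) == reshape_index la i]]%SET.

Fact young_subgroup_group_set d la : group_set (@young_subgroup d la).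
Proof.
apply/group_setP; split=> [|g h]; first by rewrite inE; apply/forallP=> i; rewrite perm1.
rewrite !inE => /forallP gP /forallP hP; apply/forallP=> i.
by rewrite permM (eqP (hP _)) (eqP (gP _)).
Qed.
Canonical young_group d la := Group (@young_subgroup_group_set d la).

Fact cf_sign_subproof d :
  is_class_fun <<[set: 'S_d]>>%g [ffun g : 'S_d => (-1) ^+ odd_perm g : algC].
Proof.
apply: intro_class_fun => [g h _ _|g]; last by case/negP; rewrite mem_gen ?inE.
by rewrite odd_permJ.
Qed.
Definition cf_sign d : 'CF([set: 'S_d]) := Cfun 0 (cf_sign_subproof d).

(* The irreducible character chi^la of S_d indexed by the partition la of d:
   the unique irreducible constituent common to the permutation character
   Ind_{S_la}^{S_d} 1 and to Ind_{S_la'}^{S_d} sgn, where la' is the conjugate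
   of la (James and Kerber, "The Representation Theory of the Symmetric Group",
   section 2.1).  So chi^(d) is trivial and chi^(1^d) is the sign.  The default
   value is never reached when la is a partition of d. *)
Definition chi_index d (la : seq nat) : Iirr [set: 'S_d] :=
  odflt 0 [pick i | (i \in irr_constt
                             ('Ind[[set: 'S_d], young_group d la] 1))
                 && (i \in irr_constt
                             ('Ind[[set: 'S_d]]
                                ('Res[young_group d (conj_partition la)]
                                   (cf_sign d))))].

Definition chi d (la : seq nat) : 'CF([set: 'S_d]) := 'chi_(chi_index d la).

(* mu need not be sorted. *)
Definition has_cycle_type d (mu : seq nat) (g : 'S_d) : bool :=
  perm_eq [seq #|c| | c : {set 'I_d} <- enum (porbits g)] mu.

(* The default value is never reached when the parts of mu are positive and
   add up to d. *)
Definition perm_of_cycle_type d (mu : seq nat) : 'S_d :=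
  odflt 1%g [pick g | has_cycle_type mu g].

Definition chi_at d (la mu : seq nat) : algC :=
  chi d la (perm_of_cycle_type d mu).

(* The degree d is |mu|; the value is meaningful only if |mu| = |nu|.  Each
   partition of d occurs exactly once in the sum, padded with zeros to
   length d. *)
Definition double_hurwitz (r s : nat) (mu nu : seq nat) : algC :=
  let d := sumn mu in
  ((\prod_(a <- mu) a)%N * (\prod_(b <- nu) b)%N)%:R^-1 *
  \sum_(t : d.-tuple 'I_d.+1 | is_partition d (map val t))
     let la := map val t in
     chi_at d la mu
     * ratr (shifted_power_sum r.+1 la / (r.+1)`!%:R) ^+ s
     * chi_at d la nu.

Section Chambers.
Local Open Scope classical_set_scope.
Variables (R : realType) (m n : nat).
Implicit Types (v : 'rV[R]_(m + n)) (I : {set 'I_m}) (J : {set 'I_n}).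

Definition xcoord v (i : 'I_m) : R := v 0 (lshift n i).
Definition ycoord v (j : 'I_n) : R := v 0 (rshift m j).

Definition hurwitz_space : set 'rV[R]_(m + n) :=
  [set v | \sum_i xcoord v i = \sum_j ycoord v j].

Definition wall I J : set 'rV[R]_(m + n) :=
  [set v | hurwitz_space v /\
           \sum_(i in I) xcoord v i - \sum_(j in J) ycoord v j = 0].

Definition is_wall_index I J : bool :=
  [&& I != finset.set0, I != [set: 'I_m]%SET,
      J != finset.set0 & J != [set: 'I_n]%SET].

Definition wall_complement : set 'rV[R]_(m + n) :=
  hurwitz_space `\`
    \bigcup_(IJ in [set IJ : {set 'I_m} * {set 'I_n} | is_wall_index IJ.1 IJ.2])
      wall IJ.1 IJ.2.

Definition is_chamber (c : set 'rV[R]_(m + n)) : Prop :=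
  exists2 v, wall_complement v & c = connected_component wall_complement v.

End Chambers.

Definition profile_point (K : pzSemiRingType) m n
    (mu : m.-tuple nat) (nu : n.-tuple nat) : 'rV[K]_(m + n) :=
  row_mx (\row_i (tnth mu i)%:R) (\row_j (tnth nu j)%:R).

(* Main.v *)
Require Import Defs.
From mathcomp Require Import all_boot all_order all_algebra all_fingroup.
From mathcomp Require Import all_field all_character.
From mathcomp Require Import zify ring lra.

(* The proof is fermionic.  In the N-fold tensor power of the space with basis
   e_x, x in int, a vector is a function of the positions of N particles; the
   vacuum is the antisymmetrised state occupying the levels 0, ..., N - 1, and
   N = 2d is large enough for that state to behave as an infinite Dirac sea.

   Representation theory.  By Frobenius' formula chi^la at cycle type mu is the
   coefficient at la + delta of the raising operators alpha_{-mu_i} applied to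
   the vacuum.  The formula is derived from the description of chi^la as common
   constituent of Ind_{S_la} 1 and Ind_{S_la'} sgn: the alternating sum X of the
   permutation characters Ind_{S_(la + delta - w delta)} 1 is a virtual
   character of norm 1, and the only w for which the w-th term meets
   Ind_{S_la'} sgn is w = 1, with multiplicity 1.

   Hence h = <prod alpha_{mu_i} . F^s . prod alpha_{-nu_j}> / (prod mu prod nu)
   where F is a diagonal derivation annihilating the vacuum.  Expanding F^s by
   the Leibniz rule leaves vacuum expectations of operators E_k(f), which lower
   one particle by k with weight f at the midpoint of the jump.  A leftmost
   operator of energy k < 0 gives 0; one of energy k > 0 is commuted to the
   right, where it annihilates the vacuum, and each commutator merges two
   operators into one.  The energies that occur are partial sums of the mu_i and
   - nu_j, whose signs are constant on a chamber, so the recursion takes the same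
   steps for all profiles of the chamber and ends with a sum of a polynomial over
   k consecutive half-integers, which is polynomial in k and divisible by k.
   Each mu_i and nu_j divides the coefficient produced by the first commutator it
   enters, which absorbs the denominator. *)

Set Implicit Arguments.
Unset Strict Implicit.
Unset Printing Implicit Defensive.

Import Order.TTheory GRing.Theory Num.Theory.
Local Open Scope ring_scope.

(** * Particle states and shift operators *)

Section Wedge.
Variable N : nat.
Notation pos := {ffun 'I_N -> int}.
Notation state := ({ffun 'I_N -> int} -> rat).
Implicit Types (a b : pos) (phi psi : state) (k l : int) (w : 'S_N) (i j : 'I_N).

Definition unit_pos i k : pos := [ffun j => if j == i then k else 0].
Definition perm_pos w a : pos := [ffun i => a (w i)].
Definition delta : pos := [ffun i : 'I_N => (N - i.+1)%N%:Z].
Definition alternating phi := forall w a, phi (perm_pos w a) = (-1) ^+ w * phi a.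
Definition vacuum : state :=
  fun a => \sum_(w : 'S_N) (-1) ^+ w * (a == perm_pos w delta)%:R.

(* Acting on functions of positions, this moves a particle down by k. *)
Definition shift_op k (u : int -> rat) phi : state :=
  fun a => \sum_i u (a i) * phi (a + unit_pos i k).

(** The finite substitute for the Dirac sea: [D] measures how many bottom levels are still certain
    to be filled. *)
Definition deep (D : int) phi := forall a, phi a != 0 ->
  (forall i, 0 <= a i) /\ (forall v : int, 0 <= v < D -> exists i, a i = v).

Lemma perm_posD w a b : perm_pos w (a + b) = perm_pos w a + perm_pos w b.
Proof. by apply/ffunP=> i; rewrite !ffunE. Qed.

Lemma perm_posB w a b : perm_pos w (a - b) = perm_pos w a - perm_pos w b.
Proof. by apply/ffunP=> i; rewrite !ffunE. Qed.

Lemma perm_posM w v a : perm_pos w (perm_pos v a) = perm_pos (w * v) a.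
Proof. by apply/ffunP=> i; rewrite !ffunE permM. Qed.

Lemma perm_pos1 a : perm_pos 1 a = a.
Proof. by apply/ffunP=> i; rewrite !ffunE perm1. Qed.

Lemma perm_unit_pos w i k : perm_pos w (unit_pos (w i) k) = unit_pos i k.
Proof. by apply/ffunP=> j; rewrite !ffunE (inj_eq perm_inj). Qed.

Lemma alternating_dup phi a i j :
  alternating phi -> i != j -> a i = a j -> phi a = 0.
Proof.
move=> alt ij aij.
have := alt (tperm i j) a; rewrite odd_tperm ij expr1.
suff -> : perm_pos (tperm i j) a = a by lra.
by apply/ffunP=> x; rewrite ffunE; case: tpermP => [->|->|//]; rewrite aij.
Qed.

Lemma eq_shift_op k u phi psi : phi =1 psi -> shift_op k u phi =1 shift_op k u psi.
Proof. by move=> e a; apply: eq_bigr => i _; rewrite e. Qed.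

Lemma shift_opD k u phi psi a :
  shift_op k u (fun b => phi b + psi b) a = shift_op k u phi a + shift_op k u psi a.
Proof. by rewrite -big_split; apply: eq_bigr => i _; rewrite mulrDr. Qed.

Lemma shift_opZ k u (c : rat) phi a :
  shift_op k u (fun b => c * phi b) a = c * shift_op k u phi a.
Proof. by rewrite mulr_sumr; apply: eq_bigr => i _; rewrite mulrCA. Qed.

Lemma shift_op0 k u phi : phi =1 (fun=> 0) -> shift_op k u phi =1 (fun=> 0).
Proof. by move=> p a; apply: big1 => i _; rewrite p mulr0. Qed.

(** Terms that move two different particles cancel in the commutator; those where both operators act
    on the same particle compose to a single shift by [k + l]. *)
Lemma shift_op_comm k l u v phi a :
  shift_op k u (shift_op l v phi) a =
  shift_op l v (shift_op k u phi) a +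
  shift_op (k + l) (fun x => u x * v (x + k) - v x * u (x + l)) phi a.
Proof.
apply/eqP; rewrite -subr_eq0 opprD addrA subr_eq0; apply/eqP.
rewrite /shift_op.
under eq_bigr do rewrite mulr_sumr.
under [X in _ - X]eq_bigr do rewrite mulr_sumr.
rewrite [X in _ - X]exchange_big /= -sumrB; apply: eq_bigr => i _.
rewrite -sumrB (bigD1 i) //= big1 ?addr0; last first.
  move=> j ji; rewrite !ffunE (negPf ji) [i == j]eq_sym (negPf ji) !addr0.
  by rewrite mulrCA [a + _ + _]addrAC subrr.
rewrite !ffunE eqxx [a + _ + _]addrAC.
have -> : a + unit_pos i l + unit_pos i k = a + unit_pos i (k + l).
  by apply/ffunP=> j; rewrite !ffunE; case: eqP => _; rewrite ?addr0 // -addrA [l + k]addrC.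
ring.
Qed.

Lemma alternating_shift_op k u phi : alternating phi -> alternating (shift_op k u phi).
Proof.
move=> alt w a; rewrite /shift_op mulr_sumr.
rewrite [RHS](reindex_inj (@perm_inj _ w)); apply: eq_bigr => i _.
by rewrite !ffunE -(perm_unit_pos w) -perm_posD alt mulrCA.
Qed.

Lemma alternating_vacuum : alternating vacuum.
Proof.
move=> w a; rewrite /vacuum mulr_sumr (reindex_inj (mulgI w)); apply: eq_bigr => v _.
rewrite odd_permM signr_addb mulrA -perm_posM; congr (_ * (nat_of_bool _)%:R).
apply/eqP/eqP => [e|-> //].
by rewrite -[a]perm_pos1 -(mulVg w) -perm_posM e perm_posM mulVg perm_pos1.
Qed.

Lemma delta_inj : injective delta.
Proof.
move=> i j; rewrite !ffunE => e; apply: val_inj => /=.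
move: e (ltn_ord i) (ltn_ord j); case: i j => i /= _ [j /= _] [e]; lia.
Qed.

Lemma vacuum_perm w : vacuum (perm_pos w delta) = (-1) ^+ w.
Proof.
rewrite alternating_vacuum /vacuum (bigD1 1%g) //= odd_perm1 perm_pos1 eqxx big1.
  by rewrite addr0 mul1r mulr1.
move=> v nv; case: eqP => [/ffunP e|]; last by rewrite mulr0.
case/eqP: nv; apply/permP=> i; rewrite perm1.
by apply: delta_inj; rewrite (e i) [RHS]ffunE.
Qed.

Lemma vacuum_delta : vacuum delta = 1.
Proof. by have := vacuum_perm 1; rewrite perm_pos1 odd_perm1. Qed.

Lemma vacuum_neq0 a : vacuum a != 0 -> exists w, a = perm_pos w delta.
Proof.
case: (pickP (fun w => a == perm_pos w delta)) => [w /eqP -> _|none]; first by exists w.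
by rewrite /vacuum big1 ?eqxx // => w _; rewrite none mulr0.
Qed.

Lemma deep_vacuum : deep N vacuum.
Proof.
move=> a /vacuum_neq0 [w ->]; split=> [i|v /andP[v0 vN]]; first by rewrite !ffunE.
have lt : (N - `|v|.+1 < N)%N by lia.
exists ((w^-1)%g (Ordinal lt)); rewrite !ffunE permKV /=; lia.
Qed.

Lemma vacuum_lt a i : vacuum a != 0 -> a i < N.
Proof. by case/vacuum_neq0=> w ->; rewrite !ffunE; have := ltn_ord (w i); lia. Qed.

Lemma alternating_neq0_inj phi a : alternating phi -> phi a != 0 -> injective a.
Proof.
move=> alt nz i j e; apply/eqP/negP => /negP ij.
by case/eqP: nz; apply: alternating_dup ij e.
Qed.

(** A level [v] below D - |k| could only be vacated by the moved particle [i]. Then [a i] is within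
    |k| of [v], hence below [D] and already occupied by another particle, against the injectivity of
    [a]. *)
Lemma deep_shift_op D k u phi : alternating phi -> deep D phi ->
  (forall x, u x != 0 -> 0 <= x) -> deep (D - `|k|) (shift_op k u phi).
Proof.
move=> alt dp u0 a nz.
have [i /= ui] : exists i, u (a i) * phi (a + unit_pos i k) != 0.
  apply/existsP; apply: contraNT nz; rewrite negb_exists => /forallP h.
  by apply/eqP; apply: big1 => i _; apply/eqP; rewrite -[_ == _]negbK h.
have inj := alternating_neq0_inj (alternating_shift_op _ _ alt) nz.
move: ui; rewrite mulf_eq0 negb_or => /andP[ui pi].
have [ge0 cov] := dp _ pi.
have aE j : j != i -> (a + unit_pos i k) j = a j.
  by move=> ji; rewrite !ffunE (negPf ji) addr0.
have aiE : (a + unit_pos i k) i = a i + k by rewrite !ffunE eqxx.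
split=> [j|v vD].
  by have [->|ji] := eqVneq j i; [exact: u0 | rewrite -aE].
have [j ej] : exists j, (a + unit_pos i k) j = v by apply: cov; lia.
have [ji|ji] := eqVneq j i; last by exists j; rewrite -aE.
rewrite ji aiE in ej.
have [k0|k0] := eqVneq k 0; first by exists i; rewrite -ej k0 addr0.
have [j' ej'] : exists j', (a + unit_pos i k) j' = a i.
  by apply: cov; have := u0 _ ui; lia.
have ji' : j' != i by apply: contraNneq k0 => ji'; move: ej'; rewrite ji' aiE; lia.
by move: (aE _ ji') (ji'); rewrite ej' => /inj ->; rewrite eqxx.
Qed.

(* The particle would land on a level already occupied, so antisymmetry gives 0. *)
Lemma shift_op_deep0 D k u phi : alternating phi -> deep D phi -> k != 0 ->
  (forall a i, u (a i) != 0 -> phi (a + unit_pos i k) != 0 -> 0 <= a i < D) ->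
  shift_op k u phi =1 (fun=> 0).
Proof.
move=> alt dp k0 ub a; apply/eqP; apply: contraT => nz.
have inj := alternating_neq0_inj (alternating_shift_op _ _ alt) nz.
have [i /= ui] : exists i, u (a i) * phi (a + unit_pos i k) != 0.
  apply/existsP; apply: contraNT nz; rewrite negb_exists => /forallP h.
  by apply/eqP; apply: big1 => i _; apply/eqP; rewrite -[_ == _]negbK h.
move: ui; rewrite mulf_eq0 negb_or => /andP[ui pi].
have [j] := (dp _ pi).2 _ (ub _ _ ui pi); rewrite !ffunE.
have [->|ji] := eqVneq j i; first by move/(canRL (addKr _)) => e; rewrite e addNr eqxx in k0.
by rewrite addr0 => /inj e; rewrite e eqxx in ji.
Qed.

End Wedge.

(** * Energy operators *)

Section EnergyOperators.
Variable N : nat.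
Notation pos := {ffun 'I_N -> int}.
Notation state := ({ffun 'I_N -> int} -> rat).
Implicit Types (a b : pos) (phi psi : state) (k l x : int) (f g : {poly rat}).

(* Levels are centred at N - 1/2, the surface of the sea, and jumps across the
   bottom level 0 are cut off; the commutators then differ from those of the
   untruncated operators only deep inside the sea (see [shift_op_deep0]). *)
Definition midpoint k x : rat := x%:~R + k%:~R / 2 - (N%:R - 1 / 2).
Definition window k f x : rat :=
  if (0 <= x) && (0 <= x + k) then f.[midpoint k x] else 0.
Definition energy_op k f : state -> state := shift_op k (window k f).

Definition translate (c : rat) f : {poly rat} := f \Po ('X + c%:P).
(** The midpoints of two successive jumps differ by [l / 2] and [k / 2] from the midpoint of the
    composite jump, with signs that depend on the order of the jumps. *)
Definition bracket k l f g : {poly rat} :=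
  translate (- (l%:~R / 2)) f * translate (k%:~R / 2) g
  - translate (l%:~R / 2) f * translate (- (k%:~R / 2)) g.

Lemma horner_translate c f (y : rat) : (translate c f).[y] = f.[y + c].
Proof. by rewrite horner_comp !hornerE. Qed.

Lemma window_ge0 k f x : window k f x != 0 -> 0 <= x.
Proof. by rewrite /window; case: (0 <= x) => //=; rewrite eqxx. Qed.

Lemma windowE k f x : 0 <= x -> 0 <= x + k -> window k f x = f.[midpoint k x].
Proof. by rewrite /window => -> ->. Qed.

Lemma window0 k f x : x + k < 0 -> window k f x = 0.
Proof. by rewrite /window andbC leNgt => ->. Qed.

Lemma alternating_energy_op k f phi : alternating phi -> alternating (energy_op k f phi).
Proof. exact: alternating_shift_op. Qed.

Lemma deep_energy_op D k f phi : alternating phi -> deep D phi ->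
  deep (D - `|k|) (energy_op k f phi).
Proof. by move=> alt dp; apply: deep_shift_op => // x; apply: window_ge0. Qed.

(** From level [D] on no jump passes below level 0, so the windows cut nothing off and the weights
    agree. Below [D] the sea is filled, and [k + l != 0] lets [shift_op_deep0] discard the
    discrepancy. *)
Lemma energy_op_comm D k l f g phi a : alternating phi -> deep D phi ->
  `|k| + `|l| <= D -> k + l != 0 ->
  energy_op k f (energy_op l g phi) a =
  energy_op l g (energy_op k f phi) a + energy_op (k + l) (bracket k l f g) phi a.
Proof.
move=> alt dp leD kl; rewrite /energy_op shift_op_comm; congr (_ + _).
apply/eqP; rewrite -subr_eq0 -(@shift_op_deep0 _ D (k + l) (fun x => window k f x
  * window l g (x + k) - window l g x * window k f (x + l)
  - window (k + l) (bracket k l f g) x) phi alt dp kl _ a); last first.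
  move=> {}a i nz _; move: nz; move: {a}(a i) => x.
  case: (lerP 0 x) => x0; last first.
    by rewrite /window [0 <= x]leNgt x0 /= !mul0r !subrr eqxx.
  case: (ltP x D) => // xD; rewrite /window.
  have -> : 0 <= x + k by lia.
  have -> : 0 <= x + l by lia.
  have -> : 0 <= x + k + l by lia.
  have -> : 0 <= x + l + k by lia.
  have -> : 0 <= x + (k + l) by lia.
  rewrite x0 /= /bracket hornerD hornerN !hornerM !horner_translate.
  have -> : midpoint (k + l) x + - (l%:~R / 2) = midpoint k x.
    by rewrite /midpoint intrD; field.
  have -> : midpoint (k + l) x + - (k%:~R / 2) = midpoint l x.
    by rewrite /midpoint intrD; field.
  have -> : midpoint (k + l) x + k%:~R / 2 = midpoint l (x + k).
    by rewrite /midpoint !intrD; field.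
  have -> : midpoint (k + l) x + l%:~R / 2 = midpoint k (x + l).
    by rewrite /midpoint !intrD; field.
  by rewrite [g.[_] * _]mulrC subrr eqxx.
by rewrite /shift_op -sumrB; apply/eqP; apply: eq_bigr => i _; rewrite -mulrBl.
Qed.

Lemma energy_op_vacuum k f : 0 < k -> energy_op k f (@vacuum N) =1 (fun=> 0).
Proof.
move=> k0; apply: shift_op_deep0 (@alternating_vacuum N) (@deep_vacuum N) _ _.
  by rewrite gt_eqF.
move=> a i /window_ge0 a0 /vacuum_lt => /(_ i); rewrite !ffunE eqxx => aN.
have {}aN : a i + k < N by [].
lia.
Qed.

(** Evaluation at [delta] is the pairing with the vacuum on the left: for negative [k] it samples
    [phi] at [delta] with one particle moved down onto an occupied level. *)
Lemma energy_op_neg_delta k f phi : alternating phi -> k < 0 ->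
  energy_op k f phi (delta N) = 0.
Proof.
move=> alt k0; apply: big1 => i _; rewrite /window.
case: ifP => [/andP[d0 dk]|_]; last by rewrite mul0r.
have iE : delta N i = (N - i.+1)%N by rewrite ffunE.
have lt : (N - `|(delta N i + k)%R|.+1 < N)%N by have := ltn_ord i; lia.
have [j jE] : exists j, delta N j = delta N i + k.
  by exists (Ordinal lt); rewrite [LHS]ffunE /=; have := ltn_ord i; lia.
have ij : i != j by apply: contraTneq k0 => e; move: jE; rewrite -e; lia.
rewrite (alternating_dup alt ij) ?mulr0 // ![(delta N + _) _]ffunE jE.
by rewrite ![unit_pos _ _ _]ffunE eqxx eq_sym (negPf ij) addr0.
Qed.

Lemma sum_delta (h : int -> rat) : \sum_i h (delta N i) = \sum_(0 <= x < N) h x%:Z.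
Proof.
rewrite big_nat_rev /= big_mkord; apply: eq_bigr => i _; rewrite ffunE.
by congr (h (Posz _)); lia.
Qed.

(** Opposite energies have a diagonal commutator, outside the scope of [energy_op_comm]. Its two
    sums have the same summands, over the lowest N and the lowest N - k levels; what remains are the
    k jumps across the surface of the sea, with midpoints symmetric about 0. *)
Lemma energy_pair (k : nat) f g : (0 < k <= N)%N ->
  energy_op k f (energy_op (- k%:Z) g (@vacuum N)) (delta N) =
  \sum_(t < k) (f * g).[(k%:R - 1) / 2 - t%:R].
Proof.
move=> /andP[k0 kN].
rewrite /energy_op shift_op_comm.
rewrite [X in X + _](shift_op0 _ _ (energy_op_vacuum _ _)) // add0r subrr /shift_op.
under eq_bigr => i _.
  have -> : delta N + unit_pos i 0 = delta N.
    by apply/ffunP=> j; rewrite !ffunE; case: eqP; rewrite addr0.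
  rewrite vacuum_delta mulr1.
  over.
rewrite (sum_delta (fun x => window k f x * window (- k%:Z) g (x + k) -
  window (- k%:Z) g x * window k f (x - k%:Z))).
rewrite sumrB.
have e1 : \sum_(0 <= x < N) window k f x%:Z * window (- k%:Z) g (x%:Z + k) =
  \sum_(0 <= x < N) (f * g).[midpoint k x].
  apply: eq_bigr => x _; rewrite !windowE; try lia.
  by rewrite hornerM; congr (_ * g.[_]); rewrite /midpoint intrD intrN; field.
have e2 : \sum_(0 <= x < N) window (- k%:Z) g x%:Z * window k f (x%:Z - k%:Z) =
  \sum_(0 <= x < N - k) (f * g).[midpoint k x].
  rewrite (big_cat_nat (n := k)) //= big_nat big1 ?add0r => [|x xk]; last first.
    by rewrite window0 ?mul0r //; lia.
  rewrite -{1}[k]add0n big_addn; apply: eq_bigr => x _; rewrite !windowE; try lia.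
  rewrite hornerM mulrC /midpoint PoszD !intrD intrN.
  by congr (f.[_] * g.[_]); field.
rewrite e1 e2 (big_cat_nat (n := (N - k)%N)) ?leq_subr //=.
have addKl (x y : rat) : x + y - x = y by ring.
rewrite addKl.
rewrite big_nat_rev /= -{1}[(N - k)%N]add0n big_addn subKn // big_mkord.
apply: eq_bigr => t _; congr (_.[_]); rewrite /midpoint.
have -> : (N - k + N - (t + (N - k)).+1)%N%:Z = N%:Z - t%:Z - 1.
  by have := ltn_ord t; lia.
by rewrite !intrD !intrN !pmulrn; field.
Qed.

(** Normalised to vanish at [delta]; at the configuration of a partition it is p_(r+1) / (r+1)!, the
    eigenvalue of the completed cycle. *)
Definition charge r a : rat :=
  \sum_i ((midpoint 0 (a i)) ^+ r.+1 - (midpoint 0 (delta N i)) ^+ r.+1) / (r.+1)`!%:R.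
Definition cycle_op r phi : state := fun a => charge r a * phi a.
(** The change of [charge] in one jump, as a function of the midpoint: the particle leaves from
    [+ k / 2] and arrives at [- k / 2]. *)
Definition cycle_poly r k : {poly rat} :=
  (r.+1)`!%:R^-1 *: (('X - (k%:~R / 2)%:P) ^+ r.+1 - ('X + (k%:~R / 2)%:P) ^+ r.+1).

Lemma cycle_op_vacuum r : cycle_op r (@vacuum N) =1 (fun=> 0).
Proof.
move=> a; rewrite /cycle_op.
have [-> |/vacuum_neq0 [w ->]] := eqVneq (vacuum a) 0; first by rewrite mulr0.
rewrite /charge -mulr_suml sumrB.
have -> : \sum_i (midpoint 0 (perm_pos w (delta N) i)) ^+ r.+1 =
          \sum_i (midpoint 0 (delta N i)) ^+ r.+1.
  rewrite [RHS](reindex_inj (@perm_inj _ w)).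
  by apply: eq_bigr => i _; rewrite [perm_pos _ _ _]ffunE.
by rewrite subrr !mul0r.
Qed.

Lemma alternating_cycle_op r phi : alternating phi -> alternating (cycle_op r phi).
Proof.
move=> alt w a; rewrite /cycle_op alt mulrCA; congr (_ * (_ * _)).
rewrite /charge -!mulr_suml !sumrB; congr ((_ - _) * _).
by rewrite [RHS](reindex_inj (@perm_inj _ w)); apply: eq_bigr => i _; rewrite [perm_pos _ _ _]ffunE.
Qed.

Lemma cycle_op_comm r k f phi a :
  cycle_op r (energy_op k f phi) a =
  energy_op k f (cycle_op r phi) a + energy_op k (f * cycle_poly r k) phi a.
Proof.
rewrite /cycle_op /energy_op /shift_op mulr_sumr -big_split; apply: eq_bigr => i _ /=.
have -> : charge r (a + unit_pos i k) = charge r a +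
   ((midpoint 0 (a i + k)) ^+ r.+1 - (midpoint 0 (a i)) ^+ r.+1) / (r.+1)`!%:R.
  apply/eqP; rewrite [charge r a + _]addrC -subr_eq; apply/eqP; rewrite /charge -sumrB (bigD1 i) //=.
  rewrite big1 => [|j ji]; last by rewrite !ffunE (negPf ji) addr0 subrr.
  by rewrite addr0 ![(a + _) _]ffunE [unit_pos _ _ _]ffunE eqxx; ring.
rewrite mulrDl mulrDr -addrA mulrCA -[LHS]addr0; congr (_ + _).
rewrite /window; case: ifP => _; last by rewrite !mul0r addr0.
rewrite hornerM /cycle_poly !(hornerE, horner_exp).
have -> : midpoint k (a i) - k%:~R / 2 = midpoint 0 (a i).
  by rewrite /midpoint; field.
have -> : midpoint k (a i) + k%:~R / 2 = midpoint 0 (a i + k).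
  by rewrite /midpoint intrD; field.
rewrite /=.
by ring.
Qed.

Lemma eq_cycle_ops r n phi psi : phi =1 psi -> iter n (cycle_op r) phi =1 iter n (cycle_op r) psi.
Proof. by elim: n => //= n IH e a; rewrite /cycle_op IH. Qed.

Lemma cycle_opsD r n phi psi a : iter n (cycle_op r) (fun b => phi b + psi b) a =
  iter n (cycle_op r) phi a + iter n (cycle_op r) psi a.
Proof. by elim: n a => //= n IH a; rewrite /cycle_op IH mulrDr. Qed.

Lemma cycle_opsZ r n (c : rat) phi a :
  iter n (cycle_op r) (fun b => c * phi b) a = c * iter n (cycle_op r) phi a.
Proof. by elim: n a => //= n IH a; rewrite /cycle_op IH mulrCA. Qed.

Lemma cycle_ops0 r n phi : phi =1 (fun=> 0) -> iter n (cycle_op r) phi =1 (fun=> 0).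
Proof. by elim: n => //= n IH e a; rewrite /cycle_op IH // mulr0. Qed.

Definition energy_ops (s : seq (int * {poly rat})) phi : state :=
  foldr (fun p psi => energy_op p.1 p.2 psi) phi s.

Lemma energy_ops_cat s1 s2 phi :
  energy_ops (s1 ++ s2) phi = energy_ops s1 (energy_ops s2 phi).
Proof. by rewrite /energy_ops foldr_cat. Qed.

Lemma eq_energy_ops s phi psi : phi =1 psi -> energy_ops s phi =1 energy_ops s psi.
Proof. by elim: s => //= p s IH e; apply: eq_shift_op; apply: IH. Qed.

Lemma energy_opsD s phi psi a :
  energy_ops s (fun b => phi b + psi b) a = energy_ops s phi a + energy_ops s psi a.
Proof.
elim: s a => //= p s IH a.
by rewrite /energy_op (eq_shift_op _ _ IH) shift_opD.
Qed.

Lemma energy_opsZ s (c : rat) phi a :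
  energy_ops s (fun b => c * phi b) a = c * energy_ops s phi a.
Proof.
elim: s a => //= p s IH a.
by rewrite /energy_op (eq_shift_op _ _ IH) shift_opZ.
Qed.

Lemma energy_ops0 s phi : phi =1 (fun=> 0) -> energy_ops s phi =1 (fun=> 0).
Proof. by elim: s => //= p s IH e; apply: shift_op0; apply: IH. Qed.

Lemma alternating_energy_ops s phi : alternating phi -> alternating (energy_ops s phi).
Proof. by elim: s => //= p s IH alt; apply/alternating_energy_op/IH. Qed.

Lemma deep_energy_ops s D phi : alternating phi -> deep D phi ->
  deep (D - \sum_(p <- s) `|p.1|) (energy_ops s phi).
Proof.
move=> alt dp; elim: s => [|p s IH] /=; first by rewrite big_nil subr0.
rewrite big_cons [`|_| + _]addrC opprD addrA.
by apply: deep_energy_op => //; apply: alternating_energy_ops.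
Qed.

End EnergyOperators.

(** * Polynomiality of matrix elements *)

Section EnergyOpScale.
Variable N : nat.

Lemma energy_opZ k (c : rat) f (phi : {ffun 'I_N -> int} -> rat) a :
  energy_op k (c%:P * f) phi a = c * energy_op k f phi a.
Proof.
rewrite mulr_sumr; apply: eq_bigr => i _; rewrite mulrA; congr (_ * _).
by rewrite /window; case: ifP; rewrite ?mulr0 // hornerM hornerC.
Qed.

End EnergyOpScale.

(** * Central differences of polynomials *)

Section DifferencePolynomials.
Variable A : comNzRingType.
Implicit Types (c : A) (g : {poly A}).

(** With [c] half an energy, this is divisibility by that energy: the source of the factors that
    cancel the denominator of the Hurwitz number. *)
Lemma comp_poly_diff c g :
  exists h, (g \Po ('X + c%:P)) - (g \Po ('X + (- c)%:P)) = (c + c)%:P * h.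
Proof.
exists (\sum_(i < size g) g`_i *: \sum_(j < i)
         ('X + c%:P) ^+ (i.-1 - j) * ('X + (- c)%:P) ^+ j).
rewrite !comp_polyE.
rewrite -sumrB mulr_sumr; apply: eq_bigr => i _.
rewrite -scalerBr -scalerAr; congr (_ *: _).
by rewrite subrXX; congr (_ * _); rewrite !polyCN !polyCD; ring.
Qed.

End DifferencePolynomials.

(* The sums over half-integer steps in [energy_pair] telescope against [G]. *)
Lemma central_antidifference (F : {poly rat}) :
  exists G, (G \Po ('X + (1 / 2)%:P)) - (G \Po ('X + (- (1 / 2))%:P)) = F.
Proof.
have [n] := ubnP (size F); elim: n F => // n IH F.
rewrite ltnS leq_eqVlt => /predU1P[sF|]; last exact: IH.
case: n IH sF => [|n] IH sF.
  by exists 0; rewrite !comp_poly0 subr0; apply/esym/eqP; rewrite -size_poly_eq0 sF.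
pose D (G : {poly rat}) := (G \Po ('X + (1 / 2)%:P)) - (G \Po ('X + (- (1 / 2))%:P)).
(* In the central difference of X^(n+1) the binomial terms of index 0 cancel and those of index 1
   give (n+1) X^n; the rest has lower degree, so subtracting a multiple of X^(n+1) from the
   antidifference lowers the degree of [F]. *)
have DE : exists2 R : {poly rat}, D 'X^(n.+1) = (n.+1%:R : rat) *: ('X^n : {poly rat}) + R & (size R <= n)%N.
  rewrite /D !comp_Xn_poly.
  pose T (c : rat) (i : nat) : {poly rat} := ('X^(n.+1 - i) * c%:P ^+ i) *+ 'C(n.+1, i).
  exists (\sum_(i < n) (T (1 / 2) i.+2 - T (- (1 / 2)) i.+2)).
    rewrite !exprDn -sumrB 2!big_ord_recl /= !expr0 !mulr1 subrr add0r.
    congr (_ + _).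
    rewrite subn1 /= /bump /= add1n bin1 !expr1 -mulrnBl -mulrBr -polyCB.
    have -> : 1 / 2 - - (1 / 2) = 1 :> rat by field.
    by rewrite mulr1 scaler_nat.
  apply: (leq_trans (size_sum _ _ _)); apply/bigmax_leqP => i _.
  have sT c : (size (T c i.+2) <= n)%N.
    rewrite /T -polyC_exp -mulrnAr -polyCMn mulrC mul_polyC.
    by apply: leq_trans (size_scale_leq _ _) _; rewrite size_polyXn subSS; have := ltn_ord i; lia.
  by apply: leq_trans (size_polyD _ _) _; rewrite size_polyN geq_max !sT.
case: DE => R DE sR.
have DB G H : D (G - H) = D G - D H by rewrite /D !comp_polyB; ring.
have DZ (c : rat) G : D (c *: G) = c *: D G by rewrite /D !comp_polyZ scalerBr.
have DD G H : D (G + H) = D G + D H by rewrite /D !comp_polyD; ring.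
pose G1 := (F`_n / n.+1%:R) *: 'X^(n.+1) : {poly rat}.
have [|G2 G2E] := IH (F - D G1).
  rewrite ltnS; apply/leq_sizeP => j nj.
  rewrite /G1 DZ DE !coefE.
  have n0 : n.+1%:R != 0 :> rat by rewrite pnatr_eq0.
  have [-> | ne] := eqVneq j n.
    by rewrite [R`_n]nth_default // addr0 mulr1 divfK // subrr.
  have lt : (n < j)%N by rewrite ltn_neqAle eq_sym ne.
  have -> : R`_j = 0 by rewrite nth_default // (leq_trans sR).
  have -> : F`_j = 0 by rewrite nth_default // sF.
  by rewrite mulr0 addr0 mulr0 subr0.
by exists (G2 + G1); rewrite -/(D _) DD [D G2]G2E subrK.
Qed.

(** * Recursion on words of operators, uniform over the profiles of a chamber *)

Section PolynomialValues.
Variables (T : finType) (A : comNzRingType) (iota : {rmorphism rat -> A}).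
Variables (Theta : Type) (ev : Theta -> {rmorphism A -> rat}).
Variables (e : T -> Theta -> int) (X : T -> A).
Hypothesis evX : forall t th, ev th (X t) = (e t th)%:~R.
Hypothesis ev_iota : forall th c, ev th (iota c) = c.

Notation item := (seq T * option {poly A})%type.
Implicit Types (th : Theta) (S : seq T) (it : item) (s : seq item).

(** [T] indexes the initial operators, [Theta] the profiles, and [A] holds polynomials in the
    energies [X t], which [ev th] specialises. An item stands for the operator obtained by merging
    those listed in its first component. *)
Definition energy_sum S th : int := \sum_(t <- S) e t th.
Definition var_sum S : A := \sum_(t <- S) X t.
(* [None] stands for the constant polynomial 1, whose energy has not yet been
   factored out of the matrix element. *)
Definition item_poly it : {poly A} := odflt 1 it.2.
Definition item_fac it : A := if it.2 is None then var_sum it.1 else 1.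
Definition item_ev th it : int * {poly rat} :=
  (energy_sum it.1 th, map_poly (ev th) (item_poly it)).
(* Each operator uncovers at most as many levels of the sea as its energy, so this
   many levels keep the commutators of [energy_op_comm] valid. *)
Definition levels th : nat := (\sum_t `|e t th|)%N.
Definition matrix_element th s : rat :=
  energy_ops [seq item_ev th it | it <- s] (@vacuum (levels th)) (delta (levels th)).
(** Invariant of the recursion: each initial operator has been absorbed into exactly one item, so
    the energy of an item that is not alone is a proper nonempty partial sum. *)
Definition covers s :=
  perm_eq (flatten [seq it.1 | it <- s]) (enum T) /\ all (fun it => it.1 != [::]) s.
(** At least one item has had its energy factored out. The final pair of items yields one energy
    only, so at most one may still be pending by then. *)
Definition has_normal s := has (fun it => it.2 : bool) s.
Definition pending_factor s : A := \prod_(it <- s) item_fac it.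

Hypothesis const_sign : forall S, uniq S -> S != [::] -> (size S < #|T|)%N ->
  (forall th, 0 < energy_sum S th) \/ (forall th, energy_sum S th < 0).
Hypothesis total_energy : forall th, \sum_t e t th = 0.

Lemma ev_var_sum S th : ev th (var_sum S) = (energy_sum S th)%:~R.
Proof. by rewrite /var_sum /energy_sum rmorph_sum rmorph_sum; apply: eq_bigr => t _; rewrite evX. Qed.

Definition half : A := iota (1 / 2).
Definition translateA (c : A) (f : {poly A}) : {poly A} := f \Po ('X + c%:P).
Definition bracketA (K L : A) (f g : {poly A}) : {poly A} :=
  translateA (- (half * L)) f * translateA (half * K) g
  - translateA (half * L) f * translateA (- (half * K)) g.

Lemma map_translateA th c f :
  map_poly (ev th) (translateA c f) = translate (ev th c) (map_poly (ev th) f).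
Proof. by rewrite map_comp_poly rmorphD /= map_polyX map_polyC. Qed.

Lemma map_bracketA th S1 S2 f g :
  map_poly (ev th) (bracketA (var_sum S1) (var_sum S2) f g) =
  bracket (energy_sum S1 th) (energy_sum S2 th) (map_poly (ev th) f) (map_poly (ev th) g).
Proof.
rewrite rmorphB !rmorphM /= !map_translateA !rmorphN !rmorphM /half !ev_iota !ev_var_sum.
by rewrite /bracket ![1 / 2 * _]mulrC !mul1r.
Qed.

Lemma translateA1 c : translateA c 1 = 1.
Proof. exact: comp_polyC. Qed.

Lemma half_double c : half * c + half * c = c.
Proof.
rewrite /half -mulrDl -rmorphD.
have -> : 1 / 2 + 1 / 2 = 1 :> rat by field.
by rewrite rmorph1 mul1r.
Qed.

(** Against the constant weight 1 the bracket is a central difference whose step is the energy of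
    the constant item, hence divisible by that pending energy; two constant weights have bracket
    0. *)
Lemma merge_items it1 it2 : exists f,
  bracketA (var_sum it1.1) (var_sum it2.1) (item_poly it1) (item_poly it2) =
  (item_fac it1 * item_fac it2)%:P * f.
Proof.
case: it1 it2 => S1 [f|] [S2 [g|]]; rewrite /item_fac /item_poly /=.
- by exists (bracketA (var_sum S1) (var_sum S2) f g); rewrite !mul1r.
- have [h hE] := comp_poly_diff (half * var_sum S2) f.
  exists (- h); rewrite half_double in hE.
  by rewrite /bracketA !translateA1 !mulr1 mul1r mulrN -hE opprB.
- have [h hE] := comp_poly_diff (half * var_sum S1) g.
  exists h; rewrite half_double in hE.
  by rewrite /bracketA !translateA1 !mul1r mulr1 -hE.
- by exists 0; rewrite /bracketA !translateA1 subrr mulr0.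
Qed.

(** By linearity in the coefficients of [F] this reduces to monomials, which come from [rat]. *)
Lemma central_antidifferenceA (F : {poly A}) :
  exists G, translateA half G - translateA (- half) G = F.
Proof.
suff H n : exists G, translateA half G - translateA (- half) G =
                     \sum_(i < n) F`_i *: 'X^i.
  have [G GE] := H (size F); exists G; rewrite GE -poly_def; exact: coefK.
elim: n => [|n [G IH]].
  by exists 0; rewrite big_ord0 /translateA !comp_poly0 subr0.
have [g gE] := central_antidifference 'X^n.
exists (G + F`_n *: map_poly iota g).
rewrite big_ord_recr /= -IH /translateA !comp_polyD !comp_polyZ.
suff -> : 'X^n = translateA half (map_poly iota g) - translateA (- half) (map_poly iota g).
  by rewrite scalerBr /translateA; ring.
have <- : map_poly iota 'X^n = 'X^n by rewrite map_polyXn.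
rewrite -gE rmorphB /= !map_comp_poly /= !rmorphD /= map_polyX !map_polyC /=.
by rewrite /translateA rmorphN.
Qed.

(** The number of terms varies with the profile, but the sum telescopes to G(k/2) - G(-k/2), a
    central difference of step [k] taken at 0; this makes it polynomial in the energies and
    divisible by [k]. *)
Lemma half_integer_sum (F : {poly A}) S : exists Q : A, forall th (k : nat),
  energy_sum S th = k ->
  \sum_(t < k) (map_poly (ev th) F).[(k%:R - 1) / 2 - t%:R] = ev th (var_sum S * Q).
Proof.
have [G GE] := central_antidifferenceA F.
have [h hE] := comp_poly_diff (half * var_sum S) G.
exists h.[0] => th k Sk.
pose g := map_poly (ev th) G.
have evS : ev th (half * var_sum S) = k%:R / 2.
  by rewrite rmorphM ev_iota ev_var_sum Sk; field.
transitivity (g.[k%:R / 2] - g.[- (k%:R / 2)]).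
  pose a (t : nat) := - g.[k%:R / 2 - t%:R].
  transitivity (\sum_(0 <= t < k) (a t.+1 - a t)).
    rewrite big_mkord; apply: eq_bigr => t _.
    rewrite -GE rmorphB /= !map_translateA hornerD hornerN !horner_translate.
    rewrite rmorphN /half ev_iota /a -/g opprK addrC; congr (- g.[_] + g.[_]).
      by rewrite -[t.+1]addn1 natrD; field.
    by field.
  rewrite telescope_sumr // /a subr0 opprK addrC; congr (_ - g.[_]).
  by field.
rewrite rmorphM ev_var_sum Sk /g.
have := congr1 (fun p => ev th p.[0]) hE.
rewrite half_double !hornerE !horner_comp !hornerE rmorphB rmorphM ev_var_sum Sk => <-.
by rewrite -!horner_map /= rmorphN evS.
Qed.

Lemma covers_perm s1 s2 : perm_eq s1 s2 -> covers s1 -> covers s2.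
Proof.
move=> p12 [c1 n1]; split; last by rewrite -(perm_all _ p12).
by apply: perm_trans c1; rewrite perm_sym; apply/perm_flatten/perm_map.
Qed.

Lemma covers_energy_sum th s : covers s ->
  (\sum_(it <- s) `|energy_sum it.1 th| <= levels th) /\ \sum_(it <- s) energy_sum it.1 th = 0.
Proof.
move=> [c _]; split; last first.
  have := total_energy th.
  by rewrite -big_enum /= -(perm_big _ c) /= big_flatten big_map.
have -> : (levels th)%:Z = \sum_t `|e t th|.
  by rewrite /levels (big_morph Posz PoszD (erefl _)); apply: eq_bigr => t _; rewrite abszE.
rewrite -[X in _ <= X]big_enum /= -(perm_big _ c) /= big_flatten big_map.
by apply: ler_sum => it _; apply: ler_norm_sum.
Qed.

Lemma energy_sum_cat S1 S2 th : energy_sum (S1 ++ S2) th = energy_sum S1 th + energy_sum S2 th.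
Proof. exact: big_cat. Qed.

Lemma covers_head it s : covers (it :: s) -> s != [::] ->
  [/\ uniq it.1, it.1 != [::] & (size it.1 < #|T|)%N].
Proof.
move=> [c /= /andP[n1 n2]] s0; have := perm_uniq c; rewrite enum_uniq cat_uniq.
case/andP=> u _; split=> //; rewrite cardE -(perm_size c) size_cat.
case: s s0 n2 {c} => // it2 s _ /= /andP[n2 _]; rewrite size_cat.
by rewrite -[X in (X < _)%N]addn0 ltn_add2l addn_gt0 lt0n size_eq0 n2.
Qed.

Lemma covers_merge it1 it2 f s :
  covers (it1 :: it2 :: s) -> covers ((it1.1 ++ it2.1, f) :: s).
Proof.
move=> [c /= /and3P[n1 _ n2]]; split; first by rewrite /= -catA.
by rewrite /= n2 andbT; case: it1.1 n1.
Qed.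

(** This is how the chamber enters the recursion: the sign of the leading energy, and so the next
    step, is the same for all profiles. *)
Lemma covers_sign it s : covers (it :: s) -> s != [::] ->
  (forall th, 0 < energy_sum it.1 th) \/ (forall th, energy_sum it.1 th < 0).
Proof. by move=> c s0; have [u n lt] := covers_head c s0; apply: const_sign. Qed.

(** As [pre ++ post] is nonempty, the merged energy is a proper partial sum and so nonzero; the
    levels still filled after [post] suffice for both energies. These are the conditions of
    [energy_op_comm]. *)
Lemma matrix_element_swap th pre it1 it2 post f :
  covers (pre ++ it1 :: it2 :: post) -> (0 < size (pre ++ post))%N ->
  bracketA (var_sum it1.1) (var_sum it2.1) (item_poly it1) (item_poly it2) =
    (item_fac it1 * item_fac it2)%:P * f ->
  matrix_element th (pre ++ it1 :: it2 :: post) =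
  matrix_element th (pre ++ it2 :: it1 :: post) +
  ev th (item_fac it1 * item_fac it2) *
    matrix_element th (pre ++ (it1.1 ++ it2.1, Some f) :: post).
Proof.
move=> c sz fE; rewrite /matrix_element !map_cat /= !energy_ops_cat.
set vac := @vacuum (levels th); set phi := energy_ops [seq item_ev th it | it <- post] vac.
have [le0 _] := covers_energy_sum th c.
have altp : alternating phi by apply/alternating_energy_ops/alternating_vacuum.
have dp : deep ((levels th)%:Z - \sum_(it <- post) `|energy_sum it.1 th|) phi.
  have := @deep_energy_ops _ [seq item_ev th it | it <- post] _ _ (@alternating_vacuum _)
    (@deep_vacuum (levels th)).
  by rewrite big_map.
have c' : covers (it1 :: it2 :: pre ++ post).
  by apply: covers_perm c; rewrite perm_catC /= !perm_cons perm_catC.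
have ne0 : energy_sum it1.1 th + energy_sum it2.1 th != 0.
  rewrite -energy_sum_cat.
  have [|/(_ th)|/(_ th)] := covers_sign (covers_merge (Some f) c').
  - by rewrite -size_eq0 -lt0n.
  - by move/gt_eqF/negbT.
  - by move/lt_eqF/negbT.
have leD : `|energy_sum it1.1 th| + `|energy_sum it2.1 th| <=
    (levels th)%:Z - \sum_(it <- post) `|energy_sum it.1 th|.
  rewrite lerBrDr; apply: le_trans le0; rewrite big_cat !big_cons /= -addrA lerDr.
  exact: sumr_ge0.
rewrite -energy_opsZ -energy_opsD; apply: eq_energy_ops => a.
rewrite /= (energy_op_comm _ _ _ altp dp leD ne0); congr (_ + _).
rewrite -energy_sum_cat -map_bracketA fE [map_poly _ (_%:P * _)]rmorphM /= map_polyC energy_opZ.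
by rewrite energy_sum_cat.
Qed.

Definition element_poly s := exists Q, forall th, matrix_element th s = ev th (pending_factor s * Q).

(** The operator of positive energy travels right until it annihilates the vacuum. Each commutator
    leaves a word with one item fewer, containing a normalised item, to which [rec] applies;
    starting from three items, two remain. *)
Lemma element_poly_pass it1 post pre :
  covers (pre ++ it1 :: post) -> (3 <= size (pre ++ it1 :: post))%N ->
  (forall th, 0 < energy_sum it1.1 th) ->
  (forall s, size s = size (pre ++ post) -> covers s -> has_normal s -> element_poly s) ->
  element_poly (pre ++ it1 :: post).
Proof.
elim: post pre => [|it2 post IH] pre c sz pos rec.
  exists 0 => th; rewrite mulr0 rmorph0 /matrix_element map_cat energy_ops_cat.
  by apply: energy_ops0 => /= b; apply: energy_op_vacuum.
have c' : covers (rcons pre it2 ++ it1 :: post).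
  apply: covers_perm c; rewrite cat_rcons perm_cat2l.
  by rewrite -cat1s -[_ :: it1 :: _]cat1s -!(cat1s _ post) perm_catCA.
have [] := IH (rcons pre it2) c' => [||s se|Q1 Q1E] //.
- by move: sz; rewrite !size_cat size_rcons /=; lia.
- by apply: rec; rewrite se !size_cat size_rcons /=; lia.
have [f fE] := merge_items it1 it2.
have [] := rec (pre ++ (it1.1 ++ it2.1, Some f) :: post) => [|||Q2 Q2E].
- by rewrite !size_cat.
- have p1 : perm_eq (pre ++ it1 :: it2 :: post) (it1 :: it2 :: pre ++ post).
    by rewrite perm_catC /= !perm_cons perm_catC.
  apply: covers_perm (covers_merge (Some f) (covers_perm p1 c)).
  by rewrite perm_sym perm_catC /= perm_cons perm_catC.
- by rewrite /has_normal has_cat /= orbT.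
exists (Q1 + Q2) => th.
rewrite (matrix_element_swap th c _ fE); last first.
  by move: sz; rewrite !size_cat /=; lia.
rewrite -cat_rcons Q1E Q2E -rmorphM -rmorphD; congr (ev th _).
by rewrite /pending_factor !big_cat !big_cons /= big_rcons /= [item_fac (_, Some _)]/item_fac /=; ring.
Qed.

(** The two energies are opposite. If the first is negative the pairing is 0; if it is positive,
    [half_integer_sum] supplies one factor, which absorbs the single energy that may still be
    pending. *)
Lemma element_poly_pair it1 it2 : covers [:: it1; it2] ->
  has_normal [:: it1; it2] -> element_poly [:: it1; it2].
Proof.
move=> c nrm.
have [//|pos|neg] := covers_sign c; last first.
  exists 0 => th; rewrite mulr0 rmorph0 /matrix_element /=.
  by apply: energy_op_neg_delta => //; apply/alternating_energy_op/alternating_vacuum.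
have e2 th : energy_sum it2.1 th = - energy_sum it1.1 th.
  by have [_] := covers_energy_sum th c; rewrite !big_cons big_nil; lia.
have [Q QE] := half_integer_sum (item_poly it1 * item_poly it2) it1.1.
have sumE th : matrix_element th [:: it1; it2] = ev th (var_sum it1.1 * Q).
  have [le0 _] := covers_energy_sum th c.
  rewrite !big_cons big_nil in le0.
  case kE : (energy_sum it1.1 th) (pos th) => [k|//] k0.
  rewrite -(QE th k kE) rmorphM /= -(@energy_pair (levels th)); last by rewrite kE e2 kE in le0; lia.
  by rewrite /matrix_element /= e2 kE.
(* The pending energy may belong to either item; the two differ only by a sign. *)
have X2 th : ev th (var_sum it2.1) = - ev th (var_sum it1.1).
  by rewrite !ev_var_sum e2 intrN.
case: it1 it2 nrm X2 sumE {c pos e2 QE} => [S1 [f|]] [S2 [g|]] //= _ X2 sumE.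
- by exists (var_sum S1 * Q) => th; rewrite sumE /pending_factor !big_cons big_nil !mul1r.
- exists (- Q) => th; rewrite sumE /pending_factor !big_cons big_nil /item_fac /= mul1r mulr1.
  by rewrite !rmorphM rmorphN X2 mulrNN.
- by exists Q => th; rewrite sumE /pending_factor !big_cons big_nil /item_fac /= !mulr1.
Qed.

(** Longer words shrink by [element_poly_pass], or vanish if the first energy is negative. Two
    untouched items are excluded: their matrix element carries the energy once while it is pending
    twice. *)
Theorem element_polyP s : covers s -> (2 <= size s)%N ->
  (3 <= size s)%N || has_normal s -> element_poly s.
Proof.
have [n] := ubnP (size s); elim: n s => // n IH s; rewrite ltnS => sn c sz2 h.
have [sz3|sz3] := leqP 3 (size s); last first.
  case: s sn c sz2 sz3 h => [|it1 [|it2 [|? ?]]] //= _ c _ _; exact: element_poly_pair.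
case: s sn c sz3 {h sz2} => // it1 post sn c sz3.
have [|pos|neg] := covers_sign c; first by case: post sz3 {sn c}.
- apply: (@element_poly_pass it1 post [::]) => // s' /= se c' nrm.
  by apply: IH => //; rewrite ?nrm ?orbT ?se //; move: sn sz3 => /=; lia.
- exists 0 => th; rewrite mulr0 rmorph0 /matrix_element /=.
  by apply: energy_op_neg_delta => //; apply/alternating_energy_ops/alternating_vacuum.
Qed.

(** * Commuting the cycle operators to the vacuum *)

Variable r : nat.

Definition cycle_polyA (K : A) : {poly A} :=
  (iota (r.+1)`!%:R^-1)%:P *
  (translateA (- (half * K)) 'X^(r.+1) - translateA (half * K) 'X^(r.+1)).

Lemma map_cycle_polyA th S :
  map_poly (ev th) (cycle_polyA (var_sum S)) = cycle_poly r (energy_sum S th).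
Proof.
rewrite rmorphM rmorphB /= !map_translateA map_polyXn map_polyC /= ev_iota.
rewrite /cycle_poly mul_polyC /translate !comp_Xn_poly rmorphN rmorphM /half ev_iota.
by rewrite ev_var_sum [1 / 2 * _]mulrC mul1r polyCN.
Qed.

(** The polynomial of a cycle operator is itself a central difference with the energy as step, so
    this commutator too releases a pending energy. *)
Lemma cycle_item it : exists f,
  item_poly it * cycle_polyA (var_sum it.1) = (item_fac it)%:P * f.
Proof.
case: it => S [f|]; rewrite /item_fac /item_poly /=.
  by exists (f * cycle_polyA (var_sum S)); rewrite !mul1r.
have [h hE] := comp_poly_diff (half * var_sum S) 'X^(r.+1).
rewrite half_double in hE.
exists (- (iota (r.+1)`!%:R^-1)%:P * h).
rewrite mul1r mulrCA -hE /cycle_polyA /translateA; ring.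
Qed.

Definition cycle_element_poly n s1 s2 := exists Q, forall th,
  energy_ops [seq item_ev th it | it <- s1] (iter n (cycle_op r)
    (energy_ops [seq item_ev th it | it <- s2] (@vacuum (levels th))))
    (delta (levels th)) = ev th (pending_factor (s1 ++ s2) * Q).

(** The rightmost cycle operator travels right until it annihilates the vacuum. Each commutator uses
    it up and leaves a normalised item, which is why [0 < n] is an alternative to the other two
    conditions. *)
Theorem cycle_element_polyP n s1 s2 : covers (s1 ++ s2) -> (2 <= size (s1 ++ s2))%N ->
  [|| (3 <= size (s1 ++ s2))%N, has_normal (s1 ++ s2) | (0 < n)%N] ->
  cycle_element_poly n s1 s2.
Proof.
elim: n s2 => [|n IH] s2 c sz2 h.
  have [|Q QE] := element_polyP c sz2; first by move: h; rewrite orbF.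
  by exists Q => th; rewrite -QE /matrix_element map_cat energy_ops_cat.
(* [pre] holds the items that the travelling operator has passed, [post] those still ahead of it. *)
suff H post pre : covers (s1 ++ pre ++ post) -> (2 <= size (s1 ++ pre ++ post))%N ->
    exists Q, forall th,
    energy_ops [seq item_ev th it | it <- s1] (iter n (cycle_op r)
      (energy_ops [seq item_ev th it | it <- pre] (cycle_op r
        (energy_ops [seq item_ev th it | it <- post] (@vacuum (levels th))))))
      (delta (levels th)) = ev th (pending_factor (s1 ++ pre ++ post) * Q).
  by have [Q QE] := H s2 [::] c sz2; exists Q => th; rewrite -QE iterSr.
elim: post pre => [|it post IHpost] pre {sz2 h}c sz2.
  exists 0 => th; rewrite mulr0 rmorph0.
  by apply/energy_ops0/cycle_ops0/energy_ops0/cycle_op_vacuum.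
have [] := IHpost (rcons pre it); rewrite ?cat_rcons // => Q1 Q1E.
have [f fE] := cycle_item it.
have [] := IH (pre ++ (it.1, Some f) :: post) => [|||Q2 Q2E].
- by move: c; rewrite /covers !map_cat !flatten_cat !all_cat.
- by move: sz2; rewrite !size_cat.
- by rewrite /has_normal !has_cat /= !orbT.
exists (Q1 + Q2) => th; move: (Q1E th) (Q2E th).
set vac := @vacuum _.
rewrite map_rcons -cats1 !map_cat !energy_ops_cat /= => E1 E2.
rewrite /=.
set phi := energy_ops _ vac in E1 E2 *.
pose psi a := cycle_op r (energy_op (energy_sum it.1 th) (map_poly (ev th) (item_poly it)) phi) a.
have psiE : psi =1 fun a =>
    energy_op (energy_sum it.1 th) (map_poly (ev th) (item_poly it)) (cycle_op r phi) a +
    ev th (item_fac it) * energy_op (energy_sum it.1 th) (map_poly (ev th) f) phi a.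
  move=> a; rewrite /psi cycle_op_comm; congr (_ + _).
  by rewrite -map_cycle_polyA -rmorphM fE rmorphM /= map_polyC energy_opZ.
rewrite (eq_energy_ops _ (eq_cycle_ops _ _ (eq_energy_ops _ psiE))).
rewrite (eq_energy_ops _ (eq_cycle_ops _ _ (energy_opsD _ _ _))).
rewrite (eq_energy_ops _ (cycle_opsD _ _ _ _)) energy_opsD.
rewrite E1 [X in _ + X = _](_ : _ = ev th (item_fac it) *
  ev th (pending_factor (s1 ++ pre ++ (it.1, Some f) :: post) * Q2)).
  rewrite -rmorphM -rmorphD; congr (ev th _).
  by rewrite /pending_factor !big_cat !big_cons /= [item_fac (_, Some _)]/item_fac /=; ring.
rewrite -E2 (eq_energy_ops _ (eq_cycle_ops _ _ (energy_opsZ _ _ _))).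
by rewrite (eq_energy_ops _ (cycle_opsZ _ _ _ _)) energy_opsZ.
Qed.

End PolynomialValues.

(** * Colourings and Frobenius' formula *)

Section Colourings.
Variables (d : nat) (T : finType).
Implicit Types (c : {ffun 'I_d -> T}) (g h : 'S_d) (t : T) (q : {ffun T -> 'I_d.+1}).

Definition recolour g c : {ffun 'I_d -> T} := [ffun x => c (g x)].
Definition fixes g c := recolour g c == c.
(** Values in ['I_d.+1] make the contents a finite type to sum over; [inord] is exact by
    [contentE]. *)
Definition content c : {ffun T -> 'I_d.+1} := [ffun t => inord #|[set x | c x == t]|].

Lemma recolourM g h c : recolour (g * h) c = recolour g (recolour h c).
Proof. by apply/ffunP=> x; rewrite !ffunE permM. Qed.

Lemma recolour1 c : recolour 1 c = c.
Proof. by apply/ffunP=> x; rewrite !ffunE perm1. Qed.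

Lemma contentE c t : content c t = #|[set x | c x == t]| :> nat.
Proof. by rewrite ffunE inordK // ltnS -[X in (_ <= X)%N]card_ord max_card. Qed.

Lemma content_recolour g c : content (recolour g c) = content c.
Proof.
apply/ffunP=> t; apply: val_inj; rewrite /= !contentE.
rewrite -(card_imset [set x | recolour g c x == t] (@perm_inj _ g)); congr #|pred_of_set _|.
apply/setP=> x; apply/imsetP/idP => [[y]|]; first by rewrite !inE ffunE => ? ->.
by rewrite inE => cx; exists ((g^-1)%g x); rewrite ?permKV // inE ffunE permKV.
Qed.

Lemma sum_content c : (\sum_t content c t = d)%N.
Proof.
under eq_bigr do rewrite contentE -sum1dep_card.
rewrite (exchange_big_dep xpredT) //= -[RHS]card_ord -sum1_card.
by apply: eq_bigr => x _; rewrite (big_pred1 (c x)) // => t; rewrite eq_sym.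
Qed.

Lemma count_colours c t : count_mem t (codom c) = content c t.
Proof.
rewrite contentE /codom /image_mem count_map -sum1dep_card -sum1_count.
by rewrite big_enum_cond.
Qed.

(** Hence the orbits of S_d on colourings are the fibres of [content]. *)
Lemma same_contentP c c' : content c = content c' -> exists g, c' = recolour g c.
Proof.
move=> e; pose t' := [tuple of codom c].
have /tuple_permP [g gE] : perm_eq (codom c') [tuple c x | x < d].
  rewrite /perm_eq; apply/allP => x _ /=.
  have -> : [seq c x | x <- enum 'I_d] = codom c by [].
  by rewrite !count_colours e.
exists g; apply/ffunP=> x; rewrite ffunE.
have /(congr1 (fun s => nth (c x) s x)) := gE.
rewrite /codom /image_mem (nth_map x) ?size_enum_ord // nth_ord_enum => ->.
by rewrite (nth_map x) ?size_enum_ord // nth_ord_enum tnth_mktuple.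
Qed.

Lemma content_onto q : (\sum_t q t = d)%N -> exists c, content c = q.
Proof.
move=> sq; pose s := flatten [seq nseq (q t) t | t <- enum T].
have ss : size s == d.
  rewrite size_flatten /shape -map_comp sumnE big_map big_enum /= -[X in _ == X]sq.
  by apply/eqP/eq_bigr => t _; rewrite /= size_nseq.
exists [ffun x => tnth (Tuple ss) x]; apply/ffunP=> t; apply: val_inj.
rewrite /= -count_colours.
have -> : codom [ffun x => tnth (Tuple ss) x] = s.
  rewrite /codom /image_mem; under eq_map do rewrite ffunE.
  exact: (map_tnth_enum (Tuple ss)).
rewrite count_flatten -map_comp sumnE big_map big_enum /= (bigD1 t) //=.
rewrite count_nseq /= eqxx mul1n big1 ?addn0 // => t' tt'.
by rewrite count_nseq /= (negPf tt').
Qed.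

(** Orbit-stabiliser: the stabiliser of [c] has as many elements as the set of [g] sending [c0] to
    [c], and these sets partition S_d. *)
Lemma sum_stabilisers q : (\sum_t q t = d)%N ->
  (\sum_(c | content c == q) #|[set g | fixes g c]| = d`!)%N.
Proof.
move=> /content_onto [c0 c0E].
transitivity (\sum_(c | content c == q) #|[set g | recolour g c0 == c]|)%N.
  apply: eq_bigr => c /eqP cE.
  have [h hE] : exists h, c = recolour h c0 by apply: same_contentP; rewrite c0E.
  rewrite -(card_imset _ (@mulIg _ h)); congr #|pred_of_set _|.
  apply/setP=> g; apply/imsetP/idP => [[g']|].
    by rewrite inE /fixes hE -!recolourM => /eqP e ->; rewrite inE e.
  rewrite inE => /eqP e; exists (g * h^-1)%g; last by rewrite mulgKV.
  by rewrite inE /fixes hE -recolourM mulgKV e hE.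
under eq_bigr do rewrite -sum1dep_card.
rewrite (exchange_big_dep xpredT) //= -card_Sn -sum1_card.
apply: eq_bigr => g _; rewrite (big_pred1 (recolour g c0)) // => c /=.
by rewrite [RHS]eq_sym andb_idl // => /eqP <-; rewrite content_recolour c0E.
Qed.

(** Burnside's lemma with weights depending on the content. *)
Lemma orbit_sum (V : nmodType) (F : {ffun T -> 'I_d.+1} -> V) :
  \sum_(g : 'S_d) \sum_(c | fixes g c) F (content c) =
  (\sum_(q : {ffun T -> 'I_d.+1} | (\sum_t q t == d)%N) F q) *+ d`!.
Proof.
rewrite (exchange_big_dep xpredT) //=.
rewrite (partition_big (@content) (fun q => (\sum_t q t == d)%N)) /=; last first.
  by move=> c _; rewrite sum_content.
rewrite -sumrMnl; apply: eq_bigr => q /eqP sq.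
rewrite -(sum_stabilisers sq) -sumrMnr; apply: eq_bigr => c /eqP <-.
by rewrite -sum1dep_card -sumrMnr.
Qed.
End Colourings.

Lemma content_fst d (T1 T2 : finType) (c : {ffun 'I_d -> T1 * T2}) i :
  content [ffun x => (c x).1] i = (\sum_k content c (i, k))%N :> nat.
Proof.
rewrite contentE -sum1dep_card (partition_big (fun x => (c x).2) xpredT) //=.
apply: eq_bigr => k _; rewrite contentE -sum1dep_card; apply: eq_bigl => x.
by rewrite ffunE -pair_eqE.
Qed.

Lemma content_snd d (T1 T2 : finType) (c : {ffun 'I_d -> T1 * T2}) k :
  content [ffun x => (c x).2] k = (\sum_i content c (i, k))%N :> nat.
Proof.
rewrite contentE -sum1dep_card (partition_big (fun x => (c x).1) xpredT) //=.
apply: eq_bigr => i _; rewrite contentE -sum1dep_card; apply: eq_bigl => x.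
by rewrite ffunE -pair_eqE andbC.
Qed.

Section IteratedSums.
Variables (J : Type) (B : finType) (V : zmodType) (W : nmodType).
Variables (P : J -> pred B) (v : J -> B -> V).

Lemma foldr_sum_ffun (phi : V -> W) (j0 : J) (s : seq J) (l : nat) (a : V) : size s = l ->
  foldr (fun j psi a => \sum_(b | P j b) psi (a - v j b)) phi s a =
  \sum_(f : {ffun 'I_l -> B} | [forall i : 'I_l, P (nth j0 s i) (f i)])
     phi (a - \sum_(i < l) v (nth j0 s i) (f i)).
Proof.
elim: s l a => [|j s IH] l a <- /=.
  pose f0 : {ffun 'I_0 -> B} := ffun0 (card_ord 0).
  rewrite (big_pred1 f0) ?big_ord0 ?subr0 // => f /=.
  have -> : f = f0 by apply/ffunP=> -[].
  by rewrite eqxx; apply/forallP=> -[].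
pose glue (p : B * {ffun 'I_(size s) -> B}) : {ffun 'I_(size s).+1 -> B} :=
  [ffun i => if unlift ord0 i is Some i' then p.2 i' else p.1].
have glue0 p : glue p ord0 = p.1 by rewrite ffunE unlift_none.
have glueS p i : glue p (lift ord0 i) = p.2 i by rewrite ffunE liftK.
rewrite (reindex glue) /=; last first.
  exists (fun f => (f ord0, [ffun i => f (lift ord0 i)])) => [[b f]|f] _.
    by rewrite glue0; congr (_, _); apply/ffunP=> i; rewrite ffunE glueS.
  by apply/ffunP=> i; case: (unliftP ord0 i) => [i' ->|->];
    rewrite ?glueS ?glue0 //= ffunE.
have PE p : [forall i : 'I_(size s).+1, P (nth j0 (j :: s) i) (glue p i)] =
    P j p.1 && [forall i : 'I_(size s), P (nth j0 s i) (p.2 i)].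
  apply/forallP/andP => [Pf|[P1 /forallP P2] i].
    split; first by have := Pf ord0; rewrite glue0.
    by apply/forallP=> i; have := Pf (lift ord0 i); rewrite glueS.
  by case: (unliftP ord0 i) => [i' ->|->]; rewrite ?glueS ?glue0 //= P2.
rewrite (eq_bigl _ _ PE) -(pair_big_dep (P j)
  (fun _ (f : {ffun 'I_(size s) -> B}) => [forall i : 'I_(size s), P (nth j0 s i) (f i)])
  (fun b f => phi (a - \sum_(i < (size s).+1) v (nth j0 (j :: s) i) (glue (b, f) i)))) /=.
apply: eq_bigr => b _; rewrite (IH _ _ erefl); apply: eq_bigr => f _.
congr (phi _); rewrite big_ord_recl glue0 opprD addrA; congr (_ - _).
by apply: eq_bigr => i _; rewrite glueS.
Qed.

End IteratedSums.

(** * Frobenius coefficients and permutation characters *)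

Section Frobenius.
Variables (d N : nat).
Notation pos := {ffun 'I_N -> int}.
Notation state := ({ffun 'I_N -> int} -> rat).
Implicit Types (a : pos) (g : 'S_d) (c : {ffun 'I_d -> 'I_N}) (q : {ffun 'I_N -> 'I_d.+1}).

Definition qpos q : pos := [ffun i => (q i : nat)%:Z].
(* The coefficient of x^a in a_delta p_mu, mu being the cycle type of g. *)
Definition frobenius a g : rat := \sum_(c | fixes g c) vacuum (a - qpos (content c)).
Definition fixed_count a g : nat := #|[set c | fixes g c & qpos (content c) == a]|.
(** Multiplication by the complete homogeneous polynomial h_k, acting on coefficients. The bound [d]
    on exponents is harmless for [k <= d], and a negative [k] gives 0. *)
Definition complete_op (k : int) (phi : state) : state :=
  fun a => \sum_(q : {ffun 'I_N -> 'I_d.+1} | (\sum_i q i)%N%:Z == k) phi (a - qpos q).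
Definition extend a (k : nat) : int := if insub k is Some i then a i else 0.
(* The coefficient of x^a in a_delta h_(b 0) ... h_(b (k - 1)), as a function of a. *)
Definition kostka (b : pos) (k : nat) : state :=
  foldr (fun k psi => complete_op (extend b k) psi) (@vacuum N) (rev (iota 0 k)).

Lemma extendE a (i : 'I_N) : extend a i = a i.
Proof. by rewrite /extend valK. Qed.

(** Expanding the vacuum gives the Jacobi-Trudi alternating sum, each term being the value of a
    permutation character on colourings. *)
Lemma frobeniusE a g : frobenius a g =
  \sum_(w : 'S_N) (-1) ^+ w * (fixed_count (a - perm_pos w (delta N)) g)%:R.
Proof.
rewrite /frobenius /vacuum exchange_big; apply: eq_bigr => w _ /=.
rewrite -mulr_sumr; congr (_ * _); rewrite -natr_sum; congr _%:R.
rewrite /fixed_count -sum1dep_card -big_mkcondr /=; apply: eq_bigl => c.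
by congr (_ && _); rewrite subr_eq [RHS]eq_sym subr_eq addrC.
Qed.

Notation pair_content := {ffun 'I_N * 'I_N -> 'I_d.+1}.
Definition row_sums (m : pair_content) : pos := [ffun i => \sum_k (m (i, k) : nat)%:Z].
Definition col_sums (m : pair_content) : pos := [ffun k => \sum_i (m (i, k) : nat)%:Z].

Lemma content_margin (c : {ffun 'I_d -> 'I_N * 'I_N}) :
  row_sums (content c) = qpos (content [ffun x => (c x).1]) /\
  col_sums (content c) = qpos (content [ffun x => (c x).2]).
Proof.
by split; apply/ffunP=> i; rewrite [LHS]ffunE [RHS]ffunE ?content_fst ?content_snd
  (big_morph Posz PoszD (erefl _)).
Qed.

(** A pair of fixed colourings is one fixed colouring by pairs, so [orbit_sum] turns the sum over
    S_d into a sum over matrices. Those with row sums [b] are chosen row by row, one [complete_op]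
    per row. *)
Lemma sum_frobenius_fixed_count a (b : pos) : \sum_i b i = d%:Z ->
  \sum_(g : 'S_d) frobenius a g * (fixed_count b g)%:R = kostka b N a *+ d`!.
Proof.
move=> sb.
pose F (m : pair_content) := if row_sums m == b then vacuum (a - col_sums m) else 0.
transitivity (\sum_(g : 'S_d) \sum_(c | fixes g c) F (content c)).
  apply: eq_bigr => g _; rewrite /frobenius mulr_suml.
  under eq_bigr do rewrite /fixed_count -sum1dep_card natr_sum mulr_sumr.
  rewrite pair_big_dep /=.
  pose split (c : {ffun 'I_d -> 'I_N * 'I_N}) :=
    ([ffun x => (c x).2] : {ffun 'I_d -> 'I_N}, [ffun x => (c x).1] : {ffun 'I_d -> 'I_N}).
  rewrite (reindex split) /=; last first.
    exists (fun p : {ffun 'I_d -> 'I_N} * {ffun 'I_d -> 'I_N} => [ffun x => (p.2 x, p.1 x)]) => [c|[c1 c2]] _.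
      by apply/ffunP=> x; rewrite !ffunE; case: (c x).
    by congr (_, _); apply/ffunP=> x; rewrite !ffunE.
  rewrite /F -big_mkcondr /=; apply: eq_big => c.
    have [-> _] := content_margin c; rewrite andbA; congr (_ && _).
    apply/andP/eqP => [[/eqP/ffunP e2 /eqP/ffunP e1]|e].
      apply/ffunP=> x; have := e1 x; have := e2 x; rewrite !ffunE => e2x e1x.
      by apply/eqP; rewrite -pair_eqE /= e1x e2x !eqxx.
    by split; apply/eqP/ffunP=> x; move/ffunP/(_ x): e; rewrite !ffunE => ->.
  by have [_ ->] := content_margin c; rewrite mulr1.
rewrite orbit_sum; congr (_ *+ _); rewrite /kostka.
rewrite (@foldr_sum_ffun _ _ _ _ (fun k (q : {ffun 'I_N -> 'I_d.+1}) =>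
  (\sum_i q i)%N%:Z == extend b k) (fun _ => qpos) _ 0 _ N); last first.
  by rewrite size_rev size_iota.
(* Rows are listed in reverse since [kostka] applies the factor of row 0 innermost. *)
pose curry (m : pair_content) : {ffun 'I_N -> {ffun 'I_N -> 'I_d.+1}} :=
  [ffun i => [ffun k => m (rev_ord i, k)]].
rewrite [RHS](reindex curry) /=; last first.
  exists (fun f : {ffun 'I_N -> {ffun 'I_N -> 'I_d.+1}} =>
      [ffun p : 'I_N * 'I_N => f (rev_ord p.1) p.2]) => [m|f] _.
    by apply/ffunP=> -[i k]; rewrite !ffunE rev_ordK.
  by apply/ffunP=> i; apply/ffunP=> k; rewrite !ffunE rev_ordK.
rewrite /F -big_mkcondr /=; apply: eq_big => m.
  apply/andP/forallP => [[_ /eqP rb] i|rb].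
    rewrite nth_rev ?size_iota // nth_iota ?ltn_subrL ?(leq_ltn_trans _ (ltn_ord i)) //.
    rewrite (extendE b (rev_ord i)) -rb [row_sums _ _]ffunE (big_morph Posz PoszD (erefl _)).
    by apply/eqP; apply: eq_bigr => k _; rewrite !ffunE.
  have {}rb : row_sums m = b.
    apply/ffunP=> i; have := rb (rev_ord i).
    rewrite nth_rev ?size_iota // nth_iota ?ltn_subrL ?(leq_ltn_trans _ (ltn_ord i)) //.
    rewrite (extendE b (rev_ord (rev_ord i))) rev_ordK => /eqP <-.
    rewrite [row_sums _ _]ffunE (big_morph Posz PoszD (erefl _)).
    by apply: eq_bigr => k _; rewrite !ffunE rev_ordK.
  split; last exact/eqP.
  rewrite -eqz_nat -sb -rb (big_morph Posz PoszD (erefl _)).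
  under [in X in _ == X]eq_bigr do rewrite ffunE.
  by rewrite pair_big /=; apply/eqP; apply: eq_bigr => -[].
move=> _; congr (vacuum (_ - _)); apply/ffunP=> k.
rewrite ffunE sum_ffunE (reindex_inj rev_ord_inj) /=.
by apply: eq_bigr => i _; rewrite !ffunE.
Qed.

End Frobenius.

(** * Kostka coefficients *)

Section Kostka.
Variables (d N : nat).
Notation pos := {ffun 'I_N -> int}.
Notation state := ({ffun 'I_N -> int} -> rat).
Notation cont := {ffun 'I_N -> 'I_d.+1}.
Notation qpos := (@qpos d N).
Notation complete_op := (@complete_op d N).
Notation kostka := (@kostka d N).
Implicit Types (a b : pos) (phi : state) (q : cont).

Lemma complete_op_neq0 k phi a : complete_op k phi a != 0 ->
  exists2 q : cont, (\sum_i q i)%N%:Z = k & phi (a - qpos q) != 0.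
Proof.
move=> nz.
case: (pickP (fun q : cont => ((\sum_i q i)%N%:Z == k) && (phi (a - qpos q) != 0)))
  => [q /andP[/eqP qk qn]|none]; first by exists q.
case/eqP: nz; apply: big1 => q qk; apply/eqP; apply: contraFT (none q) => ->.
by rewrite qk.
Qed.

Lemma alternating_complete_op k phi : alternating phi -> alternating (complete_op k phi).
Proof.
move=> alt w a; rewrite /complete_op mulr_sumr.
pose tw (w : 'S_N) (q : cont) : cont := [ffun i => q (w i)].
rewrite (reindex (tw w)) /=; last first.
  by exists (tw (w^-1)%g) => q _; apply/ffunP=> i; rewrite !ffunE ?permK ?permKV.
apply: eq_big => [q|q _].
  congr (Posz _ == _); rewrite [RHS](reindex_inj (@perm_inj _ w)) /=.
  by apply: eq_bigr => i _; rewrite ffunE.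
rewrite -alt perm_posB; congr (phi (_ - _)).
by apply/ffunP=> i; rewrite !ffunE.
Qed.

Lemma alternating_kostka b k : alternating (kostka b k).
Proof.
rewrite /kostka; elim: (rev _) => [|j s IH] /=; first exact: alternating_vacuum.
exact: alternating_complete_op.
Qed.

Lemma kostkaS b k : kostka b k.+1 = complete_op (extend b k) (kostka b k).
Proof. by rewrite /kostka -[k.+1]addn1 iotaD rev_cat. Qed.

Lemma kostka_homogeneous b k a : kostka b k a != 0 ->
  \sum_i a i = \sum_i delta N i + \sum_(0 <= j < k) extend b j.
Proof.
elim: k a => [|k IH] a.
  move=> /vacuum_neq0 [w ->]; rewrite big_geq // addr0.
  by rewrite [RHS](reindex_inj (@perm_inj _ w)); apply: eq_bigr => i _; rewrite ffunE.
rewrite kostkaS => /complete_op_neq0 [q qk /IH].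
rewrite big_nat_recr //= addrA => <-; rewrite -qk (big_morph Posz PoszD (erefl _)).
by rewrite -big_split /=; apply: eq_bigr => i _; rewrite !ffunE subrK.
Qed.

Lemma kostka_rows_ge0 b k a j : kostka b k a != 0 -> (j < k)%N -> 0 <= extend b j.
Proof.
elim: k a => // k IH a; rewrite kostkaS => /complete_op_neq0 [q qk /IH jk].
by rewrite ltnS leq_eqVlt => /predU1P[->|/jk //]; rewrite -qk.
Qed.

Section Involution.
Variables (k : int) (phi : state) (D : nat) (a : pos) (v : nat).
Hypotheses (kd : k <= d%:Z) (alt : alternating phi) (dp : deep D.+1 phi).
Hypotheses (vD : (v < D)%N) (a_inj : injective a) (a_ge0 : forall i, 0 <= a i).
Hypothesis av : forall i, a i != v.

Let b q : pos := a - qpos q.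
(* If a misses the level v, exchanging in b the first two particles that lie at
   height at most v + 1 in b and at least v + 1 in a reverses the sign. *)
Let small q i := (v.+1%:Z <= a i) && (b q i <= v.+1%:Z).
Let fst_small q := [pick i | small q i].
Let snd_small q i := [pick i' | small q i' && (i' != i)].
Let swapped q (w : 'S_N) : cont := [ffun i => inord `|a i - b q (w i)|%N].
Let invol q : cont :=
  if fst_small q is Some i then
    if snd_small q i is Some i' then swapped q (tperm i i') else q
  else q.
Let good q := ((\sum_i q i)%N%:Z == k) && (phi (b q) != 0).

Let bE q i : b q i = a i - (q i : nat)%:Z. Proof. by rewrite !ffunE. Qed.

(** Pigeonhole: the v + 2 levels up to v + 1 are all filled in [b q], whereas at most v particles
    lie below [v] in [a] and none lies at [v]. *)
Lemma two_small q : good q -> exists i i',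
  [/\ fst_small q = Some i, snd_small q i = Some i', small q i, small q i' & i != i'].
Proof.
move=> /andP[_ nz].
have b_inj := alternating_neq0_inj alt nz.
have [b_ge0 cov] := dp nz.
pose S := [set i | small q i]; pose B := [set i | b q i <= v.+1%:Z].
pose A := [set i | a i < v%:Z].
have cB : (v.+2 <= #|B|)%N.
  have := @uniq_leq_size _ (iota 0 v.+2) [seq `|b q i|%N | i <- enum B] (iota_uniq _ _).
  rewrite size_iota size_map -cardE; apply=> t; rewrite mem_iota add0n => /= tv.
  have [i bi] : exists i, b q i = t by apply: cov; lia.
  by apply/mapP; exists i; rewrite ?mem_enum ?inE bi //; lia.
have cA : (#|A| <= v)%N.
  have := @uniq_leq_size _ [seq `|a i|%N | i <- enum A] (iota 0 v).
  rewrite size_iota size_map -cardE; apply=> [|t /mapP[i]].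
    rewrite map_inj_in_uniq ?enum_uniq // => i j _ _ e; apply: a_inj.
    by have := a_ge0 i; have := a_ge0 j; lia.
  by rewrite mem_enum inE mem_iota => ai ->; have := a_ge0 i; lia.
have cS : (2 <= #|S|)%N.
  have : B \subset S :|: A.
    apply/subsetP=> i; rewrite !inE /small => -> ; rewrite andbT.
    by have := av i; case: ltgtP => //; lia.
  by move=> /subset_leq_card; rewrite cardsU; lia.
have [i si e1] : exists2 i, small q i & fst_small q = Some i.
  rewrite /fst_small; case: (pickP (small q)) => [i si|none]; first by exists i.
  by move: cS; rewrite (eq_card0 (A := S)) // => i; rewrite inE none.
have [i' /andP[si' ii'] e2] : exists2 i', small q i' && (i' != i) & snd_small q i = Some i'.
  rewrite /snd_small; case: (pickP (fun i' => small q i' && (i' != i))) => [i' si'|none].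
    by exists i'.
  suff : (#|S| <= 1)%N by lia.
  rewrite -(cards1 i); apply/subset_leq_card/subsetP=> i'; rewrite !inE => si'.
  by move: (none i'); rewrite si' /= => /negbFE.
by exists i, i'; rewrite eq_sym.
Qed.

(** Both particles are at or above v + 1 in [a] and at or below it in [b q], so exchanging them
    keeps all differences nonnegative. The set of small indices is unchanged, so the same pair is
    selected again. *)
Lemma involP q : good q ->
  [/\ good (invol q), invol (invol q) = q & phi (b (invol q)) = - phi (b q)].
Proof.
move=> gq; have [i [i' [e1 e2 si si' ii']]] := two_small gq.
have [/eqP qk nz] := andP gq.
have b_le j : b q j <= a j by rewrite bE; lia.
(* This bounds the exchanged differences by [d], so that [inord] in [swapped] is exact. *)
have sum2 : ((q i : nat) + (q i' : nat) <= d)%N.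
  have i'i : i' != i by rewrite eq_sym.
  rewrite -lez_nat (le_trans _ kd) // -qk lez_nat (bigD1 i) //= (bigD1 i') //=.
  by rewrite addnA leq_addr.
have iE : invol q = swapped q (tperm i i') by rewrite /invol e1 e2.
have swE j : (swapped q (tperm i i') j : nat)%:Z = a j - b q (tperm i i' j).
  move: si si' => /andP[ai bi] /andP[ai' bi'].
  have h : 0 <= a j - b q (tperm i i' j) <= d%:Z.
    have := bE q i; have := bE q i'; have := b_le j; have := bE q j.
    by have := ltn_ord (q j); case: tpermP => [->|->|_ _]; lia.
  have [h0 hd] := andP h.
  by rewrite [swapped _ _ _]ffunE inordK ?ltnS -?lez_nat gez0_abs.
have bsw : b (invol q) = perm_pos (tperm i i') (b q).
  by apply/ffunP=> j; rewrite bE iE swE [RHS]ffunE opprB addrC subrK.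
have smE : small (invol q) =1 small q.
  move=> j; rewrite /small bsw ffunE.
  by move: si si' => /andP[ai bi] /andP[ai' bi']; case: tpermP => [->|->|//];
    rewrite ?bi ?bi' ?ai ?ai'.
have phiE : phi (b (invol q)) = - phi (b q) by rewrite bsw alt odd_tperm ii' expr1 mulN1r.
split=> //.
  rewrite /good phiE oppr_eq0 nz andbT iE -qk !(big_morph Posz PoszD (erefl _)).
  under eq_bigr do rewrite swE.
  have bs : \sum_j b q (tperm i i' j) = \sum_j b q j.
    by rewrite [RHS](reindex_inj (@perm_inj _ (tperm i i'))).
  rewrite sumrB bs.
  rewrite -sumrB; apply/eqP; apply: eq_bigr => j _.
  by rewrite bE opprB addrC subrK.
have e1' : fst_small (invol q) = Some i by rewrite -e1; apply: eq_pick.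
have e2' : snd_small (invol q) i = Some i'.
  by rewrite -e2; apply: eq_pick => j /=; rewrite smE.
rewrite [LHS]/invol e1' e2'; apply/ffunP=> j; apply: val_inj.
rewrite ffunE /= bsw [perm_pos _ _ _]ffunE tpermK bE inordK; first by lia.
by have := ltn_ord (q j); lia.
Qed.

Lemma complete_op_gap : complete_op k phi a = 0.
Proof.
suff: complete_op k phi a = - complete_op k phi a by lra.
have -> : complete_op k phi a = \sum_(q | good q) phi (b q).
  rewrite /complete_op (bigID (fun q => phi (b q) != 0)) /= [X in _ + X]big1 ?addr0 //.
  by move=> q /andP[_ /negPn/eqP].
rewrite -sumrN [LHS](reindex_onto invol invol) /=; last by move=> q /involP[].
apply: eq_big => [q|q /andP[g1 /eqP e]]; last by have [_ _] := involP g1; rewrite e => ->; rewrite opprK.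
apply/andP/idP => [[g1 /eqP e]|gq]; first by have [] := involP g1; rewrite e.
by have [g1 -> _] := involP gq.
Qed.

End Involution.

(** Multiplication by h_k costs a single level of the sea whatever [k] is, because a gap below [D]
    is cancelled by the involution. *)
Lemma deep_complete_op k phi (D : nat) : k <= d%:Z -> alternating phi ->
  deep D.+1 phi -> deep D (complete_op k phi).
Proof.
move=> kd alt dp a nz.
have a_inj := alternating_neq0_inj (alternating_complete_op k alt) nz.
have a_ge0 i : 0 <= a i.
  have [q _ /dp [/(_ i) b0 _]] := complete_op_neq0 nz.
  by move: b0; rewrite !ffunE subr_ge0; apply: le_trans.
split=> // v /andP[v0 vD].
case: (pickP (fun i => a i == v)) => [i /eqP <-|none]; first by exists i.
case/eqP: nz; apply: (@complete_op_gap _ _ D _ `|v|%N) => //; first by lia.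
by move=> i; rewrite gez0_abs // none.
Qed.

Lemma deep_kostka (b : pos) k : (k <= N)%N -> (forall i, b i <= d%:Z) ->
  deep (N - k)%N (kostka b k).
Proof.
move=> kN bd; elim: k kN => [|k IH] kN; first by rewrite subn0; apply: deep_vacuum.
rewrite kostkaS; apply: deep_complete_op; first by rewrite (extendE b (Ordinal kN)).
  exact: alternating_kostka.
by rewrite subnSK //; apply: IH; apply: ltnW.
Qed.

End Kostka.

(** * Dominance and triangularity of Kostka coefficients *)

Section KostkaValues.
Variables (d N : nat).
Notation pos := {ffun 'I_N -> int}.
Notation cont := {ffun 'I_N -> 'I_d.+1}.
Notation kostka := (@kostka d N).
Implicit Types (a b la : pos) (q : cont).

Definition decreasing (a : pos) := forall i j : 'I_N, (i < j)%N -> a j < a i.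

(** The particles of [b] below level N - j contribute exactly the last N - j entries of [delta]; the
    other j lie under [a], whose j largest entries come first. Equality leaves no slack in either
    comparison. *)
Lemma top_sum_bound (j : nat) (a b : pos) : (j <= N)%N -> injective b ->
  (forall i, 0 <= b i) -> (forall v : int, 0 <= v < (N - j)%N -> exists i, b i = v) ->
  (forall i, b i <= a i) -> decreasing a ->
  \sum_i b i - \sum_i delta N i <= \sum_(i : 'I_N | (i < j)%N) (a i - delta N i) /\
  (\sum_i b i - \sum_i delta N i = \sum_(i : 'I_N | (i < j)%N) (a i - delta N i) ->
   (forall i : 'I_N, (i < j)%N -> b i = a i) /\
   (forall i : 'I_N, (j <= i)%N -> b i < (N - j)%N)).
Proof.
move=> jN b_inj b_ge0 cov ba dec.
pose Z := [set i | b i < (N - j)%N]; pose I := [set i : 'I_N | (i < j)%N].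
have pZ : perm_eq [seq `|b i|%N | i <- enum Z] (iota 0 (N - j)).
  apply: uniq_perm; rewrite ?iota_uniq //.
    rewrite map_inj_uniq ?enum_uniq // => i i' e; apply: b_inj.
    by have := b_ge0 i; have := b_ge0 i'; lia.
  move=> t; rewrite mem_iota add0n leq0n /=; apply/mapP/idP => [[i]|tj].
    by rewrite mem_enum inE => bi ->; have := b_ge0 i; lia.
  have [i bi] : exists i, b i = t by apply: cov; lia.
  by exists i; rewrite ?mem_enum ?inE bi.
have cZ : #|Z| = (N - j)%N by rewrite cardE -(size_map (fun i => `|b i|%N)) (perm_size pZ) size_iota.
have cI : #|I| = j.
  rewrite -sum1dep_card.
  by rewrite -(big_ord_widen N (fun _ => 1%N) jN) sum_nat_const card_ord muln1.
have cCZ : #|~: Z| = j by move: (cardsC Z); rewrite card_ord; lia.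
have sZ : \sum_(i in Z) b i = \sum_(i : 'I_N | ~~ (i < j)%N) delta N i.
  transitivity (\sum_(x <- iota 0 (N - j)) x%:Z).
    apply: etrans (perm_big _ pZ); rewrite big_map big_enum /=; apply: eq_bigr => i _.
    by rewrite gez0_abs.
  have -> : iota 0 (N - j) = index_iota 0 (N - j) by rewrite /index_iota subn0.
  rewrite [RHS]big_mkcond /=.
  rewrite [RHS](_ : _ = \sum_(0 <= x < N) if (x < N - j)%N then x%:Z else 0).
    by rewrite (big_nat_widen 0 _ N) ?leq_subr // big_mkcond.
  rewrite [RHS]big_nat_rev /= big_mkord; apply: eq_bigr => i _; rewrite ffunE add0n.
  have iN := ltn_ord i; case: (ltnP i j) => ij /=; first by rewrite ifF //; lia.
  by rewrite ifT //; lia.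
have sb : \sum_i b i = \sum_(i in Z) b i + \sum_(i in ~: Z) b i.
  rewrite (bigID (mem Z)) /=; congr (_ + _); apply: eq_bigl => i.
  by rewrite !inE.
have sd : \sum_i delta N i = \sum_(i in I) delta N i + \sum_(i : 'I_N | ~~ (i < j)%N) delta N i.
  rewrite (bigID (mem I)) /=; congr (_ + _); apply: eq_bigl => i.
  by rewrite !inE.
have sI : \sum_(i : 'I_N | (i < j)%N) (a i - delta N i) =
    \sum_(i in I) a i - \sum_(i in I) delta N i.
  by rewrite -sumrB; apply: eq_bigl => i; rewrite inE.
(* A threshold between the first [j] entries of [a] and the others; through it the slack in [dE]
   splits into three nonnegative sums. *)
have [th [th1 th2]] : exists th : int, (forall i, i \in I -> th <= a i) /\
    (forall i, i \notin I -> a i < th).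
  suff [th [th1 th2]] : exists th : int, (forall i : 'I_N, (i < j)%N -> th <= a i) /\
      (forall i : 'I_N, (j <= i)%N -> a i < th).
    by exists th; split=> i; rewrite inE -?leqNgt; [apply: th1 | apply: th2].
  case: j jN {I cov Z pZ cZ cI cCZ sZ sb sd sI} => [|j] jN.
    exists (\sum_i `|a i| + 1); split=> // i _.
    rewrite ltzD1 (le_trans (ler_norm _)) // (bigD1 i) //= lerDl.
    exact: sumr_ge0.
  exists (a (Ordinal jN)); split=> i; last exact: (@dec (Ordinal jN)).
  rewrite ltnS => ij; have [->//|/eqP ne] := eqVneq i (Ordinal jN).
  apply/ltW/dec => /=; rewrite ltn_neqAle ij andbT.
  by apply: contra_notN ne => /eqP e; apply: val_inj.
have dE : \sum_(i in I) a i - \sum_(i in ~: Z) b i =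
    \sum_(i in I :\: ~: Z) (a i - th) + \sum_(i in ~: Z :\: I) (th - a i) +
    \sum_(i in ~: Z) (a i - b i).
  have e1 : \sum_(i in I) (a i - th) = \sum_(i in I :&: ~: Z) (a i - th) +
      \sum_(i in I :\: ~: Z) (a i - th) by rewrite (big_setID (~: Z)).
  have e2 : \sum_(i in ~: Z) (a i - th) = \sum_(i in I :&: ~: Z) (a i - th) +
      \sum_(i in ~: Z :\: I) (a i - th) by rewrite (big_setID I) setIC.
  have e3 : \sum_(i in ~: Z :\: I) (th - a i) = - \sum_(i in ~: Z :\: I) (a i - th).
    by rewrite -sumrN; apply: eq_bigr => i _; rewrite opprB.
  have e4 : \sum_(i in I) (a i - th) = \sum_(i in I) a i - th *+ j.
    by rewrite sumrB sumr_const cI.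
  have e5 : \sum_(i in ~: Z) (a i - th) = \sum_(i in ~: Z) a i - th *+ j.
    by rewrite sumrB sumr_const cCZ.
  have e6 : \sum_(i in ~: Z) (a i - b i) = \sum_(i in ~: Z) a i - \sum_(i in ~: Z) b i.
    by rewrite sumrB.
  rewrite e3 e6.
  move: e1 e2 e4 e5; move: (\sum_(i in I) (a i - th)) (\sum_(i in ~: Z) (a i - th)).
  move=> x y e1 e2 e4 e5.
  have -> : \sum_(i in I) a i = x + th *+ j by rewrite e4 subrK.
  have -> : \sum_(i in ~: Z) a i = y + th *+ j by rewrite e5 subrK.
  rewrite e1 e2; ring.
have p1 : 0 <= \sum_(i in I :\: ~: Z) (a i - th).
  by apply: sumr_ge0 => i; rewrite inE subr_ge0 => /andP[_ /th1].
have p2i i : i \in ~: Z :\: I -> 0 < th - a i.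
  by rewrite inE subr_gt0 => /andP[/th2].
have p2 : 0 <= \sum_(i in ~: Z :\: I) (th - a i).
  by apply: sumr_ge0 => i /p2i /ltW.
have p3 : 0 <= \sum_(i in ~: Z) (a i - b i).
  by apply: sumr_ge0 => i _; rewrite subr_ge0.
have goalE : \sum_(i : 'I_N | (i < j)%N) (a i - delta N i) - (\sum_i b i - \sum_i delta N i) =
    \sum_(i in I) a i - \sum_(i in ~: Z) b i.
  by rewrite sI sb sd sZ; ring.
split; first by rewrite -subr_ge0 goalE dE !addr_ge0.
move=> e; move: goalE; rewrite e subrr dE => /esym/eqP.
rewrite paddr_eq0 ?addr_ge0 // paddr_eq0 // => /andP[/andP[_ z2] z3].
have sub : ~: Z \subset I.
  apply/subsetP=> i iZ; apply: contraLR z2 => iI; rewrite gt_eqF //.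
  have iD : i \in ~: Z :\: I by rewrite inE iI.
  rewrite (bigD1 i) //= ltr_pwDl ?p2i //.
  by apply: sumr_ge0 => i' /andP[/p2i /ltW].
have ZI : ~: Z = I by apply/eqP; rewrite eqEcard sub cCZ cI /=.
split=> i ij.
  have iZ : i \in ~: Z by rewrite ZI inE.
  apply/eqP; rewrite eq_sym -subr_eq0; move: z3; rewrite psumr_eq0 => [/allP|i' _].
    by move=> /(_ i); rewrite mem_index_enum iZ => /(_ isT).
  by rewrite subr_ge0.
have : i \notin ~: Z by rewrite ZI inE -leqNgt.
by rewrite !inE negbK.
Qed.

Lemma decreasing_delta : decreasing (delta N).
Proof. by move=> i j ij; rewrite !ffunE ltz_nat; have := ltn_ord j; lia. Qed.

Lemma big_extend (a : pos) k : (k <= N)%N ->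
  \sum_(0 <= j < k) extend a j = \sum_(i : 'I_N | (i < k)%N) a i.
Proof.
move=> kN; rewrite (big_nat_widen 0 k N) // big_mkord.
by apply: eq_bigr => i _; rewrite extendE.
Qed.

(** Dominance of [b] by [a - delta]: after the first [j] factors all levels below N - j are filled,
    and [top_sum_bound] applies to the configuration reached, which still lies under [a]. *)
Lemma kostka_partial_sums (a b c : pos) k j : (forall i, b i <= d%:Z) -> decreasing a ->
  (j <= k <= N)%N -> kostka b k c != 0 -> (forall i, c i <= a i) ->
  \sum_(i : 'I_N | (i < j)%N) b i <= \sum_(i : 'I_N | (i < j)%N) (a i - delta N i).
Proof.
move=> bd dec; elim: k c => [|k IH] c /andP[jk kN] nz ca.
  by rewrite !big_pred0 // => i; move: jk; case: j.
move: jk; rewrite leq_eqVlt => /predU1P[->|jk]; last first.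
  move: nz; rewrite kostkaS => /complete_op_neq0 [q _ nz].
  apply: IH nz _; first by rewrite (ltnW kN) andbT.
  by move=> i; apply: le_trans (ca i); rewrite !ffunE gerBl.
have hom := kostka_homogeneous nz.
have [c0 cov] := deep_kostka kN bd nz.
have c_inj := alternating_neq0_inj (@alternating_kostka d N b k.+1) nz.
have [+ _] := top_sum_bound kN c_inj c0 cov ca dec.
by rewrite hom big_extend // [X in X - _]addrC addrK.
Qed.

(** If [v] fixes all indices below [i], the next prefix sum forces [v i <= i], and injectivity
    excludes a smaller value. *)
Lemma perm_prefix_sums (v : 'S_N) :
  (forall j, (j <= N)%N ->
     \sum_(i : 'I_N | (i < j)%N) (v i)%:Z <= \sum_(i : 'I_N | (i < j)%N) (i : nat)%:Z) ->
  v = 1%g.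
Proof.
move=> h; apply/permP=> i; rewrite perm1; apply: val_inj.
have [n] := ubnP i; elim: n i => // n IH i; rewrite ltnS => ni.
have fixed (i' : 'I_N) : (i' < i)%N -> v i' = i' :> nat.
  by move=> lt; apply: IH; apply: leq_trans ni.
have := h i.+1 (ltn_ord i).
rewrite (bigD1 i) ?ltnSn //= [X in _ <= X](bigD1 i) ?ltnSn //=.
have -> : \sum_(i' : 'I_N | (i' < i.+1)%N && (i' != i)) (v i')%:Z =
    \sum_(i' : 'I_N | (i' < i.+1)%N && (i' != i)) (i' : nat)%:Z.
  by apply: eq_bigr => i' /andP[lt ne]; congr Posz; apply: fixed; rewrite ltn_neqAle -ltnS lt andbT.
rewrite lerD2r lez_nat leq_eqVlt => /predU1P[//|lt].
have /perm_inj e : v (v i) = v i by apply: val_inj; rewrite /= fixed.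
by move: lt; rewrite e ltnn.
Qed.

Section Partition.
Variable la : pos.
Hypotheses (la_ge0 : forall i, 0 <= la i) (la_dec : forall i j : 'I_N, (i < j)%N -> la j <= la i).
Hypothesis la_sum : \sum_i la i = d%:Z.

Let la_le i : la i <= d%:Z.
Proof. by rewrite -la_sum (bigD1 i) //= lerDl sumr_ge0. Qed.

Let part k : pos := [ffun i : 'I_N => (if (i < k)%N then la i else 0) + delta N i].

Lemma decreasing_part k : decreasing (part k).
Proof.
move=> i j ij; have := decreasing_delta ij; have := la_dec ij; have := la_ge0 i.
rewrite [part k j]ffunE [part k i]ffunE => h1 h2 h3; apply: ler_ltD h3.
by case: ltnP => jk; case: ltnP => // ik; lia.
Qed.

(** The Kostka number K_(la,la) = 1, row by row: the equality case of [top_sum_bound] leaves [q0],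
    which puts the whole new row on particle [k], as the only contributing content. *)
Lemma kostka_part k : (k <= N)%N -> kostka la k (part k) = 1.
Proof.
elim: k => [|k IH] kN.
  by rewrite /kostka /= (_ : part 0 = delta N) ?vacuum_delta //; apply/ffunP=> i; rewrite !ffunE add0r.
pose k0 := Ordinal kN.
have lt : (`|la k0| < d.+1)%N by have := la_le k0; have := la_ge0 k0; lia.
pose q0 : cont := [ffun i => if i == k0 then Ordinal lt else ord0].
have q0E : part k.+1 - qpos q0 = part k.
  apply/ffunP=> i; rewrite ffunE [part k.+1 i]ffunE [part k i]ffunE !ffunE.
  have [->|ne] := eqVneq i k0.
    by rewrite /= ltnSn ltnn gez0_abs // add0r addrC addKr.
  have nk : (i : nat) != k by apply: contraNneq ne => e; apply/eqP/val_inj.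
  by rewrite ltnS leq_eqVlt (negPf nk) /= subr0.
rewrite kostkaS /complete_op (bigD1 q0) /=; last first.
  rewrite (bigD1 k0) //= big1 => [|i ik]; last by rewrite ffunE (negPf ik).
  by rewrite ffunE eqxx addn0 (extendE la k0) /= gez0_abs.
rewrite q0E IH ?(ltnW kN) // big1 ?addr0 // => q /andP[/eqP qk qq0].
apply/eqP; apply: contraNT qq0 => nz.
set b := part k.+1 - qpos q in nz.
have bE i : b i = part k.+1 i - (q i : nat)%:Z by rewrite !ffunE.
have kN' := ltnW kN.
have [b0 cov] := deep_kostka kN' la_le nz.
have b_inj := alternating_neq0_inj (@alternating_kostka d N la k) nz.
have b_le i : b i <= part k.+1 i by rewrite bE gerBl.
have [_ eqc] := top_sum_bound kN' b_inj b0 cov b_le (@decreasing_part k.+1).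
have partE (i : 'I_N) : (i < k)%N -> part k.+1 i = la i + delta N i.
  by move=> ik; rewrite ffunE ltnS (ltnW ik).
have hom := kostka_homogeneous nz.
have [|bk bZ] := eqc.
  rewrite hom big_extend // [X in X - _]addrC addrK; apply: eq_bigr => i ik.
  by rewrite partE // addrK.
have dl (i : 'I_N) : (k <= i)%N -> b i <= delta N i.
  move=> ki; have := bZ i ki; rewrite bE; move: ki; rewrite leq_eqVlt => /predU1P[ki|ki].
    by rewrite [delta N i]ffunE -ki => h; rewrite -ltzD1 (lt_le_trans h) //; have := ltn_ord i; lia.
  by move=> _; rewrite [part _ _]ffunE ltnS leqNgt ki add0r gerBl.
have bd (i : 'I_N) : (k <= i)%N -> b i = delta N i.
  move=> ki; apply/eqP; rewrite eq_sym -subr_eq0.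
  (* By homogeneity the nonnegative differences on the remaining indices add up to 0, so each is
     0. *)
  have : \sum_(i : 'I_N | (k <= i)%N) (delta N i - b i) == 0.
    rewrite sumrB subr_eq0; apply/eqP.
    have e1 (f : pos) : \sum_i f i = \sum_(i : 'I_N | (i < k)%N) f i + \sum_(i : 'I_N | (k <= i)%N) f i.
      by rewrite (bigID (fun i : 'I_N => (i < k)%N)) /=; congr (_ + _); apply: eq_bigl => j; rewrite -leqNgt.
    move: hom; rewrite big_extend // (e1 b) (e1 (delta N)).
    rewrite (eq_bigr (fun i => la i + delta N i)) => [|j jk]; last by rewrite bk // partE.
    rewrite big_split /=.
    move: (\sum_(i : 'I_N | (i < k)%N) la i) (\sum_(i : 'I_N | (i < k)%N) delta N i).
    move: (\sum_(i : 'I_N | (k <= i)%N) b i) (\sum_(i : 'I_N | (k <= i)%N) delta N i).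
    by move=> x y z t; lia.
  rewrite psumr_eq0 => [/allP /(_ i)|j kj]; last by rewrite subr_ge0 dl.
  by rewrite mem_index_enum ki => /(_ isT).
apply/eqP/ffunP=> i; apply: val_inj => /=.
have eb : b i = part k i.
  have [ik|ki] := ltnP i k; first by rewrite bk // !ffunE ltnS (ltnW ik) ik.
  by rewrite bd // [RHS]ffunE ltnNge ki add0r.
have rE : (part k.+1 - qpos q0) i = part k.+1 i - (q0 i : nat)%:Z.
  by rewrite [LHS]ffunE [(- qpos q0) i]ffunE [qpos _ i]ffunE.
by move: eb; rewrite -q0E bE rE => /addrI /oppr_inj [].
Qed.

(** If the coefficient is nonzero, dominance bounds the prefix sums of [v] by those of the identity,
    so [perm_prefix_sums] gives [v = 1]. *)
Lemma kostka_shifted (v : 'S_N) :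
  kostka (la + delta N - perm_pos v (delta N)) N (la + delta N) = (v == 1%g)%:R.
Proof.
have laE : la + delta N = part N by apply/ffunP=> i; rewrite !ffunE ltn_ord.
have [->|v1] := eqVneq v 1%g; first by rewrite perm_pos1 addrK laE kostka_part.
apply/eqP; apply: contraNT v1 => nz; apply/eqP; apply: perm_prefix_sums => j jN.
set b := la + _ - _ in nz.
have bE i : b i = la i + delta N i - delta N (v i) by rewrite !ffunE.
have b0 i : 0 <= b i by have := kostka_rows_ge0 nz (ltn_ord i); rewrite extendE.
have sb : \sum_i b i = d%:Z.
  under eq_bigr do rewrite bE.
  rewrite sumrB big_split /= [X in _ + X - _](reindex_inj (@perm_inj _ v)) /=.
  by rewrite addrK.
have bd i : b i <= d%:Z by rewrite -sb (bigD1 i) //= lerDl sumr_ge0.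
rewrite laE in nz.
have := @kostka_partial_sums (part N) b (part N) N j bd (@decreasing_part N) _ nz.
rewrite jN leqnn => /(_ isT (fun=> lexx _)).
under eq_bigr do rewrite bE.
under [X in _ <= X]eq_bigr do rewrite -laE [(la + _) _]ffunE addrK.
rewrite sumrB big_split /= -addrA gerDl subr_le0 => le.
have dE (i : 'I_N) : delta N i = N%:Z - 1 - (i : nat)%:Z.
  by rewrite ffunE; have := ltn_ord i; lia.
move: le; under eq_bigr do rewrite dE.
under [X in _ <= X]eq_bigr do rewrite dE.
by rewrite !sumrB lerD2l lerN2.
Qed.

End Partition.
End KostkaValues.

(** * Irreducible characters of the symmetric group *)

Section ColouringCharacters.
Variables (d : nat).
Local Notation G := [set: 'S_d].

Definition stab (T : finType) (b : {ffun 'I_d -> T}) : {set 'S_d} :=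
  [set g : 'S_d | fixes g b].

Lemma stab_group_set T b : group_set (@stab T b).
Proof.
apply/group_setP; split=> [|g h]; first by rewrite inE /fixes recolour1.
by rewrite !inE /fixes recolourM => /eqP gb /eqP ->; rewrite gb.
Qed.
Canonical stab_group T b := Group (@stab_group_set T b).

Lemma recolour_inj (T : finType) h : injective (@recolour d T h).
Proof. by apply: (can_inj (g := recolour h^-1)) => c; rewrite -recolourM mulVg recolour1. Qed.

Lemma fixesJ (T : finType) (b : {ffun 'I_d -> T}) g h :
  fixes (g ^ h)%g b = fixes g (recolour h b).
Proof.
rewrite /fixes -(inj_eq (@recolour_inj _ h)) -!recolourM conjgE.
by rewrite mulgA mulgV mul1g recolourM.
Qed.

Lemma recolour_stab (T : finType) (b : {ffun 'I_d -> T}) h :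
  #|[set y | recolour y b == recolour h b]| = #|stab b|.
Proof.
rewrite -(card_imset (stab b) (@mulgI _ h)); congr #|pred_of_set _|.
apply/setP=> y; apply/idP/imsetP => [|[s]]; rewrite !inE.
  move=> /eqP yh; exists (h^-1 * y)%g; last by rewrite mulKVg.
  by rewrite inE /fixes recolourM yh -recolourM mulVg recolour1.
by rewrite /fixes => /eqP sb ->; rewrite recolourM sb.
Qed.

(** Cosets of the stabiliser correspond to colourings with the content of [b], so the induced
    character counts the fixed ones. *)
Lemma cfInd_stab1 (T : finType) (b : {ffun 'I_d -> T}) g :
  'Ind[G, stab b] 1 g = #|[set c | fixes g c & content c == content b]|%:R.
Proof.
rewrite cfIndE ?subsetT //.
have -> : \sum_(y in G) (1 : 'CF(stab b)) (g ^ y)%g =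
    \sum_(c | fixes g c && (content c == content b)) #|stab b|%:R :> algC.
  under eq_bigr do rewrite cfun1E inE.
  transitivity (\sum_(y in G) \sum_(c | fixes g c && (content c == content b))
      (recolour y b == c)%:R : algC).
    apply: eq_bigr => y _; rewrite -natr_sum; congr _%:R.
    rewrite fixesJ.
    have [fy|nfy] := boolP (fixes g (recolour y b)).
      rewrite (bigD1 (recolour y b)) /= ?fy ?content_recolour ?eqxx // big1 ?addn0 //.
      by move=> c /andP[_]; rewrite eq_sym => /negPf ->.
    by rewrite big1 // => c /andP[fc _]; case: eqP => // e; rewrite e fc in nfy.
  rewrite exchange_big /=; apply: eq_bigr => c /andP[_ /eqP cb].
  have [h ->] : exists h, c = recolour h b by apply: same_contentP.
  rewrite -(recolour_stab b h) -sum1dep_card natr_sum [RHS]big_mkcond /=.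
  by rewrite big_mkcond /=; apply: eq_bigr => y _; rewrite inE; case: eqP.
rewrite -sum1dep_card natr_sum mulr_sumr; apply: eq_bigr => c _.
by rewrite mulVf // pnatr_eq0 -lt0n cardG_gt0.
Qed.

Definition sign_char (chi : 'CF(G)) := forall g : 'S_d, chi g = (-1) ^+ g.

Lemma sign_char_is_char chi : sign_char chi -> chi \is a character.
Proof.
move=> chiE; pose r (g : 'S_d) : 'M[algC]_1 := ((-1) ^+ g)%:M.
have rP : mx_repr G r.
  split=> [|g h _ _]; first by rewrite /r odd_perm1.
  by rewrite /r odd_permM signr_addb scalar_mxM.
suff -> : chi = cfRepr (MxRepresentation rP) by apply: cfRepr_char.
by apply/cfunP=> g; rewrite cfunE inE mulr1n /= mxtrace_scalar chiE.
Qed.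

(** If two points agree in both colours, their transposition lies in both stabilisers and pairs off
    opposite signs; otherwise only the identity fixes both colourings. *)
Lemma sum_sign_stab (T1 T2 : finType) (c : {ffun 'I_d -> T1}) (b : {ffun 'I_d -> T2}) :
  \sum_(g in stab b | fixes g c) (-1) ^+ g =
  (injectiveb (fun x => (c x, b x)))%:R :> algC.
Proof.
case: injectiveP => [inj|ninj].
  rewrite (big_pred1 1%g) ?odd_perm1 // => g /=; rewrite inE; apply/andP/eqP.
    case=> /eqP/ffunP gb /eqP/ffunP gc; apply/permP=> x; rewrite perm1; apply: inj.
    by have := gb x; have := gc x; rewrite !ffunE => -> ->.
  by move=> ->; rewrite /fixes !recolour1.
have [x [y [xy e]]] : exists x y, x != y /\ (c x, b x) = (c y, b y).
  have /injectivePn [x [y xy e]] : ~~ injectiveb (fun x => (c x, b x)) by apply/injectiveP.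
  by exists x, y.
case: e => ec eb.
have tfix (T : finType) (f : {ffun 'I_d -> T}) : f x = f y -> recolour (tperm x y) f = f.
  by move=> e; apply/ffunP=> z; rewrite ffunE; case: tpermP => [->|->|].
suff : \sum_(g in stab b | fixes g c) (-1) ^+ g =
    - \sum_(g in stab b | fixes g c) (-1) ^+ g :> algC.
  by move/eqP; rewrite -addr_eq0 -mulr2n mulrn_eq0 /= => /eqP.
rewrite [LHS](reindex_inj (mulgI (tperm x y))) -sumrN /=; apply: eq_big => [g|g _].
  rewrite !inE /fixes !recolourM -{2}(tfix _ _ eb) -{2}(tfix _ _ ec).
  by rewrite (inj_eq (@recolour_inj T2 _)) (inj_eq (@recolour_inj T1 _)).
by rewrite odd_permM odd_tperm xy /= signrN.
Qed.

(** Frobenius reciprocity moves the product to [stab b2], where [sum_sign_stab] applies. Up to the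
    free action of [stab b2], the colourings counted are 0-1 matrices with the two contents as
    margins. *)
Lemma cfdot_perm_sign (T1 T2 : finType) (b1 : {ffun 'I_d -> T1})
    (b2 : {ffun 'I_d -> T2}) chi : sign_char chi ->
  '['Ind[G, stab b1] 1, 'Ind[G, stab b2] ('Res[stab b2] chi)] =
  #|[set c | (content c == content b1) && injectiveb (fun x => (c x, b2 x))]|%:R /
  #|stab b2|%:R.
Proof.
move=> chiE; rewrite cfdotC -Frobenius_reciprocity cfdotE.
have -> : \sum_(g in stab b2) 'Res[stab b2] chi g * ('Res[stab b2] ('Ind[G, stab b1] 1) g)^* =
    #|[set c | (content c == content b1) && injectiveb (fun x => (c x, b2 x))]|%:R :> algC.
  transitivity (\sum_(g in stab b2) \sum_(c | fixes g c && (content c == content b1))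
      (-1) ^+ g : algC).
    apply: eq_bigr => g gH; rewrite !cfResE ?subsetT // cfInd_stab1 chiE rmorph_nat.
    by rewrite -sum1dep_card natr_sum mulr_sumr; apply: eq_bigr => c _; rewrite mulr1.
  rewrite (exchange_big_dep (fun c => content c == content b1)) /=; last by move=> g c _ /andP[].
  rewrite -sum1dep_card natr_sum [RHS]big_mkcondr /=; apply: eq_bigr => c cb.
  rewrite (eq_bigl (fun g => (g \in stab b2) && fixes g c)) => [|g]; last by rewrite cb andbT.
  by rewrite sum_sign_stab; case: injectiveb.
by rewrite rmorphM fmorphV !rmorph_nat mulrC.
Qed.

End ColouringCharacters.

(** Measured from the threshold #|R|, passing from [R] to [S] adds only nonnegative terms and
    removes only negative ones. *)
Lemma initial_segment_sum (N : nat) (S R : {set 'I_N}) : #|S| = #|R| ->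
  (forall i j : 'I_N, j \in R -> (i < j)%N -> i \in R) ->
  (\sum_(k in R) k <= \sum_(k in S) k)%N /\ (\sum_(k in R) k = \sum_(k in S) k -> S = R)%N.
Proof.
move=> cSR dR; pose r := #|R|.
have RE k : (k \in R) = (k < r)%N.
  have le_card (A : {set 'I_N}) (m : nat) : (forall k, k \in A -> (k < m)%N) -> (#|A| <= m)%N.
    move=> h; rewrite cardE -(size_map val) -(size_iota 0 m).
    apply: uniq_leq_size; first by rewrite map_inj_uniq ?enum_uniq //; apply: val_inj.
    by move=> t /mapP[k']; rewrite mem_enum mem_iota => /h ? ->.
  apply/idP/idP => [kR|]; last first.
    apply: contraLR => kR; rewrite -leqNgt; apply: le_card => k' k'R.
    rewrite ltnNge; apply: contra kR => kk'.
    by move: kk'; rewrite leq_eqVlt => /predU1P[/val_inj -> //|/(dR _ _ k'R)].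
  have : [set k' : 'I_N | (k' <= k)%N] \subset R.
    apply/subsetP=> k'; rewrite inE leq_eqVlt => /predU1P[/val_inj -> //|].
    exact: dR.
  move/subset_leq_card; apply: leq_trans.
  rewrite -sum1dep_card -(big_ord_widen N (fun=> 1%N) (ltn_ord k)).
  by rewrite sum_nat_const card_ord muln1.
have e1 (A B : {set 'I_N}) : \sum_(k in A) ((k : nat)%:Z - r%:Z) =
    \sum_(k in A :&: B) ((k : nat)%:Z - r%:Z) + \sum_(k in A :\: B) ((k : nat)%:Z - r%:Z).
  by rewrite (big_setID B).
have dE : \sum_(k in S) (k : nat)%:Z - \sum_(k in R) (k : nat)%:Z =
    \sum_(k in S :\: R) ((k : nat)%:Z - r%:Z) + \sum_(k in R :\: S) (r%:Z - (k : nat)%:Z).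
  have e2 (A : {set 'I_N}) : \sum_(k in A) (k : nat)%:Z =
      \sum_(k in A) ((k : nat)%:Z - r%:Z) + r%:Z *+ #|A|.
    by rewrite sumrB sumr_const subrK.
  have -> : \sum_(k in R :\: S) (r%:Z - (k : nat)%:Z) = - \sum_(k in R :\: S) ((k : nat)%:Z - r%:Z).
    by rewrite -sumrN; apply: eq_bigr => k _; rewrite opprB.
  rewrite e2 [X in _ - X]e2 cSR (e1 S R) (e1 R S) [R :&: S]setIC; ring.
have sZ (A : {set 'I_N}) : (\sum_(k in A) k)%N%:Z = \sum_(k in A) (k : nat)%:Z.
  exact: (big_morph Posz PoszD (erefl _)).
have p1 : 0 <= \sum_(k in S :\: R) ((k : nat)%:Z - r%:Z).
  by apply: sumr_ge0 => k; rewrite inE RE -leqNgt subr_ge0 lez_nat => /andP[].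
have p2k k : k \in R :\: S -> 0 < r%:Z - (k : nat)%:Z.
  by rewrite inE RE subr_gt0 ltz_nat => /andP[].
have p2 : 0 <= \sum_(k in R :\: S) (r%:Z - (k : nat)%:Z).
  by apply: sumr_ge0 => k /p2k /ltW.
split; first by rewrite -lez_nat !sZ -subr_ge0 dE addr_ge0.
move=> e; move/eqP: dE; rewrite -!sZ e subrr eq_sym paddr_eq0 // => /andP[_ z2].
have sub : R \subset S.
  apply/subsetP=> k kR; apply: contraLR z2 => kS; rewrite gt_eqF //.
  have kD : k \in R :\: S by rewrite inE kS.
  rewrite (bigD1 k) //= ltr_pwDl ?p2k //.
  by apply: sumr_ge0 => k' /andP[/p2k /ltW].
by apply/esym/eqP; rewrite eqEcard sub cSR /=.
Qed.

(** * The common constituent as an alternating sum of permutation characters *)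

Section FrobeniusCharacter.
Variables (d N M : nat) (lam : 'I_N -> nat).
Hypothesis lam_dec : forall i j : 'I_N, (i < j)%N -> (lam j <= lam i)%N.
Hypothesis lam_sum : (\sum_k lam k = d)%N.
Hypothesis lam_le : forall k, (lam k <= M)%N.
Local Notation G := [set: 'S_d].
Notation pos := {ffun 'I_N -> int}.
Let la : pos := [ffun k => (lam k)%:Z].
Variables (b1 : {ffun 'I_d -> 'I_N}) (b2 : {ffun 'I_d -> 'I_M}).
Hypothesis b1_content : forall k, content b1 k = lam k :> nat.
Hypothesis b2_content : forall j, content b2 j = #|[set k | (j < lam k)%N]| :> nat.
Let alpha (w : 'S_N) : pos := la + delta N - perm_pos w (delta N).

(* The Gale-Ryser extremal case, tested on the single weight \sum_x c x. *)
Lemma extremal_colouring w (c : {ffun 'I_d -> 'I_N}) :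
  qpos (content c) = alpha w -> injective (fun x => (c x, b2 x)) ->
  w = 1%g /\ forall k j, #|[set x | (c x, b2 x) == (k, j)]| = (j < lam k)%N :> nat.
Proof.
move=> cE inj.
pose S j := c @: [set x | b2 x == j]; pose R (j : 'I_M) := [set k | (j < lam k)%N].
have injj j : {in [set x | b2 x == j] &, injective c}.
  by move=> x y; rewrite !inE => /eqP bx /eqP by_ cxy; apply: inj; rewrite bx by_ cxy.
have cSR j : #|S j| = #|R j| by rewrite card_in_imset // -contentE b2_content.
have dR j (i k : 'I_N) : k \in R j -> (i < k)%N -> i \in R j.
  by rewrite !inE => jk /lam_dec; apply: leq_trans.
have seg j := initial_segment_sum (cSR j) (dR j).
have dE (i : 'I_N) : delta N i = N%:Z - 1 - (i : nat)%:Z.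
  by rewrite ffunE; have := ltn_ord i; lia.
have sS : (\sum_x c x)%N = (\sum_j \sum_(k in S j) k)%N.
  rewrite (partition_big b2 xpredT) //=; apply: eq_bigr => j _.
  by rewrite big_imset //=; apply: eq_bigl => x; rewrite inE.
have sR : (\sum_(k < N) k * lam k)%N = (\sum_j \sum_(k in R j) k)%N.
  rewrite (exchange_big_dep xpredT) //=; apply: eq_bigr => k _.
  rewrite (eq_bigl (fun j : 'I_M => (j < lam k)%N)) => [|j]; last by rewrite inE.
  by rewrite -(big_ord_widen M (fun=> k : nat) (lam_le k)) sum_nat_const card_ord mulnC.
have sC : (\sum_x c x)%N = (\sum_(k < N) k * content c k)%N.
  rewrite (partition_big c xpredT) //=; apply: eq_bigr => k _.
  rewrite (eq_bigr (fun=> k : nat)) => [|x /eqP -> //].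
  by rewrite sum_nat_cond_const contentE mulnC.
(* The sum of squares equals twice the minimal weight minus the actual one, which is at most 0 by
   [seg]; both sides therefore vanish. *)
have sqE : \sum_(k < N) ((k : nat)%:Z - (w k : nat)%:Z) ^+ 2 =
    2 * ((\sum_j \sum_(k in R j) k)%N%:Z - (\sum_j \sum_(k in S j) k)%N%:Z).
  rewrite -sR -sS sC !(big_morph Posz PoszD (erefl _)) -sumrB mulr_sumr.
  have -> : \sum_(k < N) 2 * ((k * lam k)%N%:Z - (k * content c k)%N%:Z) =
      \sum_(k < N) (2 * (k : nat)%:Z ^+ 2 - 2 * (k : nat)%:Z * (w k : nat)%:Z).
    apply: eq_bigr => k _; move/ffunP/(_ k): cE.
    rewrite [qpos _ k]ffunE !PoszM => ->.
    rewrite [alpha w k]ffunE [(la + _) k]ffunE [(- _ : pos) k]ffunE [perm_pos _ _ k]ffunE.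
    rewrite [la k]ffunE !dE; ring.
  rewrite sumrB (eq_bigr (fun k : 'I_N => (k : nat)%:Z ^+ 2 + (w k : nat)%:Z ^+ 2 -
    2 * (k : nat)%:Z * (w k : nat)%:Z)) => [|k _]; last by ring.
  have wsq : \sum_(k < N) (w k : nat)%:Z ^+ 2 = \sum_(k < N) (k : nat)%:Z ^+ 2.
    by rewrite [RHS](reindex_inj (@perm_inj _ w)).
  by rewrite !sumrB big_split /= wsq -[in RHS]mulr_sumr; ring.
have leRS : (\sum_j \sum_(k in R j) k <= \sum_j \sum_(k in S j) k)%N.
  by apply: leq_sum => j _; have [] := seg j.
have sq0 : \sum_(k < N) ((k : nat)%:Z - (w k : nat)%:Z) ^+ 2 = 0.
  apply/eqP; rewrite eq_le sumr_ge0 ?andbT => [|k _]; last exact: sqr_ge0.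
  by rewrite sqE pmulr_rle0 // subr_le0 lez_nat.
split.
  apply/permP=> k; rewrite perm1; apply: val_inj => /=.
  have := sq0; move/eqP; rewrite psumr_eq0 => [/allP/(_ k)|? _]; last exact: sqr_ge0.
  by rewrite mem_index_enum => /(_ isT); rewrite sqrf_eq0 subr_eq0 eqz_nat => /eqP.
have SR j : S j = R j.
  have [le eqS] := seg j; apply: eqS; apply/eqP; rewrite eqn_leq le /=.
  have : (\sum_j \sum_(k in R j) k)%N = (\sum_j \sum_(k in S j) k)%N.
    by move: sq0; rewrite sqE; lia.
  rewrite (bigD1 j) //= [in RHS](bigD1 j) //= => e.
  rewrite leqNgt; apply/negP => lt.
  have : (\sum_(j' | j' != j) \sum_(k in R j') k <= \sum_(j' | j' != j) \sum_(k in S j') k)%N.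
    by apply: leq_sum => j' _; have [] := seg j'.
  by move=> le'; move: (leq_add lt le'); rewrite addSn e ltnn.
move=> k j; have := SR j; move/setP/(_ k); rewrite inE => <-.
have [/imsetP[x]|nS] := boolP (k \in S j).
  rewrite inE => /eqP bx kc; apply: etrans (cards1 x); congr #|pred_of_set _|.
  by apply/setP=> y; rewrite !inE -bx kc (inj_eq inj).
apply/eqP; rewrite cards_eq0; apply/eqP/setP=> x; rewrite !inE.
apply/negP => /eqP[cx bx]; case/negP: nS; apply/imsetP; exists x => //.
by rewrite inE bx.
Qed.

Let lam_le_d k : (lam k <= d)%N.
Proof. by rewrite -lam_sum (bigD1 k) //= leq_addr. Qed.

(** Colour the points by the cells of the Ferrers diagram of [lam], then permute them so that the
    column colouring becomes [b2]. *)
Lemma ferrers_colouring : exists c0 : {ffun 'I_d -> 'I_N},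
  forall k j, #|[set x | (c0 x, b2 x) == (k, j)]| = (j < lam k)%N :> nat.
Proof.
pose q : {ffun 'I_N * 'I_M -> 'I_d.+1} := [ffun p : 'I_N * 'I_M => inord (p.2 < lam p.1)%N].
have qE k j : q (k, j) = (j < lam k)%N :> nat.
  rewrite ffunE inordK // ltnS /=; case: ltnP => // jk.
  by apply: leq_trans (lam_le_d k); apply: leq_trans jk.
have [|p pE] := @content_onto d _ q.
  apply: etrans lam_sum; transitivity (\sum_k \sum_j q (k, j))%N.
    by rewrite pair_big /=; apply: eq_bigr => -[].
  apply: eq_bigr => k _; under eq_bigr do rewrite qE.
  rewrite -[RHS]muln1 -[lam k in RHS]card_ord -sum_nat_const.
  by rewrite (big_ord_widen M (fun=> 1%N) (lam_le k)) [RHS]big_mkcond.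
have /same_contentP [g gE] : content [ffun x => (p x).2] = content b2.
  apply/ffunP=> j; apply: val_inj; rewrite /= content_snd b2_content -sum1dep_card.
  by rewrite [RHS]big_mkcond; apply: eq_bigr => k _; rewrite pE qE.
exists (recolour g [ffun x => (p x).1]) => k j.
rewrite -qE -pE -(content_recolour g) contentE; congr #|pred_of_set _|.
by apply/setP=> x; rewrite !inE gE !ffunE -surjective_pairing.
Qed.

(** For [w = 1] the joint content is the Ferrers diagram, and [stab b2] acts simply transitively on
    the colourings that realise it. *)
Lemma count_extremal w :
  #|[set c : {ffun 'I_d -> 'I_N} | (qpos (content c) == alpha w) &&
     injectiveb (fun x => (c x, b2 x))]| = if w == 1%g then #|stab b2| else 0%N.
Proof.
have [w1|w1] := eqVneq w 1%g; last first.
  apply: eq_card0 => c; rewrite inE; apply/andP => -[/eqP ca /injectiveP inj].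
  by have [e _] := extremal_colouring ca inj; rewrite e eqxx in w1.
have [c0 c0E] := ferrers_colouring.
pose pair (c : {ffun 'I_d -> 'I_N}) : {ffun 'I_d -> 'I_N * 'I_M} := [ffun x => (c x, b2 x)].
have pairE c k j : content (pair c) (k, j) = #|[set x | (c x, b2 x) == (k, j)]| :> nat.
  by rewrite contentE; congr #|pred_of_set _|; apply/setP=> x; rewrite !inE ffunE.
have inj0 : injective (fun x => (c0 x, b2 x)).
  move=> x y e; have := c0E (c0 x) (b2 x) => card1.
  have : (#|[set x' | (c0 x', b2 x') == (c0 x, b2 x)]| <= 1)%N by rewrite card1; case: ltnP.
  by move/card_le1P => /(_ x); rewrite inE eqxx => /(_ isT y); rewrite !inE e eqxx => /esym/eqP.
rewrite -(@card_in_imset _ _ (fun g => recolour g c0)); last first.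
  move=> g h; rewrite !inE => /eqP/ffunP gb /eqP/ffunP hb /ffunP e; apply/permP=> x.
  by apply: inj0; have := gb x; have := hb x; have := e x; rewrite !ffunE => -> -> ->.
congr #|pred_of_set _|; apply/setP=> c; rewrite inE; apply/andP/imsetP.
  move=> [/eqP ca /injectiveP inj]; have [_ cE] := extremal_colouring ca inj.
  have /same_contentP [g /ffunP gE] : content (pair c0) = content (pair c).
    apply/ffunP=> -[k j]; apply: ord_inj; apply: etrans (pairE c0 k j) _.
    by rewrite c0E -(cE k j) -pairE.
  exists g; rewrite ?inE; first by apply/eqP/ffunP=> x; have := gE x; rewrite !ffunE => -[].
  by apply/ffunP=> x; have := gE x; rewrite !ffunE => -[].
move=> [g]; rewrite inE => /eqP/ffunP gb ->; split.
  rewrite content_recolour w1 /alpha perm_pos1 addrK; apply/eqP/ffunP=> k.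
  rewrite [LHS]ffunE [RHS]ffunE; congr Posz.
  have -> : c0 = [ffun x => (pair c0 x).1] by apply/ffunP=> x; rewrite !ffunE.
  rewrite content_fst; under eq_bigr do rewrite pairE c0E.
  rewrite -[RHS]muln1 -[lam k in RHS]card_ord -sum_nat_const.
  by rewrite (big_ord_widen M (fun=> 1%N) (lam_le k)) [RHS]big_mkcond.
apply/injectiveP => x y [ec eb]; apply: (@perm_inj _ g); apply: inj0.
by have := gb x; have := gb y; move: ec; rewrite !ffunE eb => -> -> ->.
Qed.

(* This is 0 when a has a negative entry. *)
Definition perm_cfun (a : pos) : 'CF(G) :=
  if [pick b : {ffun 'I_d -> 'I_N} | qpos (content b) == a] is Some b
  then 'Ind[G, stab b] 1 else 0.

Lemma qpos_inj : injective (@qpos d N).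
Proof.
move=> p q /ffunP e; apply/ffunP=> i; apply: val_inj.
by have := e i; rewrite !ffunE => -[].
Qed.

Lemma perm_cfunE a g : perm_cfun a g = (fixed_count a g)%:R.
Proof.
rewrite /perm_cfun /fixed_count; case: pickP => [b /eqP <-|none].
  rewrite cfInd_stab1; congr _%:R; congr #|pred_of_set _|.
  by apply/setP=> c; rewrite !inE (inj_eq qpos_inj).
by rewrite cfunE eq_card0 // => c; rewrite inE none andbF.
Qed.

Lemma perm_cfun_char a : perm_cfun a \is a character.
Proof.
rewrite /perm_cfun; case: pickP => [b _|_]; last exact: cfun0_char.
exact/cfInd_char/cfun1_char.
Qed.

Variable chi : 'CF(G).
Hypothesis chi_sign : sign_char chi.
Let eps : 'CF(G) := 'Ind[G, stab b2] ('Res[stab b2] chi).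

Lemma cfdot_perm_cfun_sign w : '[perm_cfun (alpha w), eps] = (w == 1%g)%:R.
Proof.
have <- : #|[set c : {ffun 'I_d -> 'I_N} | (qpos (content c) == alpha w) &&
     injectiveb (fun x => (c x, b2 x))]|%:R / #|stab b2|%:R = (w == 1%g)%:R :> algC.
  rewrite count_extremal; case: eqP => _; last by rewrite mul0r.
  by rewrite mulfV // pnatr_eq0 -lt0n cardG_gt0.
rewrite /perm_cfun; case: pickP => [b /eqP <-|none].
  rewrite cfdot_perm_sign //; congr (_%:R / _); congr #|pred_of_set _|.
  by apply/setP=> c; rewrite !inE (inj_eq qpos_inj).
by rewrite cfdot0l eq_card0 ?mul0r // => c; rewrite inE none.
Qed.

Definition frobenius_cfun : 'CF(G) :=
  \sum_(w : 'S_N) (-1) ^+ w *: perm_cfun (alpha w).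

Lemma frobenius_cfunE g : frobenius_cfun g = ratr (frobenius (la + delta N) g).
Proof.
rewrite sum_cfunE frobeniusE rmorph_sum; apply: eq_bigr => w _.
by rewrite cfunE perm_cfunE rmorphM rmorph_sign rmorph_nat.
Qed.

(** The inner product is a Kostka coefficient by [sum_frobenius_fixed_count], and [kostka_shifted]
    evaluates it. *)
Lemma cfdot_frobenius_perm v :
  '[frobenius_cfun, perm_cfun (alpha v)] = (v == 1%g)%:R.
Proof.
have sal : \sum_i alpha v i = d%:Z.
  have -> : \sum_i alpha v i = \sum_i la i + \sum_i delta N i - \sum_i perm_pos v (delta N) i.
    by rewrite -big_split -sumrB /=; apply: eq_bigr => i _; rewrite !ffunE.
  rewrite [X in _ + X - _](reindex_inj (@perm_inj _ v)).
  rewrite [X in _ - X](eq_bigr (fun i => delta N (v i))) => [|i _]; last by rewrite ffunE.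
  rewrite addrK -lam_sum (big_morph Posz PoszD (erefl _)).
  by apply: eq_bigr => i _; rewrite ffunE.
rewrite cfdotE.
have -> : \sum_(g in G) frobenius_cfun g * (perm_cfun (alpha v) g)^* =
    ratr (\sum_(g : 'S_d) frobenius (la + delta N) g * (fixed_count (alpha v) g)%:R).
  rewrite rmorph_sum /=; apply: eq_big => [g|g _]; first by rewrite inE.
  by rewrite frobenius_cfunE perm_cfunE rmorphM !rmorph_nat.
rewrite sum_frobenius_fixed_count // kostka_shifted; first last.
- rewrite -lam_sum (big_morph Posz PoszD (erefl _)).
  by apply: eq_bigr => i _; rewrite ffunE.
- by move=> i j ij; rewrite !ffunE lez_nat lam_dec.
- by move=> i; rewrite ffunE.
rewrite cardsT card_Sn rmorphMn /= rmorph_nat -[X in _ * X]mulr_natr mulrCA mulVf ?mulr1 //.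
by rewrite pnatr_eq0 -lt0n fact_gt0.
Qed.

Lemma frobenius_cfun_norm : '[frobenius_cfun] = 1.
Proof.
rewrite {2}/frobenius_cfun cfdot_sumr (bigD1 1%g) //= big1 ?addr0.
  by rewrite cfdotZr cfdot_frobenius_perm odd_perm1 rmorph1 eqxx mul1r.
by move=> w w1; rewrite cfdotZr cfdot_frobenius_perm (negPf w1) mulr0.
Qed.

Lemma frobenius_cfun_vchar : frobenius_cfun \in 'Z[irr G]%g.
Proof.
apply: rpred_sum => w _; have := char_vchar (perm_cfun_char (alpha w)).
by rewrite scaler_sign; case: (odd_perm w); rewrite ?rpredN.
Qed.

(** The products of multiplicities add up to 1, so ['chi_i] occurs once in the term [w = 1];
    orthogonality to [eps] keeps it out of all other terms. Thus it has coefficient 1 in a virtual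
    character of norm 1, which is an irreducible up to sign. *)
Lemma common_constituent_mul i :
  i \in irr_constt (perm_cfun la) -> i \in irr_constt eps -> frobenius_cfun = 'chi_i.
Proof.
have chi_char := sign_char_is_char chi_sign.
have eps_char : eps \is a character by apply/cfInd_char/cfRes_char.
have laE : la = alpha 1 by rewrite /alpha perm_pos1 addrK.
rewrite !irr_consttE => pi0 ei0.
have nat1 (x : algC) : x \in Num.nat -> x != 0 -> 1 <= x.
  by move=> /natrP[n ->]; rewrite pnatr_eq0 -lt0n ler1n.
have piE : '[perm_cfun la, 'chi_i] = 1.
  have := cfdot_perm_cfun_sign 1; rewrite -laE eqxx cfdot_sum_irr (bigD1 i) //=.
  set p := '[_, _] in pi0 *; set e := '[_, _] in ei0 *; set S := \sum_(_ | _) _ => pe.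
  have pN : p \in Num.nat by apply/Cnat_cfdot_char_irr/perm_cfun_char.
  have eN : e \in Num.nat by apply: Cnat_cfdot_char_irr.
  have S0 : 0 <= S.
    apply: sumr_ge0 => j _; rewrite mulr_ge0 // ?conjC_ge0; apply: natr_ge0.
      exact/Cnat_cfdot_char_irr/perm_cfun_char.
    exact/Cnat_cfdot_char_irr.
  rewrite conj_natr // in pe; have {}pe : p * e + S = 1 by [].
  apply/eqP; rewrite eq_le nat1 // andbT.
  have : p * e <= 1 by rewrite -pe lerDl.
  by apply: le_trans; rewrite ler_peMr ?nat1 // natr_ge0.
have zero w : w != 1%g -> '[perm_cfun (alpha w), 'chi_i] = 0.
  move=> w1; have := cfdot_perm_cfun_sign w; rewrite (negPf w1) cfdot_sum_irr => /eqP.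
  rewrite psumr_eq0 => [/allP/(_ i)|j _].
    rewrite mem_index_enum => /(_ isT); rewrite mulf_eq0 conjC_eq0 (negPf ei0) orbF.
    by move/eqP.
  rewrite mulr_ge0 // ?conjC_ge0; apply: natr_ge0.
    exact/Cnat_cfdot_char_irr/perm_cfun_char.
  exact/Cnat_cfdot_char_irr.
have Xi : '[frobenius_cfun, 'chi_i] = 1.
  rewrite cfdot_suml (bigD1 1%g) //= big1 ?addr0.
    by rewrite cfdotZl -laE piE odd_perm1 mul1r.
  by move=> w w1; rewrite cfdotZl zero // mulr0.
have [s [j XE]] := vchar_norm1P frobenius_cfun_vchar frobenius_cfun_norm.
move: Xi; rewrite XE cfdotZl cfdot_irr; case: eqP => [->|_].
  by rewrite mulr1 => ->; rewrite scale1r.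
by rewrite mulr0 => /eqP; rewrite eq_sym oner_eq0.
Qed.

Lemma common_constituent_exists :
  exists2 i, i \in irr_constt (perm_cfun la) & i \in irr_constt eps.
Proof.
have laE : la = alpha 1 by rewrite /alpha perm_pos1 addrK.
case: (pickP (fun i => (i \in irr_constt (perm_cfun la)) && (i \in irr_constt eps))).
  by move=> i /andP[]; exists i.
move=> none; have := cfdot_perm_cfun_sign 1; rewrite -laE eqxx cfdot_sum_irr big1.
  by move/eqP; rewrite eq_sym oner_eq0.
move=> i _; have := none i; rewrite !irr_consttE.
by case: eqP => [->|_] /=; [rewrite mul0r | move/negbFE/eqP ->; rewrite rmorph0 mulr0].
Qed.

Lemma perm_cfun_b1 : perm_cfun la = 'Ind[G, stab b1] 1.
Proof.
apply/cfunP=> g; rewrite perm_cfunE cfInd_stab1 /fixed_count; congr _%:R.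
congr #|pred_of_set _|; apply/setP=> c; rewrite !inE; congr (_ && _).
rewrite -(inj_eq qpos_inj); congr (_ == _); apply/ffunP=> k.
by rewrite [LHS]ffunE [RHS]ffunE b1_content.
Qed.

End FrobeniusCharacter.

(** * Consecutive blocks, cycle types and Young subgroups *)

Lemma card_block d (sh : seq nat) r : sumn sh = d ->
  #|[set x : 'I_d | reshape_index sh x == r]| = nth 0%N sh r.
Proof.
move=> sd; rewrite -[RHS]card_ord -cardsT.
have lt (c : 'I_(nth 0%N sh r)) : (flatten_index sh r c < d)%N.
  by rewrite -[X in (_ < X)%N]sd flatten_indexP.
rewrite -(card_imset setT (f := fun c => Ordinal (lt c))); last first.
  move=> c c' [e]; apply: ord_inj.
  by rewrite -(flatten_indexKr (ltn_ord c)) e flatten_indexKr.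
congr #|pred_of_set _|; apply/setP=> x; rewrite inE; apply/eqP/imsetP => [xr|[c _ ->]].
  have xd : (x < sumn sh)%N by rewrite sd.
  have ot := reshape_offsetP xd; rewrite xr in ot.
  by exists (Ordinal ot); rewrite ?inE //; apply: ord_inj; rewrite /= -xr reshape_indexK.
by rewrite /= flatten_indexKl.
Qed.

(** The witness rotates each block of consecutive points: the offset grows by 1 modulo the block
    size, so the blocks are the orbits. *)
Lemma cycle_type_exists d (mu : seq nat) : all (leq 1) mu -> sumn mu = d ->
  exists g : 'S_d, perm_eq [seq #|c| | c : {set 'I_d} <- enum (porbits g)] mu.
Proof.
move=> /all_nthP pos sd.
pose r (x : 'I_d) := reshape_index mu x; pose o (x : 'I_d) := reshape_offset mu x.
have xd (x : 'I_d) : (x < sumn mu)%N by rewrite sd.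
have rl x : (r x < size mu)%N by apply: reshape_indexP.
have ol x : (o x < nth 0 mu (r x))%N by apply: reshape_offsetP.
have ro_inj x y : r x = r y -> o x = o y -> x = y.
  move=> er eo; apply: ord_inj; rewrite -(reshape_indexK mu x) -(reshape_indexK mu y).
  by rewrite -/(r x) -/(o x) er eo.
have elt k c : (c < nth 0 mu k)%N -> exists x : 'I_d, r x = k /\ o x = c.
  move=> h; have lt : (flatten_index mu k c < d)%N by rewrite -[X in (_ < X)%N]sd flatten_indexP.
  by exists (Ordinal lt); rewrite /r /o /= flatten_indexKl ?flatten_indexKr.
have next x : exists y, r y = r x /\ o y = ((o x).+1 %% nth 0 mu (r x))%N.
  by apply: elt; rewrite ltn_mod; apply: leq_trans (ol x).
have [f fP] := fin_all_exists next.
have f_inj : injective f.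
  move=> x y e; have [rx ox] := fP x; have [ry oy] := fP y.
  have er : r x = r y by rewrite -rx e.
  apply: ro_inj => //; have := ol x; have := ol y; rewrite -er => ly lx.
  have : ((o x).+1 == (o y).+1 %[mod nth 0 mu (r x)])%N by rewrite -ox e oy -er.
  rewrite -[(o x).+1]addn1 -[(o y).+1]addn1 eqn_modDr.
  by rewrite !modn_small // => /eqP.
pose g := perm f_inj; exists g.
have gn n x : r ((g ^+ n)%g x) = r x /\ o ((g ^+ n)%g x) = ((o x + n) %% nth 0 mu (r x))%N.
  elim: n => [|n [IHr IHo]]; first by rewrite expg0 perm1 addn0 modn_small.
  rewrite expgSr permM permE; have [-> ->] := fP ((g ^+ n)%g x).
  by rewrite IHr IHo; split=> //; rewrite -addn1 modnDml addn1 addnS.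
have orb x : porbit g x = [set y | r y == r x].
  apply/setP=> y; rewrite inE; apply/porbitP/eqP => [[n ->]|ry].
    by case: (gn n x).
  exists (o y + (nth 0 mu (r x) - o x))%N; have [rn on] := gn (o y + (nth 0 mu (r x) - o x))%N x.
  apply: ro_inj; first by rewrite rn.
  rewrite on addnCA subnKC ?(ltnW (ol x)) // modnDr modn_small //.
  by have := ol y; rewrite ry.
pose blk k : {set 'I_d} := [set y | r y == k].
have muE : mu = [seq #|blk k| | k <- iota 0 (size mu)].
  apply: (@eq_from_nth _ 0%N) => [|k kl]; first by rewrite size_map size_iota.
  by rewrite (nth_map 0%N) ?size_iota // nth_iota // add0n card_block.
rewrite {}[X in perm_eq _ X]muE (map_comp (fun c : {set 'I_d} => #|c|) blk); apply: perm_map.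
apply: uniq_perm; rewrite ?enum_uniq //.
  rewrite map_inj_in_uniq ?iota_uniq // => k k'; rewrite !mem_iota add0n => /= kl _ /setP e.
  have [x [rx _]] := elt k 0%N (pos 0%N k kl).
  by have := e x; rewrite !inE rx eqxx => /esym/eqP.
move=> B; rewrite mem_enum; apply/imsetP/mapP => [[x _ ->]|[k]].
  by exists (r x); rewrite ?orb // mem_iota add0n rl.
rewrite mem_iota add0n => /= kl ->; have [x [rx _]] := elt k 0%N (pos 0%N k kl).
by exists x; rewrite ?orb ?rx.
Qed.

Section FrobeniusCycleType.
Variables (d N : nat).
Notation pos := {ffun 'I_N -> int}.

(** Multiplication by the power sums p_k, acting on coefficients; these are the raising
    operators. *)
Definition cycle_sums (mu : seq int) (phi : pos -> rat) : pos -> rat :=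
  foldr (fun k psi a => \sum_i psi (a - unit_pos i k)) phi mu.

(** A fixed colouring is a free choice of one colour per cycle, and a cycle of length k adds k to
    the content of its colour. The list [cs] orders the cycles to match [mu]. *)
Lemma sum_fixes_cycle_type (g : 'S_d) (mu : seq nat) (phi : pos -> rat) (a : pos) :
  perm_eq [seq #|c| | c : {set 'I_d} <- enum (porbits g)] mu ->
  \sum_(c : {ffun 'I_d -> 'I_N} | fixes g c) phi (a - qpos (content c)) =
  cycle_sums [seq k%:Z | k <- mu] phi a.
Proof.
rewrite perm_sym => /(perm_iotaP 0%N) [Is IsP muE].
pose cs := [seq nth set0 (enum (porbits g)) i | i <- Is].
rewrite size_map in IsP.
have csE : perm_eq cs (enum (porbits g)) by apply/(perm_iotaP set0); exists Is.
have cs_uniq : uniq cs by rewrite (perm_uniq csE) enum_uniq.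
have szI : size cs = size mu by rewrite muE !size_map.
have cs_card p : (p < size mu)%N -> #|nth set0 cs p| = nth 0%N mu p.
  rewrite muE size_map => pI; rewrite !(nth_map 0%N) // (nth_map set0) //.
  by have := mem_nth 0%N pI; rewrite (perm_mem IsP) mem_iota.
have cs_porbit p : (p < size mu)%N -> exists x, nth set0 cs p = porbit g x.
  move=> pl; have : nth set0 cs p \in enum (porbits g) by rewrite -(perm_mem csE) mem_nth ?szI.
  by rewrite mem_enum => /imsetP[x _ ->]; exists x.
have [rp rpP] := fin_all_exists (fun p : 'I_(size mu) => cs_porbit p (ltn_ord p)).
have ix_ex x : exists p : 'I_(size mu), nth set0 cs p = porbit g x.
  have xcs : porbit g x \in cs by rewrite (perm_mem csE) mem_enum imset_f.
  have lt : (index (porbit g x) cs < size mu)%N by rewrite -szI index_mem.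
  by exists (Ordinal lt); rewrite /= nth_index.
have [ix ixP] := fin_all_exists ix_ex.
have ix_porbit x y : porbit g x = porbit g y -> ix x = ix y.
  move=> e; apply: ord_inj; apply/eqP.
  by rewrite -(nth_uniq set0 _ _ cs_uniq) ?szI // !ixP e.
have ixK p : ix (rp p) = p.
  apply: ord_inj; apply/eqP.
  by rewrite -(nth_uniq set0 _ _ cs_uniq) ?szI // ixP rpP.
rewrite /cycle_sums (foldr_sum_ffun (fun _ _ => true) (fun k i => unit_pos i k) phi 0
  (l := size mu)) ?size_map //.
rewrite [RHS](eq_bigl xpredT) => [|f]; last by apply/forallP.
pose h (f : {ffun 'I_(size mu) -> 'I_N}) : {ffun 'I_d -> 'I_N} := [ffun x => f (ix x)].
rewrite (reindex h) /=; last first.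
  exists (fun c => [ffun p => c (rp p)]) => [f _|c].
    by apply/ffunP=> p; rewrite !ffunE ixK.
  rewrite inE => /eqP cg; apply/ffunP=> x; rewrite !ffunE.
  have cn n y : c ((g ^+ n)%g y) = c y.
    elim: n => [|n IH]; first by rewrite expg0 perm1.
    transitivity (recolour g c ((g ^+ n)%g y)); last by rewrite cg IH.
    by rewrite ffunE expgSr permM.
  have : rp (ix x) \in porbit g x by rewrite -ixP rpP porbit_id.
  by case/porbitP=> n ->; rewrite cn.
apply: eq_big => [f|f _].
  apply/eqP/ffunP=> x; rewrite !ffunE; congr (f _); apply: ix_porbit.
  by have := porbit_perm g 1 x; rewrite expg1.
congr (phi (_ - _)); apply/ffunP=> k.
rewrite [LHS]ffunE contentE sum_ffunE -sum1dep_card (partition_big ix xpredT) //=.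
rewrite (big_morph Posz PoszD (erefl _)); apply: eq_bigr => p _.
rewrite ffunE (nth_map 0%N) // -cs_card // eq_sym.
case: eqP => [fp|nfp]; last first.
  rewrite big1 // => x /andP[/eqP]; rewrite ffunE => fx /eqP xp.
  by case: nfp; rewrite -fx xp.
congr Posz; rewrite -sum1_card; apply: eq_bigl => x; rewrite ffunE.
have -> : (x \in nth set0 cs p) = (ix x == p).
  apply/idP/eqP => [|<-]; last by rewrite ixP porbit_id.
  by rewrite rpP => xp; rewrite -(ixK p); apply: ix_porbit; apply/eqP; rewrite eq_porbit_mem.
by apply/andP/eqP => [[_ /eqP]|e] //; rewrite e fp !eqxx.
Qed.

End FrobeniusCycleType.

Section BlockColouring.
Variables (d K : nat) (sh : seq nat).
Hypotheses (sum_sh : sumn sh = d) (size_sh : (size sh <= K)%N).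

Lemma block_colouring_subproof (x : 'I_d) : (reshape_index sh x < K)%N.
Proof. by apply: leq_trans size_sh; apply: reshape_indexP; rewrite sum_sh. Qed.
Definition block_colouring : {ffun 'I_d -> 'I_K} :=
  [ffun x => Ordinal (block_colouring_subproof x)].

Lemma content_block_colouring k : content block_colouring k = nth 0%N sh k :> nat.
Proof.
rewrite contentE -(card_block k sum_sh); congr #|pred_of_set _|.
by apply/setP=> x; rewrite !inE ffunE -val_eqE.
Qed.

(** This transfers the results on colourings to the Young subgroups that define [chi_index]. *)
Lemma young_group_stab : young_group d sh = stab_group block_colouring.
Proof.
apply/group_inj/setP=> g; rewrite !inE; apply/forallP/eqP => [gP|/ffunP gP x].
  by apply/ffunP=> x; apply: ord_inj; rewrite !ffunE /= (eqP (gP x)).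
by have := gP x; rewrite !ffunE => -[->].
Qed.

End BlockColouring.

Definition part_pos N (la : seq nat) : {ffun 'I_N -> int} := [ffun i : 'I_N => (nth 0%N la i)%:Z].

(** * Characters and power sums of a partition in terms of its configuration *)

Section Partitions.
Variables (d N : nat) (la : seq nat).
Hypotheses (la_part : is_partition d la) (la_size : size la = d) (dN : (d <= N)%N).

Lemma partition_nth_le i j : (i <= j)%N -> (nth 0%N la j <= nth 0%N la i)%N.
Proof.
move=> ij; have [la_sorted _] := andP la_part.
have [jl|jl] := ltnP j (size la); last by rewrite (nth_default _ jl).
apply: (@sorted_leq_nth _ geq _ _ 0%N la la_sorted i j) => //.
- by move=> x y z /= xy yz; apply: leq_trans yz xy.
- by move=> x /=.
- by rewrite inE (leq_ltn_trans ij).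
Qed.

Lemma partition_sum : (\sum_(k < N) nth 0%N la k = d)%N.
Proof.
have [_ /eqP sd] := andP la_part.
rewrite -[RHS]sd sumnE (big_nth 0%N) la_size big_mkord (big_ord_widen _ _ dN) [RHS]big_mkcond.
by apply: eq_bigr => k _; case: ltnP => // kd; rewrite nth_default // la_size.
Qed.

Lemma partition_le k : (nth 0%N la k <= d)%N.
Proof.
have [kN|kN] := ltnP k N; last by rewrite nth_default // la_size (leq_trans dN).
by rewrite -[X in (_ <= X)%N]partition_sum (bigD1 (Ordinal kN)) //= leq_addr.
Qed.

Lemma conj_nth j : (j < d)%N -> nth 0%N (conj_partition la) j = count (fun p => (j < p)%N) la.
Proof. by move=> jd; rewrite nth_mkseq //; case/andP: la_part => _ /eqP ->. Qed.

Lemma conj_size : size (conj_partition la) = d.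
Proof. by rewrite size_mkseq; case/andP: la_part => _ /eqP. Qed.

Lemma count_conj j : count (fun p => (j < p)%N) la = #|[set k : 'I_N | (j < nth 0%N la k)%N]|.
Proof.
rewrite -sum1dep_card -sum1_count (big_nth 0%N) la_size big_mkord big_mkcond /=.
rewrite (big_ord_widen _ (fun i => if (j < nth 0 la i)%N then 1%N else 0%N) dN).
rewrite [RHS]big_mkcond [LHS]big_mkcond.
by apply: eq_bigr => k _; case: (ltnP k d) => // kd; rewrite nth_default // la_size.
Qed.

Lemma conj_sum : sumn (conj_partition la) = d.
Proof.
rewrite sumnE (big_nth 0%N) conj_size big_mkord.
rewrite (eq_bigr (fun j : 'I_d => \sum_(k < N | (j < nth 0 la k)%N) 1)%N) => [|j _]; last first.
  by rewrite conj_nth // count_conj -sum1dep_card.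
rewrite (exchange_big_dep xpredT) //= -[RHS]partition_sum; apply: eq_bigr => k _.
by rewrite -(big_ord_widen d (fun=> 1%N) (partition_le k)) sum_nat_const card_ord muln1.
Qed.

(** Frobenius' formula. The [pick] in [chi_index] succeeds by [common_constituent_exists], and
    whatever it returns is [frobenius_cfun] by [common_constituent_mul]. *)
Lemma chi_frobenius g : chi d la g = ratr (frobenius (part_pos N la + delta N) g).
Proof.
have [_ /eqP sd] := andP la_part.
have sN : (size la <= N)%N by rewrite la_size.
have cd : (size (conj_partition la) <= d)%N by rewrite conj_size.
pose b1 := block_colouring sd sN; pose b2 := block_colouring conj_sum cd.
pose lam (k : 'I_N) := nth 0%N la k.
have lam_dec (i j : 'I_N) : (i < j)%N -> (lam j <= lam i)%N by move=> /ltnW; apply: partition_nth_le.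
have lam_le k : (lam k <= d)%N by apply: partition_le.
have c1 k : content b1 k = lam k :> nat by apply: content_block_colouring.
have c2 j : content b2 j = #|[set k | (j < lam k)%N]| :> nat.
  by rewrite content_block_colouring conj_nth // count_conj.
have sg : sign_char (cf_sign d) by move=> h; rewrite cfunE.
have [i0 i0a i0b] := common_constituent_exists lam_dec partition_sum lam_le c2 sg.
rewrite /chi /chi_index (young_group_stab sd sN) (young_group_stab conj_sum cd).
case: pickP => [i /andP[ia ib]|none] /=; last first.
  by have := none i0; rewrite -(perm_cfun_b1 c1) i0a i0b.
rewrite -(perm_cfun_b1 c1) in ia.
rewrite -(common_constituent_mul lam_dec partition_sum lam_le c2 sg ia ib).
by rewrite frobenius_cfunE.
Qed.

Lemma chi_at_cycle_sums mu : all (leq 1) mu -> sumn mu = d ->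
  chi_at d la mu = ratr (cycle_sums [seq k%:Z | k <- mu] (@vacuum N) (part_pos N la + delta N)).
Proof.
move=> mu_pos mu_sum; rewrite /chi_at chi_frobenius; congr ratr.
rewrite /frobenius (sum_fixes_cycle_type (mu := mu)) //.
rewrite /perm_of_cycle_type; case: pickP => [g //|none].
by have [g gP] := cycle_type_exists mu_pos mu_sum; have := none g; rewrite /has_cycle_type gP.
Qed.

(** Measured from the surface of the sea, particle [i] of [delta] sits at - i - 1/2, the shift in
    the definition of p_k. *)
Lemma shifted_power_sum_charge r :
  shifted_power_sum r.+1 la / (r.+1)`!%:R = charge r (part_pos N la + delta N).
Proof.
rewrite /shifted_power_sum /charge -mulr_suml; congr (_ / _).
rewrite la_size big_mkord (big_ord_widen N (fun i => (((nth 0%N la i)%:R - i%:R - 1 / 2) ^+ r.+1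
   - (- i%:R - 1 / 2) ^+ r.+1) : rat) dN) big_mkcond.
apply: eq_bigr => i _.
have dE : (delta N i)%:~R = N%:R - i%:R - 1 :> rat.
  rewrite ffunE -pmulrn natrB // -addn1 natrD; ring.
have -> : midpoint N 0 (delta N i) = - i%:R - 1 / 2 by rewrite /midpoint dE; field.
have -> : midpoint N 0 ((part_pos N la + delta N) i) = (nth 0%N la i)%:R - i%:R - 1 / 2.
  by rewrite /midpoint [(part_pos N la + _) i]ffunE intrD dE [part_pos _ _ _]ffunE; field.
by case: ltnP => // di; rewrite nth_default ?la_size // sub0r subrr.
Qed.

End Partitions.

(** * Hurwitz numbers as matrix elements *)

Section AlternatingExpansion.
Variables (d N : nat).
Hypothesis dN : (d <= N)%N.
Notation pos := {ffun 'I_N -> int}.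
Notation partition := (d.-tuple 'I_d.+1).
Implicit Types (a b : pos) (t : partition) (w : 'S_N).

Definition shifted_part t : pos := part_pos N (map val t) + delta N.
Definition is_part t := is_partition d (map val t).

Lemma shifted_partE t (i : 'I_N) : shifted_part t i = (nth 0%N (map val t) i)%:Z + delta N i.
Proof. by rewrite !ffunE. Qed.

Lemma decreasing_shifted_part t : is_part t -> decreasing (shifted_part t).
Proof.
move=> tp i j ij; rewrite !shifted_partE; apply: ler_ltD; last exact: decreasing_delta.
by rewrite lez_nat (partition_nth_le tp) // ltnW.
Qed.

Lemma decreasing_inj a : decreasing a -> injective a.
Proof.
move=> dec i j e; apply: ord_inj; case: (ltngtP (i : nat) j) => // ij.
  by have := dec i j ij; rewrite e ltxx.
by have := dec j i ij; rewrite e ltxx.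
Qed.

Lemma decreasing_perm a b w v : decreasing a -> decreasing b ->
  perm_pos w a = perm_pos v b -> a = b.
Proof.
move=> da db e.
have sorted_codom (c : pos) : decreasing c -> sorted >%R (codom c).
  move=> dc; have h : sorted (relpre val ltn) (enum 'I_N).
    by rewrite -sorted_map val_enum_ord iota_ltn_sorted.
  by rewrite codomE sorted_map; apply: sub_sorted h => i j; apply: dc.
have mem : codom a =i codom b.
  move=> x; apply/idP/idP => /codomP[k ->]; apply/codomP.
    exists (v ((w^-1)%g k)); have /ffunP/(_ ((w^-1)%g k)) := e.
    by rewrite !ffunE permKV.
  exists (w ((v^-1)%g k)); have /ffunP/(_ ((v^-1)%g k)) := e.
  by rewrite !ffunE permKV.
have ce : codom a = codom b.
  apply: (irr_sorted_eq _ _ (sorted_codom a da) (sorted_codom b db) mem).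
    by move=> x y z yx zy; apply: lt_trans zy yx.
  by move=> x; rewrite /= ltxx.
have nthE (c : pos) (i : 'I_N) : nth (0 : int) (codom c) i = c i.
  by rewrite codomE (nth_map i) ?size_enum_ord // nth_ord_enum.
by apply/ffunP=> i; rewrite -!nthE ce.
Qed.

Lemma shifted_part_inj t t' : shifted_part t = shifted_part t' -> t = t'.
Proof.
move=> e; apply: eq_from_tnth => i.
have /ffunP/(_ (Ordinal (leq_trans (ltn_ord i) dN))) := e.
rewrite !shifted_partE /= => /addIr [].
by rewrite !(nth_map ord0) ?size_tuple // -!tnth_nth => /ord_inj.
Qed.

Lemma injective_sort b : injective b -> (forall i, 0 <= b i) ->
  exists a w, [/\ decreasing a, b = perm_pos w a & forall i, delta N i <= a i].
Proof.
move=> b_inj b_ge0.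
pose s := sort >=%R (codom b).
have ss : size s = N by rewrite size_sort size_codom card_ord.
have s_uniq : uniq s by rewrite sort_uniq; apply/injectiveP.
have s_sorted : sorted >=%R s by apply: sort_sorted => x y; apply: le_total.
have s_mem x : (x \in s) = (x \in codom b) by rewrite mem_sort.
pose a : pos := [ffun i : 'I_N => nth 0 s i].
have dec : decreasing a.
  move=> i j ij; rewrite !ffunE lt_neqAle nth_uniq ?ss ?ltn_ord // gtn_eqF //=.
  apply: (sorted_leq_nth _ _ (0 : int) s_sorted); last exact: ltnW.
  - by move=> x y z yx zy; apply: le_trans zy yx.
  - by move=> x; apply: lexx.
  - by rewrite inE ss ltn_ord.
  - by rewrite inE ss ltn_ord.
have ix_lt i : (index (b i) s < N)%N by rewrite -[X in (_ < X)%N]ss index_mem s_mem codom_f.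
have ix_inj : injective (fun i => Ordinal (ix_lt i)).
  move=> i j [e]; apply: b_inj.
  by rewrite -(nth_index 0 (_ : b i \in s)) ?e ?nth_index // s_mem codom_f.
exists a, (perm ix_inj); split=> //.
  by apply/ffunP=> i; rewrite !ffunE permE /= nth_index // s_mem codom_f.
have a_ge0 i : 0 <= a i.
  have : nth 0 s i \in codom b by rewrite -s_mem mem_nth // ss.
  by rewrite ffunE => /codomP[j ->].
(* Induction from the last particle, at level 0 or higher, towards the first: each step up gains at
   least 1. *)
move=> i; have [n] := ubnP (N - i)%N; elim: n i => // n IH i; rewrite ltnS => ni.
have [iN|iN] := ltnP i.+1 N; last first.
  apply: le_trans (a_ge0 i); rewrite ffunE.
  by have -> : (N - i.+1)%N = 0%N by apply/eqP; rewrite subn_eq0.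
have := IH (Ordinal iN); rewrite /= => /(_ _) h.
have lt := dec i (Ordinal iN) (ltnSn _).
have {}h : delta N (Ordinal iN) <= a (Ordinal iN) by apply: h; have := iN; move: ni; lia.
have -> : delta N i = delta N (Ordinal iN) + 1 by rewrite !ffunE /=; have := iN; lia.
by rewrite lezD1; apply: le_lt_trans lt.
Qed.

(** Sorting [b] and subtracting [delta] leaves a weakly decreasing sequence with sum [d]. *)
Lemma shifted_part_onto b : injective b -> (forall i, 0 <= b i) ->
  \sum_i b i = \sum_i delta N i + d%:Z ->
  exists t w, is_part t /\ b = perm_pos w (shifted_part t).
Proof.
move=> b_inj b_ge0 sb; have [a [w [dec bE da]]] := injective_sort b_inj b_ge0.
pose lam (i : 'I_N) := `|a i - delta N i|%N.
have lamE i : (lam i)%:Z = a i - delta N i by rewrite gez0_abs // subr_ge0.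
have slam : (\sum_i lam i = d)%N.
  apply/eqP; rewrite -eqz_nat (big_morph Posz PoszD (erefl _)); apply/eqP.
  under eq_bigr do rewrite lamE.
  have sa : \sum_i a i = \sum_i b i.
    rewrite bE [LHS](reindex_inj (@perm_inj _ w)).
    by apply: eq_bigr => i _; rewrite ffunE.
  by rewrite sumrB sa sb addrAC subrr add0r.
have lam_dec (i j : 'I_N) : (i <= j)%N -> (lam j <= lam i)%N.
  rewrite leq_eqVlt => /predU1P[/ord_inj -> //|].
  have [n] := ubnP (j - i)%N; elim: n j => // n IH j; rewrite ltnS => nj ij.
  case: j => [[//|j] jN] in nj ij *.
  have jN' := ltnW jN.
  have step : (lam (Ordinal jN) <= lam (Ordinal jN'))%N.
    rewrite -lez_nat !lamE.
    have := @dec (Ordinal jN') (Ordinal jN) (ltnSn _).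
    have -> : delta N (Ordinal jN') = delta N (Ordinal jN) + 1 by rewrite !ffunE /=; have := jN; lia.
    by move: (a _) (a _) (delta N _) => x y z; lia.
  apply: leq_trans step _; move: ij; rewrite ltnS leq_eqVlt => /predU1P[e|ij].
    by have -> : i = Ordinal jN' by apply: ord_inj.
  by apply: IH => //=; move: nj ij => /=; lia.
have lam_le i : (lam i < d.+1)%N by rewrite ltnS -slam (bigD1 i) //= leq_addr.
(* A nonzero row of index [d] or more would make the first d + 1 rows nonzero, with sum exceeding
   [d]. *)
have lam0 (i : 'I_N) : (d <= i)%N -> lam i = 0%N.
  move=> di; apply/eqP; rewrite -leqn0 leqNgt; apply/negP => lt.
  have : (\sum_(j < N | (j < d.+1)%N) 1 <= \sum_j lam j)%N.
    rewrite [X in (_ <= X)%N](bigID (fun j : 'I_N => (j < d.+1)%N)) /=.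
    apply: leq_trans (leq_addr _ _); apply: leq_sum => j jd.
    by apply: leq_trans lt _; apply: lam_dec; apply: leq_trans di; rewrite -ltnS.
  rewrite -(big_ord_widen N (fun=> 1%N)) ?(leq_ltn_trans di) // sum_nat_const card_ord muln1.
  by rewrite slam ltnn.
pose t : partition := [tuple Ordinal (lam_le (widen_ord dN i)) | i < d].
have tE (i : 'I_N) : nth 0%N (map val t) i = lam i.
  have [id|di] := ltnP i d; last by rewrite nth_default ?lam0 // size_map size_tuple.
  rewrite (nth_map ord0) ?size_tuple // -[i in nth _ _ i]/(nat_of_ord (Ordinal id)) -tnth_nth tnth_mktuple /=.
  by congr lam; apply: ord_inj.
exists t, w; split; last first.
  rewrite bE; congr perm_pos; apply/ffunP=> i.
  by rewrite shifted_partE tE lamE subrK.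
rewrite /is_part /is_partition; apply/andP; split.
  apply/(sortedP 0%N) => i; rewrite size_map size_tuple => id.
  have iN : (i.+1 < N)%N by apply: leq_trans dN.
  have := tE (Ordinal iN); have := tE (Ordinal (ltnW iN)) => /= -> ->.
  exact/lam_dec/leqnSn.
rewrite sumnE (big_nth 0%N) size_map size_tuple big_mkord -[X in _ == X]slam; apply/eqP.
rewrite (big_ord_widen _ (fun i => nth 0%N (map val t) i) dN) big_mkcond.
by apply: eq_bigr => i _; rewrite tE; case: ltnP => // di; rewrite lam0.
Qed.

(** Antisymmetrised configurations of partitions form a basis: each [b] in the support is a
    permutation of exactly one [shifted_part t], by exactly one [w]. *)
Lemma alternating_expansion (psi : pos -> rat) b : alternating psi ->
  (forall a, psi a != 0 -> (forall i, 0 <= a i) /\ \sum_i a i = \sum_i delta N i + d%:Z) ->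
  psi b = \sum_(t | is_part t) \sum_(w : 'S_N)
     (-1) ^+ w * (b == perm_pos w (shifted_part t))%:R * psi (shifted_part t).
Proof.
move=> alt supp.
have term t w : (-1) ^+ w * (b == perm_pos w (shifted_part t))%:R * psi (shifted_part t) =
    (b == perm_pos w (shifted_part t))%:R * psi b.
  by case: eqP => [e|_]; rewrite ?mulr0 ?mul0r // mul1r mulr1 [in RHS]e alt.
under eq_bigr do under eq_bigr do rewrite term.
have [-> | nz] := eqVneq (psi b) 0.
  by rewrite big1 // => t _; rewrite big1 // => w _; rewrite mulr0.
have [b0 sb] := supp _ nz.
have [t0 [w0 [tp0 bE]]] := shifted_part_onto (alternating_neq0_inj alt nz) b0 sb.
rewrite (bigD1 t0) //= [X in _ + X]big1 => [|t /andP[tp tt0]]; last first.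
  rewrite big1 // => w _; case: eqP => [e|_]; last by rewrite mul0r.
  case/eqP: tt0; apply: shifted_part_inj; apply: (@decreasing_perm _ _ w w0).
  - exact: decreasing_shifted_part.
  - exact: decreasing_shifted_part.
  - by rewrite -e -bE.
rewrite addr0 (bigD1 w0) //= [X in _ + X]big1 => [|w ww0].
  by rewrite bE eqxx mul1r addr0.
case: eqP => [e|_]; last by rewrite mul0r.
case/eqP: ww0; apply/permP => i.
apply: (decreasing_inj (decreasing_shifted_part tp0)).
by have := e; rewrite bE => /ffunP/(_ i); rewrite !ffunE.
Qed.

End AlternatingExpansion.

(** * The sum over partitions as a vacuum expectation *)

Section HurwitzMatrixElement.
Variable N : nat.
Notation pos := {ffun 'I_N -> int}.
Implicit Types (a b : pos) (phi psi : pos -> rat).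

Lemma sum_unit_pos (i : 'I_N) k : \sum_j unit_pos i k j = k.
Proof.
rewrite (bigD1 i) //= big1 ?addr0 => [|j ji]; first by rewrite ffunE eqxx.
by rewrite ffunE (negPf ji).
Qed.

Lemma energy_ops_homogeneous (s : seq (int * {poly rat})) a :
  energy_ops s (@vacuum N) a != 0 ->
  \sum_i a i = \sum_i delta N i - \sum_(p <- s) p.1.
Proof.
elim: s a => [|[k f] s IH] a /=.
  move=> /vacuum_neq0 [w ->]; rewrite big_nil subr0.
  by rewrite [RHS](reindex_inj (@perm_inj _ w)); apply: eq_bigr => i _; rewrite ffunE.
rewrite /energy_op /shift_op => nz.
have [i] : exists i, energy_ops s (@vacuum N) (a + unit_pos i k) != 0.
  apply/existsP; apply: contraNT nz; rewrite negb_exists => /forallP h.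
  apply/eqP; apply: big1 => i _; have := h i; rewrite negbK => /eqP ->.
  exact: mulr0.
move/IH; rewrite big_cons opprD addrCA => <-.
have -> : \sum_j (a + unit_pos i k) j = \sum_j a j + k.
  by rewrite -{2}(sum_unit_pos i k) -big_split; apply: eq_bigr => j _; rewrite ffunE.
by rewrite addrCA addNr addr0.
Qed.

Lemma energy_ops_ge0 (s : seq (int * {poly rat})) a i :
  energy_ops s (@vacuum N) a != 0 -> 0 <= a i.
Proof.
by move=> nz; have [] := deep_energy_ops (s := s) (@alternating_vacuum N) (@deep_vacuum N) nz.
Qed.

(** The cut-off at level 0 is invisible here: a particle raised from a nonnegative level stays
    nonnegative. *)
Lemma energy_ops_raise (nu : seq nat) :
  energy_ops [seq (- k%:Z, 1) | k <- nu] (@vacuum N) =1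
  cycle_sums [seq k%:Z | k <- nu] (@vacuum N).
Proof.
elim: nu => // k nu IH a; rewrite /cycle_sums /= -/(cycle_sums _ _).
apply: eq_bigr => i _.
have uE : a - unit_pos i k = a + unit_pos i (- k%:Z).
  by apply/ffunP=> j; rewrite !ffunE; case: eqP; rewrite ?oppr0.
rewrite -IH uE; set x := energy_ops _ _ _.
have [->|nz] := eqVneq x 0; first by rewrite mulr0.
have := energy_ops_ge0 i nz; rewrite ffunE [unit_pos _ _ _]ffunE eqxx => ge.
have a0 : 0 <= a i by apply: le_trans ge _; rewrite gerDl oppr_le0.
by rewrite windowE // hornerC mul1r.
Qed.

Lemma energy_ops_lower (mu : seq nat) psi a : (forall i, 0 <= a i) ->
  energy_ops [seq (k%:Z, 1) | k <- mu] psi a =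
  \sum_(f : {ffun 'I_(size mu) -> 'I_N})
     psi (a + \sum_(p < size mu) unit_pos (f p) (nth 0%N mu p)%:Z).
Proof.
move=> a0.
have -> : energy_ops [seq (k%:Z, 1) | k <- mu] psi a =
  foldr (fun k phi a => \sum_(i | true) phi (a - (- unit_pos i k%:Z))) psi mu a.
  elim: mu a a0 => //= k mu IH a a0; apply: eq_bigr => i _; rewrite opprK.
  have ak : 0 <= a i + k%:Z by rewrite addr_ge0.
  rewrite windowE // hornerC mul1r IH // => j.
  by rewrite !ffunE; case: eqP => _; rewrite ?addr0 // addr_ge0.
rewrite (foldr_sum_ffun (fun _ _ => true) (fun k i => - unit_pos i k%:Z) psi 0%N a (erefl (size mu))).
apply: eq_big => [f|f _]; first by apply/forallP.
by congr psi; rewrite sumrN opprK.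
Qed.

(** Lowering is adjoint to raising: expanding [psi] over partitions inserts a complete family of
    intermediate states. *)
Lemma lower_raise_adjoint d (mu : seq nat) psi : (d <= N)%N -> alternating psi ->
  (forall a, psi a != 0 -> (forall i, 0 <= a i) /\ \sum_i a i = \sum_i delta N i + d%:Z) ->
  \sum_(t : d.-tuple 'I_d.+1 | is_part t)
     cycle_sums [seq k%:Z | k <- mu] (@vacuum N) (shifted_part N t) * psi (shifted_part N t) =
  energy_ops [seq (k%:Z, 1) | k <- mu] psi (delta N).
Proof.
move=> dN alt supp.
rewrite energy_ops_lower => [|i]; last by rewrite ffunE.
pose U (f : {ffun 'I_(size mu) -> 'I_N}) : pos :=
  \sum_(p < size mu) unit_pos (f p) (nth 0%N mu p)%:Z.
under [RHS]eq_bigr do rewrite (alternating_expansion dN _ alt supp).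
rewrite [RHS]exchange_big /=; apply: eq_bigr => t tp.
under [RHS]eq_bigr do rewrite -mulr_suml.
rewrite -mulr_suml; congr (_ * _).
rewrite /cycle_sums (foldr_sum_ffun (fun _ _ => true) (fun k i => unit_pos i k) _ 0
  (l := size mu)) ?size_map // [LHS](eq_bigl xpredT) => [|f]; last by apply/forallP.
have UE (f : {ffun 'I_(size mu) -> 'I_N}) :
    \sum_(p < size mu) unit_pos (f p) (nth 0 [seq k%:Z | k <- mu] p) = U f.
  by apply: eq_bigr => p _; rewrite (nth_map 0%N).
under eq_bigr do rewrite UE.
rewrite /vacuum exchange_big [RHS]exchange_big /=.
(* The permutation passes from the intermediate state to the vacuum, hence the inverse. *)
rewrite [RHS](reindex_inj invg_inj); apply: eq_bigr => w _.
pose tw (f : {ffun 'I_(size mu) -> 'I_N}) : {ffun 'I_(size mu) -> 'I_N} := [ffun p => w (f p)].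
have tw_inj : injective tw.
  move=> f f' /ffunP e; apply/ffunP=> p; apply: (@perm_inj _ w).
  by have := e p; rewrite !ffunE.
rewrite [RHS](reindex_inj tw_inj); apply: eq_bigr => f _.
rewrite odd_permV; congr (_ * (nat_of_bool _)%:R).
have Uw : U (tw f) = perm_pos w^-1 (U f).
  apply/ffunP=> j; rewrite [RHS]ffunE !sum_ffunE; apply: eq_bigr => p _.
  by rewrite !ffunE (can2_eq (permKV w) (permK w)).
have wK : cancel (@perm_pos N w^-1) (perm_pos w).
  by move=> b; rewrite perm_posM mulgV perm_pos1.
rewrite -/(U (tw f)) Uw subr_eq -[LHS](inj_eq (can_inj wK)) [LHS]eq_sym.
by rewrite perm_posD perm_posM mulVg perm_pos1.
Qed.

Lemma iter_cycle_op r s phi a : iter s (@cycle_op N r) phi a = charge r a ^+ s * phi a.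
Proof. by elim: s => [|s IH] /=; rewrite ?expr0 ?mul1r // /cycle_op IH exprS mulrA. Qed.

Lemma alternating_iter_cycle_op r s phi : alternating phi -> alternating (iter s (@cycle_op N r) phi).
Proof. by move=> alt; elim: s => //= s IH; apply: alternating_cycle_op. Qed.

Theorem hurwitz_matrix_element r s (mu nu : seq nat) :
  all (leq 1) mu -> all (leq 1) nu -> sumn mu = sumn nu -> (sumn mu <= N)%N ->
  double_hurwitz r s mu nu =
  ((\prod_(a <- mu) a)%N * (\prod_(b <- nu) b)%N)%:R^-1 *
  ratr (energy_ops [seq (k%:Z, 1) | k <- mu] (iter s (cycle_op r)
    (energy_ops [seq (- k%:Z, 1) | k <- nu] (@vacuum N))) (delta N)).
Proof.
move=> mu_pos nu_pos mn dN; rewrite /double_hurwitz; congr (_ * _).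
set d := sumn mu in dN *.
pose phi := energy_ops [seq (- k%:Z, 1) | k <- nu] (@vacuum N).
have altp : alternating phi by apply/alternating_energy_ops/alternating_vacuum.
rewrite -(lower_raise_adjoint mu dN (alternating_iter_cycle_op r s altp)); last first.
  move=> a; rewrite iter_cycle_op mulf_eq0 negb_or => /andP[_ nz].
  split=> [i|]; first exact: energy_ops_ge0 nz.
  rewrite (energy_ops_homogeneous nz) big_map sumrN opprK; congr (_ + _).
  by rewrite /d mn sumnE (big_morph Posz PoszD (erefl _)).
rewrite rmorph_sum; apply: eq_bigr => t tp.
have st : size (map val t) = d by rewrite size_map size_tuple.
rewrite (chi_at_cycle_sums tp st dN mu_pos) // (chi_at_cycle_sums tp st dN nu_pos) //.
rewrite (shifted_power_sum_charge st dN) iter_cycle_op.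
by rewrite /phi energy_ops_raise /= !rmorphM /= rmorphXn /= mulrA.
Qed.

End HurwitzMatrixElement.

(** * Chambers *)

From mathcomp Require Import all_classical all_reals all_analysis.
From mathcomp Require mpoly.
Import (canonicals) mpoly.
Import numFieldNormedType.Exports.

Section ChamberSigns.
Variables (R : realType) (m n : nat).

Lemma continuous_coord_sum (p : nat) (I : {set 'I_p}) (f : 'I_p -> 'I_(m + n)) :
  continuous (fun v : 'rV[R]_(m + n) => \sum_(i in I) v ord0 (f i)).
Proof.
apply: (@continuous_big _ _ _ _ _ add_continuous).
by move=> i _; apply: coord_continuous.
Qed.

(** The chamber is connected and the linear form has no zero on it, so its image is an interval
    missing 0. *)
Lemma chamber_sign (c : set 'rV[R]_(m + n)) (I : {set 'I_m}) (J : {set 'I_n}) :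
  is_chamber c -> is_wall_index I J ->
  (forall v, c v -> 0 < \sum_(i in I) xcoord v i - \sum_(j in J) ycoord v j) \/
  (forall v, c v -> \sum_(i in I) xcoord v i - \sum_(j in J) ycoord v j < 0).
Proof.
move=> [v0 _ ->] IJ; set c' := connected_component _ v0.
pose f (v : 'rV[R]_(m + n)) : R := \sum_(i in I) xcoord v i - \sum_(j in J) ycoord v j.
have f0 v : c' v -> f v != 0.
  move/connected_component_sub => [vV nw]; apply/eqP => fv; apply: nw.
  by exists (I, J).
have cf : continuous f.
  move=> v; apply: continuousB; exact: continuous_coord_sum.
have cc : connected c' by apply: component_connected.
have /connected_intervalP itv : connected (f @` c')%classic.
  by apply: connected_continuous_connected cc _; apply: continuous_subspaceT.
have [[v cv fv]|none] := pselect (exists2 v, c' v & 0 < f v).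
  left=> w cw; rewrite -/(f w) ltNge; apply/negP => fw.
  have [u cu fu] : (f @` c')%classic 0.
    by apply: (itv (f w) (f v)); [exists w|exists v|rewrite fw ltW].
  by have := f0 u cu; rewrite fu eqxx.
right=> w cw; rewrite -/(f w) lt_neqAle f0 //= leNgt; apply/negP => fw.
by apply: none; exists w.
Qed.

End ChamberSigns.

(** * The recursion applied to the profiles of a chamber *)

Section ChamberPolynomial.
Variables (R : realType) (m n : nat) (c : set 'rV[R]_(m + n)).
Hypothesis hc : is_chamber c.

Definition profiles : Type := {p : m.-tuple nat * n.-tuple nat |
  [/\ forall i, (0 < tnth p.1 i)%N, forall j, (0 < tnth p.2 j)%N
    & c (profile_point R p.1 p.2)]}.
Implicit Types th : profiles.

Definition mu_of th : m.-tuple nat := (sval th).1.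
Definition nu_of th : n.-tuple nat := (sval th).2.

Definition energy (t : 'I_(m + n)) th : int :=
  match fintype.split t with
  | inl i => (tnth (mu_of th) i)%:Z
  | inr j => - (tnth (nu_of th) j)%:Z
  end.

Definition mvar (t : 'I_(m + n)) : mpoly.mpoly (m + n) rat :=
  mpoly.mpolyX rat (mpoly.mnm1 t).

Definition energy_var (t : 'I_(m + n)) : mpoly.mpoly (m + n) rat :=
  if fintype.split t is inl _ then mvar t else - mvar t.

Definition evaluation th : {rmorphism mpoly.mpoly (m + n) rat -> rat} :=
  mpoly.meval (fun k => profile_point rat (mu_of th) (nu_of th) 0 k).

Lemma energy_lshift i th : energy (lshift n i) th = (tnth (mu_of th) i)%:Z.
Proof. by rewrite /energy (unsplitK (inl i)). Qed.

Lemma energy_rshift j th : energy (rshift m j) th = - (tnth (nu_of th) j)%:Z.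
Proof. by rewrite /energy (unsplitK (inr j)). Qed.

Lemma evaluation_mvar t th : evaluation th (mvar t) = profile_point rat (mu_of th) (nu_of th) 0 t.
Proof. exact: mpoly.mevalXU. Qed.

Lemma profile_pointl (K : nzRingType) (mu : m.-tuple nat) (nu : n.-tuple nat) i :
  profile_point K mu nu 0 (lshift n i) = (tnth mu i)%:R.
Proof. by rewrite row_mxEl mxE. Qed.

Lemma profile_pointr (K : nzRingType) (mu : m.-tuple nat) (nu : n.-tuple nat) j :
  profile_point K mu nu 0 (rshift m j) = (tnth nu j)%:R.
Proof. by rewrite row_mxEr mxE. Qed.

Lemma evaluation_energy_var t th : evaluation th (energy_var t) = (energy t th)%:~R.
Proof.
case: (split_ordP t) => [i ->|j ->].
  by rewrite energy_lshift /energy_var (unsplitK (inl i)) evaluation_mvar profile_pointl.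
rewrite energy_rshift /energy_var (unsplitK (inr j)) rmorphN evaluation_mvar profile_pointr.
by rewrite intrN.
Qed.

Lemma sum_profiles th : \sum_i (tnth (mu_of th) i)%:Z = \sum_j (tnth (nu_of th) j)%:Z.
Proof.
have csub v : c v -> hurwitz_space v.
  by have [v0 _ ->] := hc; move=> /connected_component_sub [].
case: (svalP th) => _ _ /csub.
rewrite /hurwitz_space /= /xcoord /ycoord.
under eq_bigr do rewrite profile_pointl.
under [in X in _ = X -> _]eq_bigr do rewrite profile_pointr.
rewrite -!natr_sum => /eqP; rewrite eqr_nat => /eqP e.
by rewrite -!(big_morph Posz PoszD (erefl _)) e.
Qed.

Lemma total_energy th : \sum_t energy t th = 0.
Proof.
rewrite big_split_ord /=.
under eq_bigr do rewrite energy_lshift.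
under [X in _ + X]eq_bigr do rewrite energy_rshift.
by rewrite sumrN sum_profiles subrr.
Qed.

(** Proper nonempty [I] and [J] define a wall, and the chamber fixes the sign. In the boundary cases
    positivity of the parts decides, after passing to complements by [sum_profiles]. *)
Lemma energy_const_sign (S : seq 'I_(m + n)) :
  uniq S -> S != [::] -> (size S < #|'I_(m + n)|)%N ->
  (forall th, 0 < energy_sum energy S th) \/ (forall th, energy_sum energy S th < 0).
Proof.
move=> uS S0 sS.
pose I := [set i | lshift n i \in S]; pose J := [set j | rshift m j \in S].
have energy_sumE th : energy_sum energy S th =
    \sum_(i in I) (tnth (mu_of th) i)%:Z - \sum_(j in J) (tnth (nu_of th) j)%:Z.
  rewrite /energy_sum big_uniq //= big_mkcond big_split_ord /= -sumrN.
  congr (_ + _); rewrite [RHS]big_mkcond; apply: eq_bigr => k _; rewrite inE.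
    by rewrite energy_lshift.
  by rewrite energy_rshift.
have pos_mu th (A : {set 'I_m}) : A != finset.set0 -> 0 < \sum_(i in A) (tnth (mu_of th) i)%:Z.
  case: (svalP th) => mu0 _ _ /finset.set0Pn [i iA].
  by rewrite (bigD1 i) //= ltr_pwDl ?ltz_nat ?mu0 // sumr_ge0.
have pos_nu th (A : {set 'I_n}) : A != finset.set0 -> 0 < \sum_(j in A) (tnth (nu_of th) j)%:Z.
  case: (svalP th) => _ nu0 _ /finset.set0Pn [j jA].
  by rewrite (bigD1 j) //= ltr_pwDl ?ltz_nat ?nu0 // sumr_ge0.
have setC_sum (p : nat) (A : {set 'I_p}) (f : 'I_p -> int) :
    \sum_(i in A) f i = \sum_i f i - \sum_(i in ~: A) f i.
  have -> : \sum_(i in ~: A) f i = \sum_(i | i \notin A) f i.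
    by apply: eq_bigl => i; rewrite finset.in_setC.
  by rewrite [X in _ = X - _](bigID (mem A)) /= addrK.
have IJ0 : (I != finset.set0) || (J != finset.set0).
  have [t tS] : exists t, t \in S by case: (S) S0 => // t s _; exists t; rewrite mem_head.
  case: (split_ordP t) => [i te|j te]; apply/orP; [left|right]; apply/finset.set0Pn.
    by exists i; rewrite inE -te.
  by exists j; rewrite inE -te.
have IJT : (I != [set: 'I_m]%SET) || (J != [set: 'I_n]%SET).
  rewrite -negb_and; apply: contraL sS => /andP[/eqP/setP IT /eqP/setP JT].
  rewrite -leqNgt -(card_uniqP uS); apply/subset_leq_card/fintype.subsetP => t _.
  case: (split_ordP t) => [i ->|j ->]; first by have := IT i; rewrite !inE.
  by have := JT j; rewrite !inE.
have [I0|I0] := eqVneq I finset.set0.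
  right=> th; rewrite energy_sumE I0 finset.big_set0 sub0r oppr_lt0; apply: pos_nu.
  by move: IJ0; rewrite I0 eqxx.
have [J0|J0] := eqVneq J finset.set0.
  by left=> th; rewrite energy_sumE J0 finset.big_set0 subr0; apply: pos_mu.
(* With every mu_i present the energy is the sum of the nu_j outside [J]. *)
have [IT|IT] := eqVneq I [set: 'I_m]%SET.
  left=> th; rewrite energy_sumE IT setC_sum finset.setCT finset.big_set0 subr0 (setC_sum _ J) sum_profiles.
  rewrite opprB addrCA subrr addr0; apply: pos_nu.
  by rewrite -finset.setCT (inj_eq (@finset.setC_inj _)); move: IJT; rewrite IT eqxx.
have [JT|JT] := eqVneq J [set: 'I_n]%SET.
  right=> th; rewrite energy_sumE JT [X in _ - X]setC_sum finset.setCT finset.big_set0.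
  rewrite subr0 (setC_sum _ I) sum_profiles.
  rewrite addrAC subrr sub0r oppr_lt0; apply: pos_mu.
  by rewrite -finset.setCT (inj_eq (@finset.setC_inj _)).
have realE th : (energy_sum energy S th)%:~R =
   \sum_(i in I) xcoord (profile_point R (mu_of th) (nu_of th)) i -
   \sum_(j in J) ycoord (profile_point R (mu_of th) (nu_of th)) j.
  rewrite energy_sumE intrD intrN !rmorph_sum /=; congr (_ - _); apply: eq_bigr => k _.
    by rewrite /xcoord profile_pointl.
  by rewrite /ycoord profile_pointr.
have IJ : is_wall_index I J by rewrite /is_wall_index I0 IT J0 JT.
have [sgn|sgn] := chamber_sign hc IJ; [left|right] => th.
  by rewrite -(ltr_int R) realE; apply: sgn; case: (svalP th).
by rewrite -(ltr_int R) realE; apply: sgn; case: (svalP th).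
Qed.

Definition mu_items : seq (seq 'I_(m + n) * option {poly mpoly.mpoly (m + n) rat}) :=
  [seq ([:: lshift n i], None) | i <- enum 'I_m].
Definition nu_items : seq (seq 'I_(m + n) * option {poly mpoly.mpoly (m + n) rat}) :=
  [seq ([:: rshift m j], None) | j <- enum 'I_n].

Lemma covers_items : covers (mu_items ++ nu_items).
Proof.
split; last by rewrite all_cat !all_map; apply/andP; split; apply/allP.
have mu_fl : flatten [seq it.1 | it <- mu_items] = [seq lshift n i | i <- enum 'I_m].
  by rewrite /mu_items; elim: (enum _) => //= i s ->.
have nu_fl : flatten [seq it.1 | it <- nu_items] = [seq rshift m j | j <- enum 'I_n].
  by rewrite /nu_items; elim: (enum _) => //= j s ->.
rewrite map_cat flatten_cat mu_fl nu_fl.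
apply: uniq_perm; rewrite ?enum_uniq //.
  rewrite cat_uniq (map_inj_uniq (@lshift_inj _ _)) (map_inj_uniq (@rshift_inj _ _)).
  rewrite !enum_uniq andbT /=.
  apply/hasPn => t /mapP[j _ ->]; apply/mapP => -[i _ /eqP].
  by rewrite eq_rlshift.
move=> t; rewrite mem_cat mem_enum; case: (split_ordP t) => [i ->|j ->].
  by rewrite map_f ?mem_enum.
by rewrite orbC map_f ?mem_enum.
Qed.

Lemma sumn_tuple (p : nat) (t : p.-tuple nat) : sumn t = (\sum_i tnth t i)%N.
Proof. by rewrite sumnE big_tuple. Qed.

Lemma sumn_le_levels th : (sumn (mu_of th) <= levels energy th)%N.
Proof.
rewrite sumn_tuple /levels big_split_ord /= -[X in (X <= _)%N]addn0; apply: leq_add => //.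
by apply: leq_sum => i _; rewrite energy_lshift absz_nat.
Qed.

Lemma map_mu_items th :
  [seq item_ev evaluation energy th it | it <- mu_items] =
  [seq (k%:Z, 1) | k <- mu_of th].
Proof.
rewrite -map_comp -[in RHS](map_tnth_enum (mu_of th)) -map_comp; apply: eq_map => i /=.
by rewrite /item_ev /item_poly /= rmorph1 /energy_sum big_seq1 energy_lshift.
Qed.

Lemma map_nu_items th :
  [seq item_ev evaluation energy th it | it <- nu_items] =
  [seq (- k%:Z, 1) | k <- nu_of th].
Proof.
rewrite -map_comp -[in RHS](map_tnth_enum (nu_of th)) -map_comp; apply: eq_map => j /=.
by rewrite /item_ev /item_poly /= rmorph1 /energy_sum big_seq1 energy_rshift.
Qed.

(** Each nu_j enters through the energy - nu_j, whence the sign. *)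
Lemma evaluation_factor th :
  evaluation th (pending_factor energy_var (mu_items ++ nu_items)) =
  (-1) ^+ n * ((\prod_(a <- mu_of th) a)%N * (\prod_(b <- nu_of th) b)%N)%:R.
Proof.
have mu_prod : \prod_(it <- mu_items) item_fac energy_var it =
    \prod_(i < m) energy_var (lshift n i).
  rewrite /mu_items big_map big_enum /=; apply: eq_bigr => i _.
  by rewrite /item_fac /var_sum big_seq1.
have nu_prod : \prod_(it <- nu_items) item_fac energy_var it =
    \prod_(j < n) energy_var (rshift m j).
  rewrite /nu_items big_map big_enum /=; apply: eq_bigr => j _.
  by rewrite /item_fac /var_sum big_seq1.
rewrite /pending_factor big_cat mu_prod nu_prod /= rmorphM !rmorph_prod natrM !natr_prod.
rewrite !big_tuple /= mulrCA; congr (_ * _).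
  by apply: eq_bigr => i _; rewrite evaluation_energy_var energy_lshift.
rewrite -[n in (-1) ^+ n]card_ord -prodr_const -big_split /=; apply: eq_bigr => j _.
by rewrite evaluation_energy_var energy_rshift intrN mulN1r.
Qed.

Lemma chamber_polynomial r s : (1 <= m)%N -> (1 <= n)%N -> ~ (s = 0%N /\ m = 1%N /\ n = 1%N) ->
  exists P : mpoly.mpoly (m + n) rat, forall th,
    double_hurwitz r s (mu_of th) (nu_of th) = ratr (evaluation th P).
Proof.
move=> m0 n0 hst.
have sz : size (mu_items ++ nu_items) = (m + n)%N 
  by rewrite size_cat (size_map _ (enum 'I_m)) (size_map _ (enum 'I_n)) !size_enum_ord.
pose const : {rmorphism rat -> mpoly.mpoly (m + n) rat} := @mpoly.mpolyC (m + n) rat.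
have ev_const th q : evaluation th (const q) = q by apply: mpoly.mevalC.
have [||Q QE] := cycle_element_polyP evaluation_energy_var ev_const
  energy_const_sign total_energy r (n := s) covers_items.
- by rewrite sz; lia.
(* If m + n < 3 then m = n = 1, and the excluded case leaves s > 0. *)
- rewrite sz; apply/or3P; have [|lt] := leqP 3 (m + n); first by constructor.
  constructor 3; rewrite lt0n; apply/eqP => s0; apply: hst; split=> //; lia.
(* The constant undoes the sign in [evaluation_factor]. *)
exists (const ((-1) ^+ n) * Q) => th.
have all1 (p : nat) (t : p.-tuple nat) : (forall i, (0 < tnth t i)%N) -> all (leq 1) t.
  by move=> h; apply/all_tnthP.
case: (svalP th) => mu0 nu0 _.
rewrite (hurwitz_matrix_element r s (all1 _ _ mu0) (all1 _ _ nu0) _ (sumn_le_levels th)); last first.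
  rewrite !sumn_tuple; apply/eqP; rewrite -eqz_nat !(big_morph Posz PoszD (erefl _)).
  by rewrite sum_profiles.
have := QE th; rewrite map_mu_items map_nu_items => ->.
set p := (_ * _)%N; have p0 : p%:R != 0 :> algC.
  by rewrite pnatr_eq0 -lt0n muln_gt0 !big_tuple !prodn_gt0.
have factorE : evaluation th (pending_factor energy_var (mu_items ++ nu_items) * Q) =
    p%:R * evaluation th (const ((-1) ^+ n) * Q).
  have -> : evaluation th (const ((-1) ^+ n) * Q) = (-1) ^+ n * evaluation th Q.
    by apply: etrans (rmorphM (evaluation th) _ _) _; rewrite ev_const.
  apply: etrans (rmorphM (evaluation th) _ _) _.
  by rewrite evaluation_factor -/p mulrA [p%:R * _]mulrC.
by rewrite factorE [ratr (_ * _)]rmorphM /= ratr_nat mulKf.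
Qed.

End ChamberPolynomial.

(* The degenerate case s = 0, m = n = 1 is excluded: there the only chamber is
   V itself and the Hurwitz number of the profiles (d), (d) is
   d^-2 * \sum_la (chi^la_(d))^2 = 1 / d, which is not polynomial in d. *)
Theorem theorem6p3 (R : realType) (r s m n : nat)
    (hr : (1 <= r)%N) (hm : (1 <= m)%N) (hn : (1 <= n)%N)
    (hstable : ~ (s = 0%N /\ m = 1%N /\ n = 1%N))
    (c : set 'rV[R]_(m + n)) (hc : is_chamber c) :
  exists P : mpoly.mpoly (m + n) rat,
    forall (mu : m.-tuple nat) (nu : n.-tuple nat),
      (forall i, (0 < tnth mu i)%N) -> (forall j, (0 < tnth nu j)%N) ->
      c (profile_point R mu nu) ->
      double_hurwitz r s mu nu =
        ratr (mpoly.meval (fun k => profile_point rat mu nu 0 k) P).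

Proof.
have [P PE] := chamber_polynomial hc r hm hn hstable.
exists P => mu nu mu0 nu0 cp.
have h : [/\ forall i, (0 < tnth (mu, nu).1 i)%N, forall j, (0 < tnth (mu, nu).2 j)%N
    & c (profile_point R (mu, nu).1 (mu, nu).2)] by [].
exact: PE (exist _ (mu, nu) h).
Qed.
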